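(* There exists a sequence $k_1,k_2,\dots\in\{1,2,3\}$ with the following property. Suppose that $X_0$ is a Gaussian random variable on a probability space $(\Omega,\mathcal{F},P)$ and that there exists a non-atomic $\sigma$-field $\mathcal{C}\subset\mathcal{F}$ which is independent of $X_0$. Then there exist three $\sigma$-fields $\mathcal{C}_1,\mathcal{C}_2,\mathcal{C}_3\subset\mathcal{F}$ such that the sequence $\{X_n\}$ defined by $$X_n=E(X_{n-1}\mid\mathcal{C}_{k_n}),\quad n\geq 1,$$ does not converge in probability.
   Context: $(\Omega,\mathcal{F},P)$ is a probability space and $E(\cdot\mid\mathcal{G})$ denotes conditional expectation on it with respect to a sub-$\sigma$-field $\mathcal{G}$ of $\mathcal{F}$. For a sub-$\sigma$-field $\mathcal{C}$ of $\mathcal{F}$, a set $B\in\mathcal{C}$ is called $\mathcal{C}$-atomic if $P(B)>0$ and every $\mathcal{C}$-measurable set $A\subset B$ satisfies $P(A)=0$ or $P(A)=P(B)$. The $\sigma$-field $\mathcal{C}$ is called non-atomic if it contains no $\mathcal{C}$-atomic set, i.e., for each $B\in\mathcal{C}$ with $P(B)>0$ there exists a $\mathcal{C}$-measurable set $A\subset B$ with $0<P(A)<P(B)$. The sequence $k_1,k_2,\dots$ is chosen first: it does not depend on the probability space, on $X_0$, or on $\mathcal{C}$. *)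

(* Defs.v *)
From HB Require Import structures.
From mathcomp Require Import all_boot all_order all_algebra.
From mathcomp Require Import all_classical all_reals all_analysis.

Set Implicit Arguments.
Unset Strict Implicit.
Unset Printing Implicit Defensive.

Import Order.TTheory GRing.Theory Num.Theory.
Import numFieldNormedType.Exports.

Local Open Scope classical_set_scope.
Local Open Scope ring_scope.

Definition sub_sigma_field (d : measure_display) (T : measurableType d)
    (G : set (set T)) : Prop :=
  sigma_algebra setT G /\ G `<=` measurable.

Section probability_notions.
Context (d : measure_display) (T : measurableType d) (R : realType).
Variable P : probability T R.

(* Non-degenerate: a constant X0 is a fixed point of every conditional
   expectation.  Laws are compared on measurable sets only, because the value
   of a measure elsewhere is meaningless. *)
Definition gaussian (X : {RV P >-> R}) : Prop :=
  exists m s : R, 0 < s /\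
    forall B : set R, measurable B -> distribution P X B = normal_prob m s B.

Definition atomic_set (C : set (set T)) (B : set T) : Prop :=
  [/\ C B, (0 < P B)%E
    & forall A, C A -> A `<=` B -> P A = 0%E \/ P A = P B].

Definition non_atomic (C : set (set T)) : Prop :=
  forall B, ~ atomic_set C B.

Definition independent_of_RV (C : set (set T)) (X : {RV P >-> R}) : Prop :=
  forall (A : set T) (B : set R), C A -> measurable B ->
    P (A `&` X @^-1` B) = (P A * P (X @^-1` B))%E.

(* Y is a version of E(X | G); versions are unique up to P-null sets. *)
Definition is_condexp (G : set (set T)) (X Y : T -> R) : Prop :=
  [/\ P.-integrable setT (EFin \o X),
      P.-integrable setT (EFin \o Y),
      forall B : set R, measurable B -> G (Y @^-1` B)
    & forall A, G A ->
        (\int[P]_(x in A) (Y x)%:E = \int[P]_(x in A) (X x)%:E)%E].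

(* k is used from index 1 on; the value k 0 is irrelevant. *)
Definition iterated_condexp (C : 'I_3 -> set (set T)) (k : nat -> 'I_3)
    (X0 : T -> R) (X : nat -> T -> R) : Prop :=
  X 0%N = X0 /\
  forall n : nat, (1 <= n)%N -> is_condexp (C (k n)) (X n.-1) (X n).

Definition converges_in_probability (X : nat -> T -> R) : Prop :=
  exists Y : {RV P >-> R}, forall e : R, 0 < e ->
    P [set x | e <= `|X n x - Y x|] @[n --> \oo] --> 0%E.

End probability_notions.

(* Main.v *)
Require Import Defs.
From HB Require Import structures.
From mathcomp Require Import all_boot all_order all_algebra.
From mathcomp Require Import all_classical all_reals all_analysis.
From mathcomp Require Import measurable_realfun lra ring zify.

(* In the linear span of an i.i.d. centred Gaussian family, conditioning on the
   sigma-field generated by a subspace is the orthogonal projection on that subspace: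
   rotations of the family preserve its law, and after a suitable one the residual is a
   multiple of a coordinate on which the sigma-field does not depend.  A non-atomic
   sigma-field supplies such a family next to X0: halving its sets repeatedly gives fair
   bits, these give uniform variables, and quantiles give Gaussian ones.

   It remains to find three subspaces of the space of finitely supported sequences and an
   order of projections for which the iterates of a unit vector diverge.  The first
   subspace W_E has an orthonormal basis e_0, e_1, ..., and the iterates travel along it,
   from near a fixed multiple of e_i to near the same multiple of e_(i+1), in N_i small
   turns with total loss O(1 / N_i).  A turn is an approximate projection along a unit
   vector v of the plane of e_i and e_(i+1): the word P_E (P_X P_Y)^s acts on this plane as
   1 - (1 - (1 - beta)^s) c v v^T up to errors coming from the other turns, and its m-th
   power nearly kills v.  The other turns have parameters c and beta of their own; those
   that do not matter at a given turn are made negligible by choosing c tiny for some of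
   them and beta tiny for the others. *)

Set Implicit Arguments.
Unset Strict Implicit.
Unset Printing Implicit Defensive.

Import Order.TTheory GRing.Theory Num.Theory.

Local Open Scope ring_scope.

(** * Projections of finitely supported sequences *)

(** Three projections and infinite dimension are both needed: alternating products of two
    projections converge in norm, and so do products of finitely many projections in finite
    dimension. The orbit has to wander through infinitely many directions while losing only a
    summable part of its length. The obstacle is that every turn needs its own unit vector v, while
    three subspaces serve infinitely many turns. The pair (c, beta) of a turn replaces the missing
    subspaces: the exponent s decides which beta have had time to act, and m which c are large
    enough to matter. As m is large compared with 1 / c, and s with 1 / beta, while the noise of the
    other turns is collected m times, the constants depend on each other and need an order in which
    to be chosen. All this takes place among finitely supported sequences, so that the order of the
    projections knows nothing of the probability space. Back there, a mean square distance bounded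
    below would not exclude convergence in probability for general variables; for Gaussian
    differences it bounds a tail probability from below. *)

Section finite_sequences.
Variable R : realType.
Implicit Types (x y z w : {poly R}) (a b : R).

(* A polynomial stands for the finitely supported sequence of its coefficients. *)
Definition dot x y : R := \sum_(i < size x) x`_i * y`_i.

Lemma dot_bound n x y : (size x <= n)%N -> dot x y = \sum_(i < n) x`_i * y`_i.
Proof.
move=> xn; rewrite /dot (big_ord_widen n (fun i => x`_i * y`_i) xn).
rewrite big_mkcond; apply: eq_bigr => i _; case: ifPn => //.
by rewrite -leqNgt => /(nth_default 0) ->; rewrite mul0r.
Qed.

Lemma dotC x y : dot x y = dot y x.
Proof.
rewrite (dot_bound y (leq_maxl (size x) (size y))).
rewrite (dot_bound x (leq_maxr (size x) (size y))).
by apply: eq_bigr => i _; rewrite mulrC.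
Qed.

Lemma dotDl x y z : dot (x + y) z = dot x z + dot y z.
Proof.
rewrite (dot_bound _ (size_polyD x y)).
rewrite (dot_bound z (leq_maxl (size x) (size y))).
rewrite (dot_bound z (leq_maxr (size x) (size y))) -big_split /=.
by apply: eq_bigr => i _; rewrite coefD mulrDl.
Qed.

Lemma dotZl a x y : dot (a *: x) y = a * dot x y.
Proof.
rewrite (dot_bound _ (size_scale_leq a x)) /dot big_distrr /=.
by apply: eq_bigr => i _; rewrite coefZ mulrA.
Qed.

Lemma dotNl x y : dot (- x) y = - dot x y.
Proof. by rewrite -scaleN1r dotZl mulN1r. Qed.

Lemma dotBl x y z : dot (x - y) z = dot x z - dot y z.
Proof. by rewrite dotDl dotNl. Qed.

Lemma dot0l x : dot 0 x = 0.
Proof. by rewrite -(scale0r x) dotZl mul0r. Qed.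

Lemma dot0r x : dot x 0 = 0. Proof. by rewrite dotC dot0l. Qed.

Lemma dotDr x y z : dot z (x + y) = dot z x + dot z y.
Proof. by rewrite !(dotC z) dotDl. Qed.

Lemma dotZr a x y : dot y (a *: x) = a * dot y x.
Proof. by rewrite !(dotC y) dotZl. Qed.

Lemma dotBr x y z : dot z (x - y) = dot z x - dot z y.
Proof. by rewrite !(dotC z) dotBl. Qed.

Lemma dot_suml I (r : seq I) (P : pred I) (F : I -> {poly R}) y :
  dot (\sum_(i <- r | P i) F i) y = \sum_(i <- r | P i) dot (F i) y.
Proof.
by elim/big_rec2: _ => [|i u v _ <-]; [rewrite dot0l|rewrite dotDl].
Qed.

Lemma dot_sumr I (r : seq I) (P : pred I) (F : I -> {poly R}) y :
  dot y (\sum_(i <- r | P i) F i) = \sum_(i <- r | P i) dot y (F i).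
Proof. by rewrite dotC dot_suml; apply: eq_bigr => i _; rewrite dotC. Qed.

Lemma dotXnl n x : dot 'X^n x = x`_n.
Proof.
rewrite /dot size_polyXn (bigD1 ord_max)//= coefXn eqxx mul1r big1 ?addr0//.
by move=> i /negbTE ni; rewrite coefXn -(inj_eq val_inj) /= in ni *; rewrite ni mul0r.
Qed.

Lemma dot_ge0 x : 0 <= dot x x.
Proof. by apply: sumr_ge0 => i _; rewrite -expr2 sqr_ge0. Qed.

Lemma dot_eq0 x : dot x x = 0 -> x = 0.
Proof.
move=> /eqP; rewrite psumr_eq0 => [/allP x0|i _]; last by rewrite -expr2 sqr_ge0.
apply/polyP => i; rewrite coef0; have [ix|/(nth_default 0)//] := ltnP i (size x).
have := x0 (Ordinal ix); rewrite mem_index_enum => /(_ isT)/= /eqP.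
by move=> /eqP; rewrite mulf_eq0 orbb => /eqP.
Qed.

Definition len x := Num.sqrt (dot x x).

Lemma len_ge0 x : 0 <= len x. Proof. exact: sqrtr_ge0. Qed.

Lemma sqr_len x : len x ^+ 2 = dot x x.
Proof. by rewrite sqr_sqrtr// dot_ge0. Qed.

Lemma lenZ a x : len (a *: x) = `|a| * len x.
Proof.
by rewrite /len dotZl dotZr mulrA -expr2 sqrtrM ?sqr_ge0// sqrtr_sqr.
Qed.

Lemma lenN x : len (- x) = len x.
Proof. by rewrite -scaleN1r lenZ normrN1 mul1r. Qed.

Lemma len0 : len 0 = 0. Proof. by rewrite /len dot0l sqrtr0. Qed.

(** Cauchy-Schwarz, by expanding the squared length of [len y *: x - len x *: y]. *)
Lemma dot_le_len x y : dot x y <= len x * len y.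
Proof.
have [y0|y0] := eqVneq (len y) 0.
  have /dot_eq0 -> : dot y y = 0 by rewrite -sqr_len y0 expr0n.
  by rewrite dot0r mulr_ge0// len_ge0.
have yp : 0 < len y by rewrite lt_def y0 len_ge0.
have := dot_ge0 (len y *: x - len x *: y).
rewrite !(dotBl, dotBr, dotZl, dotZr) -!sqr_len (dotC y x).
have [x0|x0] := eqVneq (len x) 0.
  have /dot_eq0 -> : dot x x = 0 by rewrite -sqr_len x0 expr0n.
  by rewrite dot0l mulr_ge0// len_ge0.
have xp : 0 < len x by rewrite lt_def x0 len_ge0.
move=> H; rewrite -subr_ge0 -(pmulr_rge0 _ (mulr_gt0 xp yp)).
by rewrite -(pmulr_rge0 _ (ltr0Sn R 1)); apply: le_trans H _; nra.
Qed.

Lemma lenD x y : len (x + y) <= len x + len y.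
Proof.
rewrite -(@ler_pXn2r _ 2) ?nnegrE ?addr_ge0 ?len_ge0//.
rewrite sqr_len dotDl !dotDr (dotC y x) -!sqr_len.
by have := dot_le_len x y; lra.
Qed.

Lemma lenB x y : len (x - y) <= len x + len y.
Proof. by rewrite -(lenN y); exact: lenD. Qed.

Lemma len_sum I (r : seq I) (P : pred I) (F : I -> {poly R}) :
  len (\sum_(i <- r | P i) F i) <= \sum_(i <- r | P i) len (F i).
Proof.
elim/big_rec2: _ => [|i u v _ uv]; first by rewrite len0.
by rewrite (le_trans (lenD _ _))// lerD2l.
Qed.

Inductive span (W : {poly R} -> Prop) : {poly R} -> Prop :=
| span0 : span W 0
| spanDZ a w y : W w -> span W y -> span W (a *: w + y).

Lemma spanD W x y : span W x -> span W y -> span W (x + y).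
Proof.
by move=> Wx Wy; elim: Wx => [|a w z Ww _ IH]; rewrite ?add0r// -addrA; exact: spanDZ.
Qed.

Lemma spanZ W a x : span W x -> span W (a *: x).
Proof.
elim=> [|b w z Ww _ IH]; first by rewrite scaler0; exact: span0.
by rewrite scalerDr scalerA; exact: spanDZ.
Qed.

Lemma span_gen (W : {poly R} -> Prop) w : W w -> span W w.
Proof.
by move=> Ww; rewrite -[w]addr0 -[w]scale1r; apply: spanDZ => //; exact: span0.
Qed.

Lemma spanB W x y : span W x -> span W y -> span W (x - y).
Proof. by move=> Wx Wy; rewrite -scaleN1r; apply: spanD => //; exact: spanZ. Qed.

Lemma span_orth (W : {poly R} -> Prop) x :
  (forall w, W w -> dot x w = 0) -> forall w, span W w -> dot x w = 0.
Proof.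
move=> xW w; elim=> [|a v z Wv _ IH]; first by rewrite dot0r.
by rewrite dotDr dotZr IH xW// mulr0 addr0.
Qed.

(** A relation and not a function: the space is not complete, so that the existence of a projection
    has to be proved for each subspace. *)
Definition is_proj (W : {poly R} -> Prop) x y :=
  span W y /\ forall w, W w -> dot (x - y) w = 0.

Lemma is_proj_orth W x y : is_proj W x y ->
  forall w, span W w -> dot (x - y) w = 0.
Proof. by move=> [_]; exact: span_orth. Qed.

Lemma is_projD W x y x' y' a : is_proj W x y -> is_proj W x' y' ->
  is_proj W (a *: x + x') (a *: y + y').
Proof.
move=> [Wy xy] [Wy' xy']; split; first by apply: spanD => //; exact: spanZ.
move=> w Ww; have := xy _ Ww; have := xy' _ Ww.
by rewrite !(dotBl, dotDl, dotZl); nra.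
Qed.

Lemma is_proj_uniq W x y y' : is_proj W x y -> is_proj W x y' -> y = y'.
Proof.
move=> pxy pxy'; have Wyy : span W (y - y') by apply: spanB; [case: pxy|case: pxy'].
apply/eqP; rewrite -subr_eq0; apply/eqP/dot_eq0.
have := is_proj_orth pxy Wyy; have := is_proj_orth pxy' Wyy.
by rewrite !dotBl; lra.
Qed.

Lemma is_proj_id W x : span W x -> is_proj W x x.
Proof. by move=> Wx; split=> // w _; rewrite subrr dot0l. Qed.

Lemma len_is_proj W x y : is_proj W x y -> len y <= len x.
Proof.
move=> pxy; rewrite -(@ler_pXn2r _ 2) ?nnegrE ?len_ge0// !sqr_len.
have := is_proj_orth pxy (pxy.1); have := dot_ge0 (x - y).
by rewrite !(dotBl, dotBr) (dotC y x); lra.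
Qed.

Lemma is_proj_total W : (forall n, exists y, is_proj W 'X^n y) ->
  forall x, exists y, is_proj W x y.
Proof.
move=> Wn x; rewrite -(coefK x) poly_def.
elim/big_rec: _ => [|i u _ [v uv]]; first by exists 0; exact/is_proj_id/span0.
by have [y ?] := Wn i; exists (x`_i *: y + v); exact: is_projD.
Qed.

End finite_sequences.

Section projections.
Variables (R : realType) (K : Type) (W : K -> {poly R} -> Prop).
Hypothesis W_total : forall k x, exists y, is_proj (W k) x y.

Definition proj k x := projT1 (cid (W_total k x)).

Lemma projP k x : is_proj (W k) x (proj k x).
Proof. exact: (projT2 (cid (W_total k x))). Qed.

Lemma projE k x y : is_proj (W k) x y -> proj k x = y.
Proof. exact/is_proj_uniq/projP. Qed.

Definition linfn (f : {poly R} -> {poly R}) :=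
  forall a x y, f (a *: x + y) = a *: f x + f y.

Definition contracting (f : {poly R} -> {poly R}) := forall x, len (f x) <= len x.

Lemma linfn_proj k : linfn (proj k).
Proof. by move=> a x y; apply: projE; apply: is_projD; exact: projP. Qed.

Lemma contracting_proj k : contracting (proj k).
Proof. by move=> x; exact/len_is_proj/projP. Qed.

(** The head of a word acts first. *)
Definition proj_word (s : seq K) x := foldl (fun x k => proj k x) x s.

Lemma proj_word_cat s t x : proj_word (s ++ t) x = proj_word t (proj_word s x).
Proof. exact: foldl_cat. Qed.

Lemma linfn_proj_word s : linfn (proj_word s).
Proof. by elim: s => // k s IH a x y; rewrite /= linfn_proj IH. Qed.

Lemma contracting_proj_word s : contracting (proj_word s).
Proof. by elim: s => // k s IH x; rewrite (le_trans (IH _))// contracting_proj. Qed.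

Section linfn_theory.
Variable f : {poly R} -> {poly R}.
Hypothesis f_lin : linfn f.

Lemma linfnD x y : f (x + y) = f x + f y.
Proof. by have := f_lin 1 x y; rewrite !scale1r. Qed.

Lemma linfn0 : f 0 = 0.
Proof. by apply/(addrI (f 0)); rewrite -linfnD !addr0. Qed.

Lemma linfnZ a x : f (a *: x) = a *: f x.
Proof. by have := f_lin a x 0; rewrite linfn0 !addr0. Qed.

Lemma linfnB x y : f (x - y) = f x - f y.
Proof. by rewrite linfnD -scaleN1r linfnZ scaleN1r. Qed.

Lemma linfn_sum I (r : seq I) (P : pred I) (F : I -> {poly R}) :
  f (\sum_(i <- r | P i) F i) = \sum_(i <- r | P i) f (F i).
Proof. by elim/big_rec2: _ => [|i u v _ <-]; rewrite ?linfn0// linfnD. Qed.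

Lemma linfn_iter m : linfn (iter m f).
Proof. by elim: m => [//|m IH] a x y; rewrite /= IH f_lin. Qed.

Lemma contracting_iter m : contracting f -> contracting (iter m f).
Proof. by move=> fc; elim: m => [|m IH] x /=; rewrite ?(le_trans (fc _)). Qed.

End linfn_theory.

Lemma proj_word_nseq m s x : proj_word (flatten (nseq m s)) x = iter m (proj_word s) x.
Proof. by elim: m x => // m IH x; rewrite /= proj_word_cat IH -iterSr. Qed.

End projections.

(** * A divergent product of three projections *)

Section parameters.
Variable R : realType.

(** Plays the part of an exponential bound: about [1 / (e * x)] factors bring the power below
    [e]. *)
Lemma pow_le_inv (x : R) n : 0 <= x <= 1 -> (1 - x) ^+ n * (1 + n%:R * x) <= 1.
Proof.
move=> /andP[x0 x1]; elim: n => [|n IH]; first by rewrite expr0 mul0r addr0 mul1r.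
apply: le_trans IH; rewrite exprS [_ * (_ ^+ n)]mulrC -mulrA.
rewrite ler_wpM2l ?exprn_ge0 ?subr_ge0//.
rewrite -natr1; have : (0 : R) <= n%:R by []. nra.
Qed.

Lemma ex_pow_small (x e : R) : 0 < x <= 1 -> 0 < e ->
  exists n, (0 < n)%N /\ (1 - x) ^+ n <= e.
Proof.
move=> /andP[x0 x1] e0; pose n := (Num.truncn ((e * x)^-1)).+1.
exists n; split=> //; have := @pow_le_inv x n; rewrite ltW//= => /(_ x1) H.
have nx : e^-1 <= 1 + n%:R * x.
  have : (e * x)^-1 < n%:R by exact: truncnS_gt.
  rewrite invfM -ltr_pdivlMr ?invr_gt0// invrK => ?.
  by rewrite -[leLHS]add0r; apply: lerD => //; exact: ltW.
have p0 : 0 <= (1 - x) ^+ n by rewrite exprn_ge0// subr_ge0.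
rewrite -[leRHS]mulr1 -ler_pdivrMl//; apply: le_trans H.
by rewrite mulrC ler_wpM2l.
Qed.

(** Bernoulli's inequality. It keeps a turn with a tiny [beta] asleep during the [n] alternations
    made for another turn. *)
Lemma pow_sub_ge (x : R) n : 0 <= x <= 1 -> 1 - (1 - x) ^+ n <= n%:R * x.
Proof.
move=> /andP[x0 x1]; elim: n => [|n IH]; first by rewrite expr0 mul0r subrr.
have : 0 <= (1 - x) ^+ n <= 1.
  by rewrite exprn_ge0 ?exprn_ile1 ?subr_ge0// lerBlDr lerDl.
by rewrite exprS -natr1; nra.
Qed.

(** Well-founded recursion along [rk], carried out by iterating [step]: the value at [x] is stable
    after [rk x] + 1 rounds, since it only looks at smaller ranks. The list [up x] makes the minimum
    finite, hence positive. *)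
Lemma rank_recursion (T : eqType) (rk : T -> nat) (up : T -> seq T) (r : T -> T -> bool)
    (u : T -> R) (phi : T -> R -> R) :
  (forall x, 0 < u x) -> (forall x a, 0 < a -> 0 < phi x a) ->
  (forall x y, r x y -> (rk y < rk x)%N) ->
  exists c : T -> R, forall x, 0 < c x <= u x /\
    forall y, y \in up x -> r x y -> c x <= phi y (c y).
Proof.
move=> u0 phi0 rkr.
pose step (g : T -> R) x :=
  \big[Num.min/u x]_(y <- up x | r x y) phi y (g y).
pose g k := iter k step u.
have g_gt0 k x : 0 < g k x.
  elim: k x => [|k IH] x; first exact: u0.
  rewrite /g iterS -/(g k) /step.
  by elim/big_ind: _ => //; [move=> a b; rewrite lt_min => -> -> | move=> y _; exact/phi0/IH].
have stab k x : (rk x < k)%N -> g k x = g (rk x).+1 x.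
  elim/ltn_ind: k x => -[//|k] IH x; rewrite ltnS leq_eqVlt => /predU1P[->//|rxk].
  rewrite /g !iterS -/(g k) -/(g (rk x)) /step; apply: eq_bigr => y /rkr yx.
  by rewrite (IH k _ _ (ltn_trans yx rxk))// (IH (rk x) _ y yx)// ltnS ltnW.
exists (fun x => g (rk x).+1 x) => x; split.
  rewrite g_gt0 andTb /g iterS /step; elim: (up x) => [|y s IH]; first by rewrite big_nil.
  by rewrite big_cons; case: ifP => // _; rewrite ge_min IH orbT.
move=> y; rewrite {1}/g iterS -/(g (rk x)) => yx rxy.
rewrite -(stab (rk x)) ?rkr// /step.
elim: (up x) yx => //= z s IH; rewrite inE big_cons => /predU1P[<-|/IH H].
  by rewrite rxy ge_min lexx.
by case: ifP => // _; rewrite ge_min H orbT.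
Qed.

(** Block [i] will cost at most 6 / N_i. Doubling N_i makes the total cost a geometric series, and
    the shift 7 brings its sum to 12 / 128, which is below 1 / 8. *)
Definition steps i := (2 ^ (i + 7))%N.

Lemma leq_steps i j : (i <= j)%N -> (steps i <= steps j)%N.
Proof. by move=> ij; rewrite leq_exp2l// leq_add2r. Qed.

(** [vertex j] has components in the blocks [j - 1] and [j], so a turn of block [i], which moves in
    the plane of [vertex i] and [vertex i.+1], is disturbed only by blocks at distance at most 1. *)
Definition adjacent (i j : nat) := (i <= j.+1)%N && (j <= i.+1)%N.

(* Odd blocks precede the even blocks next to them, so that both [prec] and its
   converse are well founded although there are infinitely many blocks. *)
Definition prec (x y : nat * nat) :=
  [&& (x.2 < steps x.1)%N, (y.2 < steps y.1)%N &
   (x.1 == y.1) && (x.2 < y.2)%N ||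
   [&& adjacent x.1 y.1, odd x.1 & ~~ odd y.1]].

Lemma prec_total x y : (x.2 < steps x.1)%N -> (y.2 < steps y.1)%N ->
  adjacent x.1 y.1 -> x != y -> prec x y || prec y x.
Proof.
case: x y => [i l] [j k] /= lx ky; rewrite /prec /adjacent /= lx ky /=.
move=> /andP[ij ji]; rewrite xpair_eqE.
have [->|nij] := eqVneq i j.
  by case: ltngtP => //= _ _; rewrite ?orbT.
move=> _; rewrite ij ji /=.
have [-> | ->] : (i = j.+1 \/ j = i.+1)%N by lia.
- by rewrite /=; case: odd.
- by rewrite /=; case: odd.
Qed.

Definition near_blocks (x : nat * nat) : seq (nat * nat) :=
  [seq (i, l) | i <- iota 0 x.1.+2, l <- iota 0 (steps x.1.+1)].

Lemma mem_near_blocks x y : adjacent x.1 y.1 -> (y.2 < steps y.1)%N ->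
  y \in near_blocks x.
Proof.
move=> /andP[xy yx] y2; apply/allpairsP; exists y; rewrite !mem_iota /=.
by split; rewrite ?add0n ?ltnS// ?(leq_trans y2)// ?leq_steps//; case: (y).
Qed.

Lemma adjacent_sym i j : adjacent i j = adjacent j i.
Proof. by rewrite /adjacent andbC. Qed.

(** Between blocks, [prec] only leads from an odd one to an even one, so a chain changes block at
    most once. The offset of the odd ranks exceeds every rank of the neighbouring even blocks. *)
Lemma prec_rank_down x y : prec x y ->
  ((if odd y.1 then (steps y.1.+1).+1 + (steps y.1 - y.2) else steps y.1 - y.2) <
   (if odd x.1 then (steps x.1.+1).+1 + (steps x.1 - x.2) else steps x.1 - x.2))%N.
Proof.
case: x y => [i l] [j k] /and3P[/= li kj /orP[/andP[/eqP -> lk]|]].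
  by case: ifP => _; lia.
move=> /and3P[/andP[_ ji] -> /negbTE ->]; apply: leq_ltn_trans (leq_subr _ _) _.
by have := leq_steps ji; lia.
Qed.

(** The mirror image: chains of the converse relation can only pass from an even block to an odd
    one, hence the offset is on the even ranks. *)
Lemma prec_rank_up x y : prec y x ->
  ((if odd y.1 then y.2 else steps y.1.+1 + y.2) <
   (if odd x.1 then x.2 else steps x.1.+1 + x.2))%N.
Proof.
case: x y => [i l] [j k] /and3P[/= li kj /orP[/andP[/eqP -> lk]|]].
  by case: ifP => _; lia.
move=> /and3P[/andP[ji _] -> /negbTE ->].
by have := leq_steps ji; lia.
Qed.

(* During phase (i, l) the coefficient [c j k] is small if (j, k) precedes (i, l),
   and [beta j k] is small otherwise: [c] is built by recursion along the converse of
   [prec], then [beta] along [prec]. *)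
Lemma ex_parameters : exists (c beta : nat -> nat -> R) (m s : nat -> nat -> nat),
  [/\ forall i l, 0 < c i l <= (8 * (steps i)%:R)^-1,
      forall i l, 0 < beta i l <= 1,
      forall i l, (1 - (1 - (1 - beta i l) ^+ s i l) * c i l) ^+ m i l <=
                  ((steps i)%:R ^+ 2)^-1 &
      forall i l j k, (l < steps i)%N -> (k < steps j)%N -> adjacent i j ->
        (i, l) != (j, k) ->
        (m i l)%:R * ((1 - (1 - beta j k) ^+ s i l) * c j k) <=
        (4 * (steps i)%:R ^+ 3)^-1].
Proof.
have st0 i : 0 < (steps i)%:R :> R by rewrite ltr0n expn_gt0.
(* [M] aims at the rate [c / 2] and not at the true rate, which depends on [beta]: [S] below makes
   every leak at least 1 / 2. So [M] depends on [c] only, and [c] can be fixed before [beta]. *)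
have /choice[M HM] : forall ix : nat * R, exists n, 0 < ix.2 <= 1 ->
    (0 < n)%N /\ (1 - ix.2 / 2) ^+ n <= ((steps ix.1)%:R ^+ 2)^-1.
  move=> [i x]; have [x01|] := boolP (0 < x <= 1); last by exists 0%N.
  have x2 : 0 < x / 2 <= 1 by move/andP: x01; lra.
  have e0 : 0 < ((steps i)%:R ^+ 2)^-1 :> R by rewrite invr_gt0 exprn_gt0.
  by have [n ?] := ex_pow_small x2 e0; exists n.
have /choice[S HS] : forall x : R, exists n, 0 < x <= 1 ->
    (0 < n)%N /\ (1 - x) ^+ n <= 2^-1.
  move=> x; have [x01|] := boolP (0 < x <= 1); last by exists 0%N.
  have e0 : 0 < 2^-1 :> R by rewrite invr_gt0.
  by have [n ?] := ex_pow_small x01 e0; exists n.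
(* The successor keeps the bounds positive even where [M] or [S] takes the default value 0. *)
have w0 (x : nat * nat) (q : nat) : 0 < (4 * (steps x.1)%:R ^+ 3 * q.+1%:R)^-1 :> R.
  by rewrite invr_gt0 !mulr_gt0// exprn_gt0.
have [c Hc] := @rank_recursion (nat * nat)%type
  (fun x => if odd x.1 then (steps x.1.+1).+1 + (steps x.1 - x.2) else steps x.1 - x.2)%N
  near_blocks prec (fun x => (8 * (steps x.1)%:R)^-1)
  (fun x a => (4 * (steps x.1)%:R ^+ 3 * (M (x.1, a)).+1%:R)^-1)
  (fun x => ltac:(by rewrite invr_gt0 mulr_gt0)) (fun x a _ => w0 x _)
  (fun x y => @prec_rank_down x y).
have [b Hb] := @rank_recursion (nat * nat)%type
  (fun x => if odd x.1 then x.2 else steps x.1.+1 + x.2)%N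
  near_blocks (fun x y => prec y x) (fun=> 1)
  (fun x a => (4 * (steps x.1)%:R ^+ 3 * (M (x.1, c x) * S a).+1%:R)^-1)
  (fun x => ltr01) (fun x a _ => w0 x _)
  (fun x y => @prec_rank_up x y).
have c01 x : 0 < c x <= 1.
  have [/andP[-> cx] _] := Hc x; rewrite (le_trans cx)// invf_le1 ?mulr_gt0//.
  have : 1 <= (steps x.1)%:R :> R by rewrite ler1n expn_gt0.
  by lra.
have b01 x : 0 < b x <= 1 by have [] := Hb x.
have b01' x : 0 <= 1 - b x <= 1 by have := b01 x; lra.
exists (fun i l => c (i, l)), (fun i l => b (i, l)), (fun i l => M (i, c (i, l))),
  (fun i l => S (b (i, l))); split=> //.
- by move=> i l; have [] := Hc (i, l).
- move=> i l; have [_ bS] := HS _ (b01 (i, l)).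
  have [_] := HM (i, c (i, l)) (c01 (i, l)); apply: le_trans => /=.
  have /andP[c0 c1] := c01 (i, l).
  have p0 : 0 <= (1 - b (i, l)) ^+ S (b (i, l)).
    by rewrite exprn_ge0//; have /andP[] := b01' (i, l).
  by rewrite lerXn2r ?nnegrE//; nra.
- move=> i l j k lst kst ij neq.
  set x := (i, l); set y := (j, k).
  have /andP[c0 c1] := c01 y; have /andP[b0 b1] := b01 y.
  have g0 : 0 <= 1 - (1 - b y) ^+ S (b x) <= 1.
    have /andP[? ?] := b01' y.
    by rewrite subr_ge0 exprn_ile1//= lerBlDr lerDl exprn_ge0.
  have K0 : 0 < 4 * (steps i)%:R ^+ 3 :> R by rewrite mulr_gt0// exprn_gt0.
  have /orP[xy|yx] := @prec_total x y lst kst ij neq.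
  + have [_ /(_ x)] := Hb y; rewrite mem_near_blocks// 1?adjacent_sym//.
    move=> /(_ isT xy) bS.
    have [g1 _] := HS _ (b01 x).
    have := @pow_sub_ge (b y) (S (b x)); rewrite ltW// b1 => /(_ isT) h.
    apply: (@le_trans _ _ ((M (i, c x) * S (b x)).+1%:R * b y)).
      rewrite -natr1 natrM.
      apply: (@le_trans _ _ ((M (i, c x))%:R * ((S (b x))%:R * b y))).
        by rewrite ler_wpM2l//; nra.
      by rewrite mulrA ler_wpM2r ?lerDl// ltW.
    by rewrite -ler_pdivlMl ?ltr0n// -invfM [_ * (4 * _)]mulrC.
  + have [_ /(_ x)] := Hc y; rewrite mem_near_blocks// 1?adjacent_sym//.
    move=> /(_ isT yx) cy.
    apply: (@le_trans _ _ ((M (i, c x)).+1%:R * c y)).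
      by rewrite -natr1 ler_pM// ?lerDl//; nra.
    by rewrite -ler_pdivlMl ?ltr0n// -invfM [_ * (4 * _)]mulrC.
Qed.

End parameters.

(** The words are nonempty, so the first [q + 1] of them already cover position [q]; the letter is
    read there, and longer prefixes give the same one. *)
Lemma concat_words (A : Type) (a0 : A) (f : nat -> seq A) :
  (forall i, 0 < size (f i))%N ->
  exists (k : nat -> A) (L : nat -> nat),
    [/\ L 0%N = 0%N, forall i, (i <= L i)%N,
        forall i, L i.+1 = (L i + size (f i))%N &
        forall i j, (j < size (f i))%N -> k (L i + j)%N = nth a0 (f i) j].
Proof.
move=> f0; pose pre n := flatten [seq f i | i <- iota 0 n].
have preS n : pre n.+1 = pre n ++ f n.
  by rewrite /pre -addn1 iotaD map_cat flatten_cat /= cats0.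
have le_size i : (i <= size (pre i))%N.
  by elim: i => // i IH; rewrite preS size_cat; have := f0 i; lia.
have nth_pre m d q : (q < size (pre m))%N ->
    nth a0 (pre (m + d)%N) q = nth a0 (pre m) q.
  move=> qm; elim: d => [|d IH]; first by rewrite addn0.
  rewrite addnS preS nth_cat IH ifT//; apply: leq_trans qm _.
  by elim: d {IH} => [|d IH]; rewrite ?addn0// addnS preS size_cat (leq_trans IH)// leq_addr.
exists (fun q => nth a0 (pre q.+1) q), (fun i => size (pre i)); split=> //.
  by move=> i; rewrite preS size_cat.
move=> i j ji; have iq : (i <= size (pre i) + j)%N by rewrite (leq_trans (le_size i))// leq_addr.
rewrite -(subnKC iq) -addSn nth_pre; last by rewrite subnKC// preS size_cat ltn_add2l.
by rewrite subnKC// preS nth_cat ltnNge leq_addr addKn.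
Qed.

(** * Orthonormal vertices, the three subspaces and a single turn *)

Section geometry.
Variables (R : realType) (n : nat -> nat) (c beta p0 p1 : nat -> nat -> R).
Hypothesis c_ge0 : forall i l, 0 <= c i l.
Hypothesis c_sum : forall i, \sum_(l < n i) c i l <= 8^-1.
Hypothesis beta01 : forall i l, 0 <= beta i l <= 1.
Hypothesis p_unit : forall i l, p0 i l ^+ 2 + p1 i l ^+ 2 = 1.

(** The index [k] is the role of a coordinate: 0 is dampened by turn [l] of block [i], 1 is its
    mirror image, 2 is the direction towards which [W_tilt] leans, 3 completes a vertex to length
    1. *)
Definition basis (k i l : nat) : {poly R} := 'X^(pickle (k, i, l)).

Lemma dot_basis k i l k' i' l' :
  dot (basis k i l) (basis k' i' l') = [&& k == k', i == i' & l == l']%:R.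
Proof.
rewrite /basis dotXnl coefXn (inj_eq (pcan_inj pickleK)) !xpair_eqE andbA.
by rewrite -!andbA.
Qed.

(** [block_src] uses sums and [block_dst] differences of the same pairs, which are orthogonal. Thus
    [vertex i] and [vertex i.+1] share the coordinates [basis 0 i l] and are orthogonal
    nevertheless. *)
Definition block_src i := \sum_(l < n i) (Num.sqrt (c i l) * p0 i l) *: (basis 0 i l + basis 1 i l).
Definition block_dst i := \sum_(l < n i) (Num.sqrt (c i l) * p1 i l) *: (basis 0 i l - basis 1 i l).
Definition block_into j := if j is i.+1 then block_dst i else 0.

Lemma dot_basis_src k i l j : dot (basis k i l) (block_src j) =
  [&& i == j, (l < n j)%N & (k < 2)%N]%:R * (Num.sqrt (c i l) * p0 i l).
Proof.
rewrite /block_src dot_sumr; have [<-{j}|ij] := eqVneq i j; last first.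
  rewrite big1 ?mul0r// => u _; rewrite dotZr dotDr !dot_basis (negbTE ij) !andbF.
  by rewrite addr0 mulr0.
have [lu|lu] := ltnP l (n i); last first.
  rewrite big1 ?mul0r// => u _; rewrite dotZr dotDr !dot_basis.
  have /negbTE -> : l != u by rewrite neq_ltn (leq_trans (ltn_ord u) lu) orbT.
  by rewrite !andbF addr0 mulr0.
rewrite (bigD1 (Ordinal lu))//= big1 => [|u ul]; last first.
  rewrite dotZr dotDr !dot_basis; have /negbTE -> : l != u.
    by apply: contra ul => /eqP lu'; apply/eqP/val_inj.
  by rewrite !andbF addr0 mulr0.
rewrite dotZr dotDr !dot_basis !eqxx !andbT addr0 mulrC; congr (_ * _).
by case: k => [|[|k]]//=; rewrite ?addr0 ?add0r.
Qed.

Lemma dot_basis_dst k i l j : dot (basis k i l) (block_dst j) =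
  ((i == j) && (l < n j)%N)%:R * ((k == 0%N)%:R - (k == 1%N)%:R) *
  (Num.sqrt (c i l) * p1 i l).
Proof.
rewrite /block_dst dot_sumr; have [<-{j}|ij] := eqVneq i j; last first.
  rewrite big1 ?mul0r// => u _; rewrite dotZr dotBr !dot_basis (negbTE ij) !andbF.
  by rewrite subrr mulr0.
have [lu|lu] := ltnP l (n i); last first.
  rewrite big1 ?mul0r// => u _; rewrite dotZr dotBr !dot_basis.
  have /negbTE -> : l != u by rewrite neq_ltn (leq_trans (ltn_ord u) lu) orbT.
  by rewrite !andbF subrr mulr0.
rewrite (bigD1 (Ordinal lu))//= big1 => [|u ul]; last first.
  rewrite dotZr dotBr !dot_basis; have /negbTE -> : l != u.
    by apply: contra ul => /eqP lu'; apply/eqP/val_inj.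
  by rewrite !andbF subrr mulr0.
by rewrite dotZr dotBr !dot_basis !eqxx !andbT addr0 mulrC mul1r.
Qed.

Lemma dot_src i j : dot (block_src i) (block_src j) =
  (i == j)%:R * \sum_(l < n i) 2 * (c i l * p0 i l ^+ 2).
Proof.
rewrite {1}/block_src dot_suml big_distrr/=; apply: eq_bigr => l _.
rewrite dotZl dotDl !dot_basis_src andbT; have [<-|ij] := eqVneq i j; last first.
  by rewrite !mul0r addr0 mulr0.
rewrite ltn_ord /= !mul1r -[in RHS](sqr_sqrtr (c_ge0 i l)); ring.
Qed.

Lemma dot_dst i j : dot (block_dst i) (block_dst j) =
  (i == j)%:R * \sum_(l < n i) 2 * (c i l * p1 i l ^+ 2).
Proof.
rewrite {1}/block_dst dot_suml big_distrr/=; apply: eq_bigr => l _.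
rewrite dotZl dotBl !dot_basis_dst; have [<-|ij] := eqVneq i j; last first.
  by rewrite !mul0r subrr mulr0.
rewrite ltn_ord /= !mul1r -[in RHS](sqr_sqrtr (c_ge0 i l)); ring.
Qed.

Lemma dot_src_dst i j : dot (block_src i) (block_dst j) = 0.
Proof.
rewrite /block_src dot_suml big1// => l _.
by rewrite dotZl dotDl !dot_basis_dst /=; ring.
Qed.

Lemma p_le1 i l : p0 i l ^+ 2 <= 1 /\ p1 i l ^+ 2 <= 1.
Proof. by have := p_unit i l; have := sqr_ge0 (p0 i l); have := sqr_ge0 (p1 i l); lra. Qed.

(** Each pair of coordinates counts twice, so the bound 1 / 8 on the sum of the [c i l] becomes 1 /
    4. A vertex has two such pieces, and at least 1 / 2 remains for the square of its apex. *)
Lemma dot_src_le i : dot (block_src i) (block_src i) <= 4^-1.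
Proof.
rewrite dot_src eqxx mul1r -big_distrr/=.
apply: (@le_trans _ _ (2 * \sum_(l < n i) c i l)); last by have := c_sum i; lra.
by rewrite ler_wpM2l// ler_sum// => l _; rewrite ler_piMr// (p_le1 i l).1.
Qed.

Lemma dot_dst_le i : dot (block_dst i) (block_dst i) <= 4^-1.
Proof.
rewrite dot_dst eqxx mul1r -big_distrr/=.
apply: (@le_trans _ _ (2 * \sum_(l < n i) c i l)); last by have := c_sum i; lra.
by rewrite ler_wpM2l// ler_sum// => l _; rewrite ler_piMr// (p_le1 i l).2.
Qed.

Lemma dot_into i j : dot (block_into i) (block_into j) =
  (i == j)%:R * dot (block_into i) (block_into i).
Proof.
case: i j => [|i] [|j] /=; rewrite ?(dot0l, dot0r) ?mulr0 ?mul0r//.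
by rewrite !dot_dst eqxx mul1r.
Qed.

Lemma dot_src_into i j : dot (block_src i) (block_into j) = 0.
Proof. by case: j => [|j]; rewrite ?dot0r// dot_src_dst. Qed.

Lemma dot_into_le i : dot (block_into i) (block_into i) <= 4^-1.
Proof. by case: i => [|i] /=; rewrite ?dot_dst_le// dot0l invr_ge0. Qed.

Definition apex j := Num.sqrt (1 - dot (block_src j) (block_src j) - dot (block_into j)
  (block_into j)).

Lemma sqr_apex j : apex j ^+ 2 = 1 - dot (block_src j) (block_src j) - dot (block_into j)
  (block_into j).
Proof. by rewrite sqr_sqrtr//; have := dot_src_le j; have := dot_into_le j; lra. Qed.

Lemma apex_gt0 j : 0 < apex j.
Proof. by rewrite sqrtr_gt0; have := dot_src_le j; have := dot_into_le j; lra. Qed.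

(* The vectors [basis 0 i l] are seen by [W_vertex] along [axis i l] only, with factor
   [Num.sqrt (c i l)]; the components on [basis 1] and [basis 3] serve to make the
   vertices orthonormal. *)
Definition vertex j := block_src j + block_into j + apex j *: basis 3 j 0.

Lemma dot_basis3_into i j l : dot (basis 3 i l) (block_into j) = 0.
Proof. by case: j => [|j]; rewrite ?dot0r// dot_basis_dst /= subrr; ring. Qed.

Lemma dot_vertex i j : dot (vertex i) (vertex j) = (i == j)%:R.
Proof.
rewrite /vertex !(dotDl, dotDr, dotZl, dotZr) (dotC (block_into i) (block_src j)) !dot_src_into.
rewrite (dotC (block_src i) (basis _ _ _)) (dotC (block_into i) (basis _ _ _)) !dot_basis_src
  !dot_basis3_into dot_basis.
rewrite !eqxx !andbF /= andbT dot_into !mul0r !mulr0 !(addr0, add0r).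
have [<-|ij] := eqVneq i j; last first.
  by rewrite dot_src (negbTE ij) !mul0r !mulr0 !addr0.
by rewrite mul1r mulr1 -expr2 sqr_apex /=; ring.
Qed.

Definition W_vertex w := exists j, w = vertex j.
Definition W_coord w := exists k i l, [/\ k <> 2%N & w = basis k i l].
(* Projecting alternately on [W_tilt] and [W_coord] multiplies [basis 0 i l] by
   [1 - beta i l] and fixes the other basis vectors occurring in the vertices. *)
Definition tilt i l := Num.sqrt (1 - beta i l) *: basis 0 i l - Num.sqrt (beta i l) *: basis 2 i l.
Definition W_tilt w := (exists k i l, [/\ k <> 0%N, k <> 2%N & w = basis k i l]) \/
  (exists i l, w = tilt i l).

Definition edge i a b := a *: vertex i + b *: vertex i.+1.
(** The unit vector v of turn [l] in block [i]. *)
Definition axis i l := edge i (p0 i l) (p1 i l).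

Lemma dot_basis_vertex k i l j : dot (basis k i l) (vertex j) =
  [&& i == j, (l < n j)%N & (k < 2)%N]%:R * (Num.sqrt (c i l) * p0 i l) +
  [&& i.+1 == j & (l < n i)%N]%:R * ((k == 0%N)%:R - (k == 1%N)%:R) *
  (Num.sqrt (c i l) * p1 i l) + [&& k == 3, i == j & l == 0%N]%:R * apex j.
Proof.
rewrite /vertex !dotDr dotZr dot_basis_src dot_basis [apex j * _]mulrC; congr (_ + _ + _).
case: j => [|j] /=; first by rewrite dot0r !mul0r.
by rewrite dot_basis_dst eqSS; case: eqP => [->|].
Qed.

Lemma edge_span i a b : span W_vertex (edge i a b).
Proof.
by apply: spanDZ; [exists i|apply/spanZ/span_gen; exists i.+1].
Qed.

Lemma dot_edge_vertex i a b j :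
  dot (edge i a b) (vertex j) = a * (i == j)%:R + b * (i.+1 == j)%:R.
Proof. by rewrite /edge dotDl !dotZl !dot_vertex. Qed.

(** A vertex reaches [basis 0 i l] with a factor [Num.sqrt (c i l)], and the way back contributes
    the same factor: together they give the term c v v^T of a turn. *)
Lemma projE_basis0 i l : (l < n i)%N ->
  is_proj W_vertex (basis 0 i l) (Num.sqrt (c i l) *: axis i l).
Proof.
move=> li; split; first exact/spanZ/edge_span.
move=> _ [j ->]; rewrite dotBl dotZl dot_edge_vertex dot_basis_vertex li /= !andbT subr0 mulr1
  mul0r.
have [<-|ij] := eqVneq i j; first by rewrite li gtn_eqF//=; ring.
by have [_|ij'] := eqVneq i.+1 j; rewrite /=; ring.
Qed.

Lemma projE_basis3 i : is_proj W_vertex (basis 3 i 0) (apex i *: vertex i).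
Proof.
split; first by apply/spanZ/span_gen; exists i.
move=> _ [j ->]; rewrite dotBl dotZl dot_vertex dot_basis_vertex /= !andbT !andbF subrr mulr0
  !mul0r !add0r.
by have [->|_] := eqVneq i j; rewrite /=; ring.
Qed.

(** [W_vertex] is infinite-dimensional, but a coordinate meets at most the vertices [i] and [i.+1],
    so its projection is an explicit combination of these two. Coordinates outside the range of
    [pickle] meet no vertex and project to 0. *)
Lemma projE_total x : exists y, is_proj W_vertex x y.
Proof.
apply: is_proj_total => m; have [[k [i [l E]]]|H] :=
  EM (exists k i l : nat, m = pickle (k, i, l)); last first.
  exists 0; split; first exact: span0.
  move=> _ [j ->]; rewrite subr0 dotXnl.
  have H' k i l : (basis k i l)`_m = 0.
    by rewrite coefXn; case: eqP => // mE; case: H; exists k, i, l.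
  rewrite /vertex !coefD coefZ H' mulr0 addr0.
  have -> : (block_src j)`_m = 0.
    by rewrite coef_sum big1// => l _; rewrite coefZ coefD !H' addr0 mulr0.
  case: j => [|j]; rewrite ?coef0 ?addr0// coef_sum big1 ?addr0// => l _.
  by rewrite coefZ coefB !H' subr0 mulr0.
rewrite E -/(basis k i l) => {m E}.
exists (edge i (dot (basis k i l) (vertex i)) (dot (basis k i l) (vertex i.+1))).
split; first exact: edge_span.
move=> _ [j ->]; rewrite dotBl dot_edge_vertex.
have [<-|ij] := eqVneq i j; first by rewrite gtn_eqF//=; ring.
have [<-|ij'] := eqVneq i.+1 j; first by rewrite /=; ring.
by rewrite !dot_basis_vertex (negbTE ij) (negbTE ij') !andbF /=; ring.
Qed.

Lemma projX_total x : exists y, is_proj W_coord x y.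
Proof.
apply: is_proj_total => m; have [[k [i [l [k2 E]]]]|H] :=
  EM (exists k i l : nat, k <> 2%N /\ m = pickle (k, i, l)).
  by exists 'X^m; apply/is_proj_id/span_gen; exists k, i, l; rewrite E.
exists 0; split; first exact: span0.
move=> _ [k [i [l [k2 ->]]]]; rewrite subr0 dotXnl coefXn; case: eqP => // mE.
by case: H; exists k, i, l.
Qed.

Lemma projX_basis2 i l : is_proj W_coord (basis 2 i l) 0.
Proof.
split; first exact: span0.
by move=> _ [k [j [m [k2 ->]]]]; rewrite subr0 dot_basis; case: k k2 => [|[|[|]]].
Qed.

Lemma projX_id k i l : k <> 2%N -> is_proj W_coord (basis k i l) (basis k i l).
Proof. by move=> k2; apply/is_proj_id/span_gen; exists k, i, l. Qed.

Lemma projY_id k i l : k <> 0%N -> k <> 2%N -> is_proj W_tilt (basis k i l) (basis k i l).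
Proof. by move=> k0 k2; apply/is_proj_id/span_gen; left; exists k, i, l. Qed.

Lemma sqr_sqrt_beta i l : Num.sqrt (beta i l) ^+ 2 = beta i l /\
  Num.sqrt (1 - beta i l) ^+ 2 = 1 - beta i l.
Proof. by rewrite !sqr_sqrtr//; have := beta01 i l; lra. Qed.

Lemma projY_basis0 i l : is_proj W_tilt (basis 0 i l) (Num.sqrt (1 - beta i l) *: tilt i l).
Proof.
have [b1 b2] := sqr_sqrt_beta i l.
split; first by apply/spanZ/span_gen; right; exists i, l.
move=> _ [[k [j [m [k0 k2 ->]]]]|[j [m ->]]]; rewrite /tilt;
  rewrite !(dotBl, dotBr, dotZl, dotZr) !dot_basis /=.
  by case: k k0 k2 => [|[|[|k]]]//= _ _; ring.
have [<-|_] := eqVneq i j; last by rewrite /=; ring.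
have [<-|_] := eqVneq l m; last by rewrite /=; ring.
rewrite /=; ring: b1 b2.
Qed.

Lemma projY_basis2 i l : is_proj W_tilt (basis 2 i l) (- Num.sqrt (beta i l) *: tilt i l).
Proof.
have [b1 b2] := sqr_sqrt_beta i l.
split; first by apply/spanZ/span_gen; right; exists i, l.
move=> _ [[k [j [m [k0 k2 ->]]]]|[j [m ->]]]; rewrite /tilt;
  rewrite !(dotBl, dotBr, dotZl, dotZr) !dot_basis /=.
  by case: k k0 k2 => [|[|[|k]]]//= _ _; ring.
have [<-|_] := eqVneq i j; last by rewrite ?andbF /=; ring.
have [<-|_] := eqVneq l m; last by rewrite /=; ring.
rewrite /=; ring: b1 b2.
Qed.

Lemma projY_total x : exists y, is_proj W_tilt x y.
Proof.
apply: is_proj_total => m; have [[k [i [l ->]]]|H] :=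
  EM (exists k i l : nat, m = pickle (k, i, l)); last first.
  exists 0; split; first exact: span0.
  have H' (k i l : nat) : ('X^m : {poly R})`_(pickle (k, i, l)) = 0.
    by rewrite coefXn; case: eqP => // mE; case: H; exists k, i, l.
  move=> _ [[k [j [u [k0 k2 ->]]]]|[j [u ->]]]; rewrite subr0 dotC.
    by rewrite dotXnl H'.
  by rewrite dotBl !dotZl !dotXnl !H' !mulr0 subrr.
rewrite -/(basis k i l).
have [->|k0] := eqVneq k 0%N; first by eexists; exact: projY_basis0.
have [->|k2] := eqVneq k 2%N; first by eexists; exact: projY_basis2.
by eexists; apply: projY_id; exact/eqP.
Qed.

Definition subspaces (k : 'I_3) : {poly R} -> Prop :=
  if val k is 0%N then W_vertex else if val k is 1%N then W_coord else W_tilt.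

Lemma subspaces_total k x : exists y, is_proj (subspaces k) x y.
Proof.
by case: k => -[|[|k]] ?; rewrite /subspaces /=;
  [exact: projE_total|exact: projX_total|exact: projY_total].
Qed.

Definition kE : 'I_3 := @Ordinal 3 0 isT.
Definition kX : 'I_3 := @Ordinal 3 1 isT.
Definition kY : 'I_3 := @Ordinal 3 2 isT.
Notation projW := (proj subspaces_total).
Notation proj_wordW := (proj_word subspaces_total).

Let XY := proj_wordW [:: kY; kX].
Let linXY : linfn XY := @linfn_proj_word _ _ _ _ _.

Lemma XY_basis0 s i l : iter s XY (basis 0 i l) = (1 - beta i l) ^+ s *: basis 0 i l.
Proof.
elim: s => [|s IH]; first by rewrite scale1r.
rewrite iterS IH (linfnZ linXY) exprS mulrC -scalerA; congr (_ *: _).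
have [b1 b2] := sqr_sqrt_beta i l.
rewrite /XY /proj_word /=; rewrite (projE subspaces_total (projY_basis0 i l : is_proj (subspaces
  kY) _ _)).
(* [W_coord] discards the part of the tilted vector on [basis 2 i l], and the two factors
   [Num.sqrt (1 - beta i l)] of the other part multiply to [1 - beta i l]. *)
apply: projE; rewrite /tilt scalerBr scalerA -expr2 b2 scalerA -scaleNr.
have := is_projD (- (Num.sqrt (1 - beta i l) * Num.sqrt (beta i l))) (projX_basis2 i l)
   (is_proj_id (spanZ (1 - beta i l) (span_gen (ex_intro _ 0%N (ex_intro _ i
      (ex_intro _ l (conj (fun h : 0%N =
        2%N => ltac:(discriminate h)) erefl))))) : span (W_coord) _)).
by rewrite scaler0 add0r addrC; apply.
Qed.

Lemma XY_basis s k i l : k <> 0%N -> k <> 2%N -> iter s XY (basis k i l) = basis k i l.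
Proof.
move=> k0 k2; elim: s => // s IH; rewrite iterS IH /XY /proj_word /=.
rewrite (projE subspaces_total (projY_id i l k0 k2 : is_proj (subspaces kY) _ _)).
exact: (projE subspaces_total (projX_id i l k2 : is_proj (subspaces kX) _ _)).
Qed.

Definition leak s i l := 1 - (1 - beta i l) ^+ s.

Lemma leak01 s i l : 0 <= leak s i l <= 1.
Proof.
have /andP[b0 b1] := beta01 i l.
by rewrite subr_ge0 lerBlDr lerDl exprn_ge0 ?exprn_ile1 ?subr_ge0// lerBlDr lerDl.
Qed.

Definition loss_src s i := \sum_(l < n i) (leak s i l * c i l * p0 i l) *: axis i l.
Definition loss_dst s i := \sum_(l < n i) (leak s i l * c i l * p1 i l) *: axis i l.
Definition loss_into s j := if j is i.+1 then loss_dst s i else 0.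

Definition sweep s x := projW kE (iter s XY x).

Lemma sweepE s x : sweep s x = proj_wordW (flatten (nseq s [:: kY; kX]) ++ [:: kE]) x.
Proof. by rewrite proj_word_cat proj_word_nseq. Qed.

Lemma linfn_sweep s : linfn (sweep s).
Proof. by move=> a x y; rewrite /sweep (linfn_iter linXY) linfn_proj. Qed.

Lemma contracting_sweep s : contracting (sweep s).
Proof.
move=> x; rewrite (le_trans (contracting_proj _ _ _))//.
by apply: contracting_iter; exact: contracting_proj_word.
Qed.

Lemma proj_basis0 i l : (l < n i)%N -> projW kE (basis 0 i l) = Num.sqrt (c i l) *: axis i l.
Proof. by move=> li; apply: projE; exact: projE_basis0. Qed.

Lemma proj_vertex j : projW kE (vertex j) = vertex j.
Proof. by apply: projE; apply: is_proj_id; apply: span_gen; exists j. Qed.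

(** The alternation changes only the components on [basis 0]. The last projection fixes the vertex
    and sees what was lost as multiples of the axes. *)
Lemma sweep_vertex s j : sweep s (vertex j) = vertex j - loss_src s j - loss_into s j.
Proof.
have E1 : iter s XY (block_src j) =
    block_src j - \sum_(l < n j) (Num.sqrt (c j l) * p0 j l * leak s j l) *: basis 0 j l.
  rewrite /block_src (linfn_sum (linfn_iter linXY s)) -sumrB; apply: eq_bigr => l _.
  rewrite (linfnZ (linfn_iter linXY s)) (linfnD (linfn_iter linXY s)) XY_basis0 XY_basis//.
  by rewrite -[X in _ = _ - X]scalerA -scalerBr addrAC /leak scalerBl scale1r opprB addrCA subrr
    addr0.
have E2 : iter s XY (block_into j) = block_into j - (if j is i.+1 then
    \sum_(l < n i) (Num.sqrt (c i l) * p1 i l * leak s i l) *: basis 0 i l else 0).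
  case: j {E1} => [|i] /=; first by rewrite (linfn0 (linfn_iter linXY s)) subr0.
  rewrite /block_dst (linfn_sum (linfn_iter linXY s)) -sumrB; apply: eq_bigr => l _.
  rewrite (linfnZ (linfn_iter linXY s)) (linfnB (linfn_iter linXY s)) XY_basis0 XY_basis//.
  by rewrite -[X in _ = _ - X]scalerA -scalerBr addrAC /leak scalerBl scale1r opprB addrCA subrr
    addr0.
rewrite /sweep {1}/vertex !(linfnD (linfn_iter linXY s)) (linfnZ (linfn_iter linXY s)).
rewrite E1 E2 XY_basis//.
set u := \sum_(_ < _) _; set v := (if _ is _.+1 then _ else _).
have -> : block_src j - u + (block_into j - v) + apex j *: basis 3 j 0 = vertex j - u - v.
  by rewrite /vertex; move: (apex _ *: _) => w; ring.
have lE := linfn_proj subspaces_total kE.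
rewrite !(linfnB lE) proj_vertex; congr (_ - _ - _).
  rewrite /u (linfn_sum lE); apply: eq_bigr => l _; rewrite (linfnZ lE) proj_basis0//.
  by rewrite scalerA -[in RHS](sqr_sqrtr (c_ge0 j l)); congr (_ *: _); ring.
rewrite /v; case: (j) => [|i]; first exact: linfn0.
rewrite (linfn_sum lE); apply: eq_bigr => l _; rewrite (linfnZ lE) proj_basis0//.
by rewrite scalerA -[in RHS](sqr_sqrtr (c_ge0 i l)); congr (_ *: _); ring.
Qed.

Lemma len_edge i a b : len (edge i a b) = Num.sqrt (a ^+ 2 + b ^+ 2).
Proof.
rewrite /len {2}/edge dotDr 2!dotZr !dot_edge_vertex// !eqxx.
by rewrite [i.+1 == i]gtn_eqF// [i == i.+1]ltn_eqF//=; congr Num.sqrt; ring.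
Qed.

Lemma len_axis i l : len (axis i l) = 1.
Proof. by rewrite len_edge p_unit sqrtr1. Qed.

Lemma len_sum_axis (m : nat) (a : nat -> R) i (P : pred nat) :
  len (\sum_(l < m | P l) a l *: axis i l) <= \sum_(l < m | P l) `|a l|.
Proof.
rewrite (le_trans (len_sum _ _ _))//; apply: ler_sum => l _.
by rewrite lenZ len_axis mulr1.
Qed.

(** Besides the other turns of block [i], there is the block that ends at [vertex i], absent for
    [i = 0], and the one that starts at [vertex i.+1]. *)
Definition noise s i l0 :=
  \sum_(l < n i | val l != l0) leak s i l * c i l +
  (if i is j.+1 then \sum_(l < n j) leak s j l * c j l else 0) +
  \sum_(l < n i.+1) leak s i.+1 l * c i.+1 l.

Lemma p_abs_le1 i l : `|p0 i l| <= 1 /\ `|p1 i l| <= 1.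
Proof.
have [h0 h1] := p_le1 i l.
by split; rewrite -(@expr_le1 _ 2)// real_normK ?num_real.
Qed.

(* On the plane of [vertex i] and [vertex i.+1] a sweep almost removes a fraction
   [leak s i l0 * c i l0] of the component along [axis i l0]. *)
Lemma sweep_edge s i l0 a b : (l0 < n i)%N -> a ^+ 2 + b ^+ 2 <= 1 ->
  len (sweep s (edge i a b) -
       (edge i a b - (leak s i l0 * c i l0 * (a * p0 i l0 + b * p1 i l0)) *: axis i l0))
  <= noise s i l0.
Proof.
move=> li ab; have a1 : `|a| <= 1.
  rewrite -(@expr_le1 _ 2)// real_normK ?num_real//.
  by have := sqr_ge0 b; lra.
have b1 : `|b| <= 1.
  rewrite -(@expr_le1 _ 2)// real_normK ?num_real//.
  by have := sqr_ge0 a; lra.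
have gc0 j l : 0 <= leak s j l * c j l by have /andP[? _] := leak01 s j l; rewrite mulr_ge0.
(* Lagrange's identity: the square of this number and that of [a * p1 i l - b * p0 i l] add up to
   the product of the two squared norms. *)
have ap l : `|a * p0 i l + b * p1 i l| <= 1.
  rewrite -(@expr_le1 _ 2)// real_normK ?num_real//.
  have := p_unit i l; have := sqr_ge0 (a * p1 i l - b * p0 i l); nra.
pose main l := (leak s i l * c i l * (a * p0 i l + b * p1 i l)) *: axis i l.
have -> : sweep s (edge i a b) = edge i a b - \sum_(l < n i) main l
    - a *: loss_into s i - b *: loss_src s i.+1.
  rewrite /edge (linfnD (linfn_sweep s)) !(linfnZ (linfn_sweep s)) !sweep_vertex /= !scalerBr.
  have -> : \sum_(l < n i) main l = a *: loss_src s i + b *: loss_dst s i.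
    rewrite /loss_src /loss_dst !scaler_sumr -big_split/=; apply: eq_bigr => l _.
    by rewrite !scalerA -scalerDl; congr (_ *: _); ring.
  move: (a *: loss_src _ _) (a *: loss_into _ _) (b *: loss_src _ _) (b *: loss_dst _ _) (a *:
    vertex i) (b *: vertex i.+1).
  by move=> u1 u2 u3 u4 u5 u6; ring.
rewrite (bigD1 (Ordinal li))//= -/(main l0); set S := \sum_(_ < _ | _) _.
have -> : edge i a b - (main l0 + S) - a *: loss_into s i - b *: loss_src s i.+1 -
    (edge i a b - main l0) = - (S + a *: loss_into s i + b *: loss_src s i.+1) by ring.
rewrite lenN (le_trans (lenD _ _))// lerD//; last first.
  rewrite lenZ (le_trans (ler_piMl (len_ge0 _) b1))//.
  rewrite (le_trans (@len_sum_axis _ (fun l => leak s i.+1 l * c i.+1 l * p0 i.+1 l) _ xpredT))//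
    ler_sum// => l _.
  by rewrite normrM ger0_norm// ler_piMr// (p_abs_le1 _ _).1.
rewrite (le_trans (lenD _ _))// lerD//.
  rewrite (le_trans (@len_sum_axis _ (fun l => leak s i l * c i l * (a * p0 i l + b * p1 i l)) _
    (fun l => l != l0)))// ler_sum// => l _.
  by rewrite normrM ger0_norm// ler_piMr.
rewrite lenZ (le_trans (ler_piMl (len_ge0 _) a1))//.
case: (i) => [|j]; first by rewrite /= len0.
rewrite /= (le_trans (@len_sum_axis _ (fun l => leak s j l * c j l * p1 j l) _ xpredT))//
  ler_sum// => l _.
by rewrite normrM ger0_norm// ler_piMr// (p_abs_le1 _ _).2.
Qed.

(** Without noise, a sweep fixes the direction orthogonal to the axis and shrinks the other
    component by a constant factor. This ideal orbit stays in the unit ball, so each sweep adds at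
    most one [noise], and contraction keeps the earlier errors from growing. *)
Lemma sweep_iter s i l a b u0 u1 t : (l < n i)%N ->
  u0 ^+ 2 + u1 ^+ 2 = 1 -> u0 * p0 i l + u1 * p1 i l = 0 -> a ^+ 2 + b ^+ 2 <= 1 ->
  len (iter t (sweep s) (a *: edge i u0 u1 + b *: axis i l) -
    (a *: edge i u0 u1 + ((1 - leak s i l * c i l) ^+ t * b) *: axis i l)) <= t%:R * noise s i l.
Proof.
move=> li u1E up0 ab; set g := leak s i l * c i l.
have c1 : c i l <= 1.
  apply: le_trans (_ : 8^-1 <= 1); last by lra.
  apply: le_trans (c_sum i); rewrite (bigD1 (Ordinal li))//= lerDl.
  by apply: sumr_ge0.
have g01 : 0 <= g <= 1.
  have /andP[g0 g1] := leak01 s i l.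
  by rewrite mulr_ge0//= (le_trans (ler_piMl _ g1)).
pose z t := a *: edge i u0 u1 + ((1 - g) ^+ t * b) *: axis i l.
have zE v : a *: edge i u0 u1 + v *: axis i l =
    edge i (a * u0 + v * p0 i l) (a * u1 + v * p1 i l).
  rewrite /axis /edge; move: (vertex i) (vertex i.+1) => x y.
  rewrite !scalerDr !scalerA addrACA -!scalerDl; congr (_ *: _ + _ *: _); ring.
elim: t => [|t IH].
  by rewrite expr0 mul1r /= subrr len0 mul0r.
rewrite iterS -/(z t.+1).
have -> : sweep s (iter t (sweep s) (a *: edge i u0 u1 + b *: axis i l)) - z t.+1 =
    sweep s (iter t (sweep s) (a *: edge i u0 u1 + b *: axis i l) - z t) + (sweep s (z t) - z t.+1).
  by rewrite (linfnB (linfn_sweep s)) addrA subrK.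
rewrite (le_trans (lenD _ _))// -natr1 mulrDl mul1r lerD//.
  by rewrite (le_trans (contracting_sweep _ _)).
set v := (1 - g) ^+ t * b.
have v2 : v ^+ 2 <= b ^+ 2.
  rewrite exprMn ler_piMl ?sqr_ge0// -exprM exprn_ile1// ?subr_ge0 ?lerBlDr ?lerDl//;
  by case/andP: g01.
have pu := p_unit i l.
have -> : z t.+1 = z t -
    (g * ((a * u0 + v * p0 i l) * p0 i l + (a * u1 + v * p1 i l) * p1 i l)) *: axis i l.
  have -> : (a * u0 + v * p0 i l) * p0 i l + (a * u1 + v * p1 i l) * p1 i l = v.
    transitivity (a * (u0 * p0 i l + u1 * p1 i l) + v * (p0 i l ^+ 2 + p1 i l ^+ 2)).
      by ring.
    by rewrite pu up0; ring.
  by rewrite /z -addrA -scalerBl -/v exprS -mulrA -/v; congr (_ + _ *: _); ring.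
rewrite /z -/v zE; apply: sweep_edge => //.
have -> : (a * u0 + v * p0 i l) ^+ 2 + (a * u1 + v * p1 i l) ^+ 2 =
   a ^+ 2 * (u0 ^+ 2 + u1 ^+ 2) + v ^+ 2 * (p0 i l ^+ 2 + p1 i l ^+ 2)
   + 2 * a * v * (u0 * p0 i l + u1 * p1 i l) by ring.
by rewrite u1E pu up0 !mulr1 mulr0 addr0; lra.
Qed.

End geometry.

(** * Small steps along a quarter circle *)

Section path.
Variable R : realType.
Implicit Types (N x : R).

(* The chord from e_i to e_(i+1), projected radially on the quarter circle. *)
Definition rad N x := Num.sqrt ((N - x) ^+ 2 + x ^+ 2).
Definition path0 N x := (N - x) / rad N x.
Definition path1 N x := x / rad N x.

Lemma rad_gt0 N x : 0 < N -> 0 < rad N x.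
Proof.
move=> N0; rewrite sqrtr_gt0; have := sqr_ge0 (N - 2 * x); nra.
Qed.

Lemma sqr_rad N x : rad N x ^+ 2 = (N - x) ^+ 2 + x ^+ 2.
Proof. by rewrite sqr_sqrtr// addr_ge0 ?sqr_ge0. Qed.

Lemma path_unit N x : 0 < N -> path0 N x ^+ 2 + path1 N x ^+ 2 = 1.
Proof.
move=> /(rad_gt0 x)/lt0r_neq0 r0; rewrite !expr_div_n -mulrDl -sqr_rad divff//.
by rewrite expf_eq0.
Qed.

Lemma path_start N : 0 < N -> path0 N 0 = 1 /\ path1 N 0 = 0.
Proof.
move=> N0; have rN : rad N 0 = N by rewrite /rad subr0 expr0n addr0 sqrtr_sqr gtr0_norm.
by rewrite /path0 /path1 rN subr0 mul0r divff// gt_eqF.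
Qed.

Lemma path_end N : 0 < N -> path0 N N = 0 /\ path1 N N = 1.
Proof.
move=> N0; have rN : rad N N = N by rewrite /rad subrr expr0n add0r sqrtr_sqr gtr0_norm.
by rewrite /path0 /path1 rN subrr mul0r divff// gt_eqF.
Qed.

(** [a] and [b] are the cosine and, up to sign, the sine of the angle between consecutive points. On
    the chord these points have determinant N and norms at least N / sqrt 2, whence b^2 <= 4 / N^2;
    and 1 - a <= 1 - a^2 = b^2. The loss being of second order, N steps lose only O(1 / N). *)
Lemma path_step N x : 0 < N -> 0 <= x <= N - 1 ->
  exists a b, [/\ path0 N x = a * path0 N (x + 1) - b * path1 N (x + 1),
    path1 N x = a * path1 N (x + 1) + b * path0 N (x + 1),
    a ^+ 2 + b ^+ 2 = 1, `|b| <= 1 & 1 - 4 / N ^+ 2 <= a <= 1].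
Proof.
move=> N0 /andP[x0 xN]; have r0 := rad_gt0 x N0; have r1 := rad_gt0 (x + 1) N0.
have rE := sqr_rad N x; have rE' := sqr_rad N (x + 1).
set r := rad N x in r0 rE *; set r' := rad N (x + 1) in r1 rE' *.
pose a := ((N - x) * (N - (x + 1)) + x * (x + 1)) / (r * r').
pose b := - N / (r * r').
have nr : r != 0 by rewrite gt_eqF.
have nr' : r' != 0 by rewrite gt_eqF.
have ab : a ^+ 2 + b ^+ 2 = 1.
  have num : ((N - x) * (N - (x + 1)) + x * (x + 1)) ^+ 2 + N ^+ 2 = r ^+ 2 * r' ^+ 2.
    by rewrite rE rE'; ring.
  by rewrite /a /b !expr_div_n sqrrN -mulrDl num exprMn divff// mulf_neq0 ?expf_neq0.
have a0 : 0 <= a.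
  by apply: divr_ge0; [apply: addr_ge0; apply: mulr_ge0; lra|apply: mulr_ge0; exact: ltW].
have b2 : b ^+ 2 <= 4 / N ^+ 2.
  rewrite /b expr_div_n sqrrN exprMn ler_pdivrMr ?mulr_gt0 ?exprn_gt0//.
  rewrite mulrAC ler_pdivlMr ?exprn_gt0//.
  have h1 : N ^+ 2 / 2 <= r ^+ 2 by rewrite rE; have := sqr_ge0 (N - 2 * x); nra.
  have h2 : N ^+ 2 / 2 <= r' ^+ 2 by rewrite rE'; have := sqr_ge0 (N - 2 * (x + 1)); nra.
  apply: (@le_trans _ _ (4 * ((N ^+ 2 / 2) * (N ^+ 2 / 2)))); first by nra.
  by rewrite ler_wpM2l// ler_pM// divr_ge0// sqr_ge0.
exists a, b; split=> //.
- rewrite /path0 /path1 -/r -/r' /a /b.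
  transitivity ((N - x) * r' ^+ 2 / (r * r' ^+ 2)); first by field; rewrite nr nr'.
  rewrite [in X in X / _]rE'; field; rewrite nr nr'//.
- rewrite /path0 /path1 -/r -/r' /a /b.
  transitivity (x * r' ^+ 2 / (r * r' ^+ 2)); first by field; rewrite nr nr'.
  rewrite [in X in X / _]rE'; field; rewrite nr nr'//.
- rewrite -(@expr_le1 _ 2)// real_normK ?num_real//; have := sqr_ge0 a; lra.
- by apply/andP; split; nra.
Qed.

End path.

(** * A divergent orbit *)

Section strange.
Variable R : realType.

(** Contractions do not amplify earlier errors, so the errors of the single steps simply add up. *)
Lemma len_iter_sum (f : nat -> {poly R} -> {poly R}) (h : nat -> {poly R}) (e : R) N :
  (forall l, linfn (f l)) -> (forall l, contracting (f l)) ->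
  (forall l, (l < N)%N -> len (f l (h l) - h l.+1) <= e) ->
  len (foldl (fun x l => f l x) (h 0%N) (iota 0 N) - h N) <= N%:R * e.
Proof.
move=> flin fctr; elim: N => [|N IH] fh; first by rewrite /= subrr len0 mul0r.
rewrite -addn1 iotaD foldl_cat /= add0n addn1.
set x := foldl _ _ _.
have -> : f N x - h N.+1 = f N (x - h N) + (f N (h N) - h N.+1).
  by rewrite (linfnB (flin N)) addrA subrK.
rewrite (le_trans (lenD _ _))// -natr1 mulrDl mul1r lerD ?fh//.
by rewrite (le_trans (fctr _ _))// IH// => l lN; rewrite fh// ltnW.
Qed.

Lemma strange_projections :
  exists (W : 'I_3 -> {poly R} -> Prop) (k : nat -> 'I_3) (a0 : nat) (delta : R),
  [/\ 0 < delta, forall i x, exists y, is_proj (W i) x y &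
   forall x : nat -> {poly R}, x 0%N = 'X^a0 ->
     (forall q, is_proj (W (k q)) (x q) (x q.+1)) ->
     forall N, exists p q, [/\ (N <= p)%N, (N <= q)%N & delta <= len (x p - x q)]].
Proof.
have [c [beta [m [s [c01 b01 gm small]]]]] := ex_parameters R.
pose Nr i : R := (steps i)%:R.
have N0 i : 0 < Nr i by rewrite ltr0n expn_gt0.
have st0 i : (steps i)%:R != 0 :> R by rewrite gt_eqF// -/(Nr i).
(* The axis of turn [l] is orthogonal to the next point of the path: killing the component along it
   moves [h i l] close to [h i l.+1]. *)
pose p0 i l := - path1 (Nr i) (l%:R + 1).
pose p1 i l := path0 (Nr i) (l%:R + 1).
have p_unit i l : p0 i l ^+ 2 + p1 i l ^+ 2 = 1 by rewrite sqrrN addrC path_unit.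
have c_ge0 i l : 0 <= c i l by have /andP[/ltW] := c01 i l.
have b01' i l : 0 <= beta i l <= 1 by have /andP[/ltW -> ->] := b01 i l.
have c_sum i : \sum_(l < steps i) c i l <= 8^-1.
  apply: (@le_trans _ _ (\sum_(l < steps i) (8 * (steps i)%:R)^-1)).
    by apply: ler_sum => l _; have /andP[] := c01 i l.
  by rewrite sumr_const card_ord -[leLHS]mulr_natr invfM -mulrA mulVf ?mulr1//.
pose W := subspaces steps c beta p0 p1.
pose tot := subspaces_total c_ge0 c_sum b01' p_unit.
pose run := proj_word tot.
pose e_ := vertex steps c p0 p1.
pose step_word i l := flatten (nseq (m i l) (flatten (nseq (s i l) [:: kY; kX]) ++ [:: kE])).
pose block i := flatten [seq step_word i l | l <- iota 0 (steps i)].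
pose h i l := edge steps c p0 p1 i (path0 (Nr i) l%:R) (path1 (Nr i) l%:R).
have h0 i : h i 0%N = e_ i.
  by rewrite /h (path_start (N0 i)).1 (path_start (N0 i)).2 /edge scale1r scale0r addr0.
have hN i : h i (steps i) = e_ i.+1.
  by rewrite /h (path_end (N0 i)).1 (path_end (N0 i)).2 /edge scale1r scale0r add0r.
have step_len i l : (l < steps i)%N ->
    len (run (step_word i l) (h i l) - h i l.+1) <= 6 / Nr i ^+ 2.
  move=> li; rewrite /run proj_word_nseq.
  have -> : proj_word tot (flatten (nseq (s i l) [:: kY; kX]) ++ [:: kE]) =
      sweep c_ge0 c_sum b01' p_unit (s i l).
    by apply/funext => x; rewrite sweepE.
  have lN : 0 <= (l%:R : R) <= Nr i - 1.
    apply/andP; split; first exact: ler0n.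
    by rewrite lerBrDr natr1 ler_nat.
  have [a [b [Ea Eb ab b1 /andP[a0 a1]]]] := path_step (N0 i) lN.
  have hE : h i l = a *: h i l.+1 + b *: axis steps c p0 p1 i l.
    rewrite /h /axis /edge Ea Eb -natr1; move: (vertex _ _ _ _ i) (vertex _ _ _ _ i.+1) => x y.
    rewrite !scalerDr !scalerA addrACA -!scalerDl /p0 /p1.
    by congr (_ *: _ + _ *: _); ring.
  have u1 := path_unit (l%:R + 1) (N0 i).
  have up0 : path0 (Nr i) (l%:R + 1) * p0 i l + path1 (Nr i) (l%:R + 1) * p1 i l = 0.
    by rewrite /p0 /p1; ring.
  have abl : a ^+ 2 + b ^+ 2 <= 1 by rewrite ab.
  have := sweep_iter c_ge0 c_sum b01' p_unit (s i l) (m i l) li u1 up0 abl.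
  rewrite natr1 -/(h i l.+1) -hE; set x := iter _ _ _; set q := (1 - _) ^+ _ => Hx.
  have -> : x - h i l.+1 = (x - (a *: h i l.+1 + (q * b) *: axis steps c p0 p1 i l)) +
      ((a - 1) *: h i l.+1 + (q * b) *: axis steps c p0 p1 i l).
    by rewrite scalerBl scale1r; move: (_ *: h i l.+1) (_ *: axis _ _ _ _ _ _) => ? ?; ring.
  (* The three terms are the noise, the shortening by the cosine [a], and what survives along the
     axis after [m i l] sweeps. *)
  have -> : 6 / Nr i ^+ 2 = 1 / Nr i ^+ 2 + (4 / Nr i ^+ 2 + 1 / Nr i ^+ 2).
    by field; rewrite st0.
  rewrite (le_trans (lenD _ _))// lerD//.
    apply: le_trans Hx _.
    (* Over the [m i l] sweeps each foreign turn contributes at most [M]. Block [i] and the block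
       before it hold at most N of them each, the block after it 2 N. *)
    pose M := (4 * Nr i ^+ 3)^-1.
    have -> : 1 / Nr i ^+ 2 = (steps i)%:R * M + (steps i)%:R * M + (2 * (steps i)%:R) * M.
      by rewrite /M; field; rewrite st0.
    rewrite !mulrDr; apply: lerD; first apply: lerD.
    - rewrite mulr_sumr mulr_natl -[X in _ <= _ *+ X]card_ord -[leRHS]sumr_const big_mkcond.
      apply: ler_sum => k _; case: ifPn => [kl|_]; last by rewrite invr_ge0 mulr_ge0// exprn_ge0.
      apply: small => //; first by rewrite /adjacent leqnSn.
      by rewrite xpair_eqE eqxx /= eq_sym.
    - destruct i as [|j]; first by rewrite mulr0 mulr_ge0// invr_ge0 mulr_ge0// exprn_ge0.
      apply: (@le_trans _ _ ((steps j)%:R * (4 * Nr j.+1 ^+ 3)^-1)); last first.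
        by rewrite ler_wpM2r ?ler_nat ?leq_steps// invr_ge0 mulr_ge0// exprn_ge0.
      rewrite mulr_sumr mulr_natl -[X in _ <= _ *+ X]card_ord -[leRHS]sumr_const.
      apply: ler_sum => k _; apply: small => //; first by rewrite /adjacent; lia.
      by rewrite xpair_eqE gtn_eqF.
    - rewrite -natrM; have -> : (2 * steps i)%N = steps i.+1 by rewrite /steps addSn expnS.
      rewrite mulr_sumr mulr_natl -[X in _ <= _ *+ X]card_ord -[leRHS]sumr_const.
      apply: ler_sum => k _; apply: small => //; first by rewrite /adjacent; lia.
      by rewrite xpair_eqE ltn_eqF.
  rewrite (le_trans (lenD _ _))// !lenZ len_axis// mulr1 lerD//.
    have -> : len (h i l.+1) = 1 by rewrite len_edge// -natr1 u1 sqrtr1.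
    by rewrite mulr1 ler_norml; lra.
  have q0 : 0 <= q.
    rewrite exprn_ge0// subr_ge0.
    have /andP[g0 g1] := leak01 b01' (s i l) i l.
    have /andP[_ cl] := c01 i l.
    rewrite -[leRHS]mulr1 ler_pM//.
    apply: le_trans cl _; rewrite invf_le1 ?mulr_gt0 ?ltr0n ?expn_gt0//.
    have : 1 <= Nr i by rewrite ler1n expn_gt0.
    by rewrite -/(Nr i); lra.
  rewrite normrM ger0_norm// (le_trans (ler_piMr _ b1))//.
  by rewrite div1r; exact: gm.
have block_len i : len (run (block i) (e_ i) - e_ i.+1) <= 6 / Nr i.
  have -> : 6 / Nr i = (steps i)%:R * (6 / Nr i ^+ 2).
    by rewrite -/(Nr i); field; rewrite st0.
  have := @len_iter_sum (fun l => run (step_word i l)) (h i) (6 / Nr i ^+ 2) (steps i).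
  rewrite h0 hN => /(_ _ _ (step_len i)); rewrite /block.
  have -> : foldl (fun x l => run (step_word i l) x) (e_ i) (iota 0 (steps i)) =
      run (flatten [seq step_word i l | l <- iota 0 (steps i)]) (e_ i).
    elim: (iota _ _) (e_ i) => //= l r IH x; by rewrite IH /run proj_word_cat.
  by apply => l; [exact: linfn_proj_word|exact: contracting_proj_word].
(* The letter [kE] in front makes the words nonempty and sends the initial coordinate vector to a
   multiple of [e_ 0]; at the start of later blocks it is harmless, as it fixes every [e_ i]. *)
have [k [L [L0 Lge LS kL]]] := @concat_words 'I_3 kE (fun i => kE :: block i) (fun=> isT).
pose nu0 := apex steps c p0 p1 0%N.
have nu0_gt0 : 0 < nu0 by exact: apex_gt0.
(* The orbit has to start at a coordinate vector, which will stand for [X0]. The apex coordinate of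
   [vertex 0] meets no other vertex and projects to [nu0 *: e_ 0]. At the end of each block the
   orbit is within [nu0 / 8] of [nu0 *: e_ i], and consecutive [e_ i] are at distance at least 1,
   which leaves more than [nu0 / 2]. *)
exists W, k, (pickle (3%N, 0%N, 0%N)), (nu0 / 2); split.
- by rewrite divr_gt0.
- exact: tot.
move=> x x0 xS N.
have xE q : x q.+1 = proj tot (k q) (x q) by apply/esym/projE.
have xL i j : (j <= size (kE :: block i))%N ->
    x (L i + j)%N = run (take j (kE :: block i)) (x (L i)).
  elim: j => [|j IH] ji; first by rewrite addn0 take0.
  rewrite addnS xE IH 1?ltnW// (take_nth kE)// -cats1 /run proj_word_cat /=.
  by rewrite kL.
pose y i := x (L i).+1.
have yE i : y i = proj tot kE (x (L i)) by rewrite /y -addn1 xL //= take0.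
have yS i : y i.+1 = proj tot kE (run (block i) (y i)).
  by rewrite yE LS xL// take_size yE.
have y0 : y 0%N = nu0 *: e_ 0%N.
  by rewrite yE L0 x0; apply: projE; exact: projE_basis3.
have pre i : proj tot kE (e_ i) = e_ i by exact: proj_vertex.
have ylen i : len (y i - nu0 *: e_ i) <= nu0 * \sum_(j < i) 6 / Nr j.
  elim: i => [|i IH]; first by rewrite y0 subrr len0 big_ord0 mulr0.
  rewrite yS -[e_ i.+1]pre -(linfnZ (linfn_proj tot kE)) -(linfnB (linfn_proj tot kE)).
  rewrite (le_trans (contracting_proj _ _ _))//.
  have -> : run (block i) (y i) - nu0 *: e_ i.+1 =
      run (block i) (y i - nu0 *: e_ i) + nu0 *: (run (block i) (e_ i) - e_ i.+1).
    rewrite /run (linfnB (linfn_proj_word tot _)) (linfnZ (linfn_proj_word tot _)) scalerBr.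
    by rewrite addrA subrK.
  rewrite (le_trans (lenD _ _))// big_ord_recr mulrDr lerD//.
    by rewrite (le_trans (contracting_proj_word _ _ _)).
  by rewrite lenZ gtr0_norm// ler_wpM2l// ltW.
have sum_small i : \sum_(j < i) 6 / Nr j <= 8^-1.
  (* The induction needs the remaining tail of the geometric series, 12 / N_i, to be kept aside. *)
  suff : \sum_(j < i) 6 / Nr j <= 8^-1 - 12 / Nr i.
    have : 0 < 12 / Nr i by rewrite divr_gt0.
    lra.
  elim: i {yE ylen} => [|i IH]; first by rewrite big_ord0 /Nr /steps /=; lra.
  rewrite big_ord_recr /=.
  have -> : Nr i.+1 = 2 * Nr i by rewrite /Nr /steps addSn expnS natrM.
  have -> : 12 / (2 * Nr i) = 6 / Nr i by field; rewrite st0.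
  have E : 12 / Nr i = 6 / Nr i + 6 / Nr i by field; rewrite st0.
  by move: IH; rewrite E; lra.
have ynear i : len (y i - nu0 *: e_ i) <= nu0 / 8.
  by rewrite (le_trans (ylen i))// ler_wpM2l// ltW.
exists (L N).+1, (L N.+1).+1; split.
- by rewrite (leq_trans (Lge N)).
- by rewrite (leq_trans (Lge N))// LS ltnW// ltnS leq_addr.
rewrite -/(y N) -/(y N.+1).
have e1 : 1 <= len (e_ N - e_ N.+1).
  rewrite -(@expr_ge1 _ 2)// ?len_ge0// sqr_len dotBl !dotBr !dot_vertex// !eqxx.
  by rewrite ltn_eqF// gtn_eqF//=; lra.
have : len (nu0 *: (e_ N - e_ N.+1)) <= len (y N - y N.+1) + len (y N - nu0 *: e_ N) +
    len (y N.+1 - nu0 *: e_ N.+1).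
  have -> : nu0 *: (e_ N - e_ N.+1) = (y N - y N.+1) - (y N - nu0 *: e_ N) +
    (y N.+1 - nu0 *: e_ N.+1).
    rewrite scalerBr; move: (_ *: e_ N) (_ *: e_ N.+1) => u v; ring.
  by rewrite (le_trans (lenD _ _))// lerD2r (le_trans (lenB _ _)).
rewrite lenZ gtr0_norm//; have := ynear N; have := ynear N.+1; nra.
Qed.

End strange.

Import numFieldNormedType.Exports.

Local Open Scope classical_set_scope.
Local Open Scope ring_scope.

(** * Rotation invariance of Gaussian measures *)

Section measure_images.
Context d1 d2 (T1 : measurableType d1) (T2 : measurableType d2) (R : realType).
Variables (mu : {measure set T1 -> \bar R}) (f : T1 -> T2).
Hypothesis mf : measurable_fun setT f.

Definition image_measure : {measure set T2 -> \bar R} :=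
  measure_function_pushforward__canonical__measure_function_Measure mu mf.

Lemma image_measureE A : image_measure A = mu (f @^-1` A).
Proof. by []. Qed.

End measure_images.

(** * Translations, shears and rotations of Lebesgue measure *)

Section lebesgue_translation.
Variable R : realType.
Notation mu := (@lebesgue_measure R).
Notation mR := (measurableTypeR R).

Lemma measurable_add (a : R) : measurable_fun setT ((fun x => x + a) : mR -> mR).
Proof. exact: measurable_funD. Qed.

Lemma lebesgue_measure_translation (a : R) (A : set R) : measurable A ->
  mu ((fun x => x + a) @^-1` A) = mu A.
Proof.
move=> mA; have mf := measurable_add a.
apply/esym; rewrite -(image_measureE mu mf).
apply: lebesgue_measure_unique => // _ [[x y] _ <-] /=.
rewrite /pushforward.
have -> : (fun x0 : R => x0 + a) @^-1` `]x, y] = `](x - a), (y - a)]%classic.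
  by apply/seteqP; split => z /=; rewrite !in_itv /= ltrBlDr lerBrDr.
rewrite !lebesgue_measure_itv /= !lte_fin ltrD2r; case: ifP => // _.
by rewrite -!EFinB; congr EFin; ring.
Qed.

Let mu2 := (mu \x mu)%E.

Lemma measurable_shear1 (a : R) :
  measurable_fun setT ((fun z => (z.1 + a * z.2, z.2)) : mR * mR -> mR * mR).
Proof.
apply: measurable_fun_pair => //.
by apply: measurable_funD => //; apply: measurable_funM.
Qed.

Lemma measurable_shear2 (a : R) :
  measurable_fun setT ((fun z => (z.1, z.2 + a * z.1)) : mR * mR -> mR * mR).
Proof.
apply: measurable_fun_pair => //.
by apply: measurable_funD => //; apply: measurable_funM.
Qed.

Lemma lebesgue_shear2 (a : R) (A : set (mR * mR)) : measurable A ->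
  mu2 ((fun z => (z.1, z.2 + a * z.1)) @^-1` A) = mu2 A.
Proof.
move=> mA; rewrite /mu2 /product_measure1; apply: eq_integral => x _ /=.
have -> : xsection ((fun z => (z.1, z.2 + a * z.1)) @^-1` A) x =
    (fun y => y + a * x) @^-1` xsection A x.
  by apply/seteqP; split => y; rewrite /xsection /= !inE.
by rewrite lebesgue_measure_translation//; exact: measurable_xsection.
Qed.

Lemma lebesgue_shear1 (a : R) (A : set (mR * mR)) : measurable A ->
  mu2 ((fun z => (z.1 + a * z.2, z.2)) @^-1` A) = mu2 A.
Proof.
(* This shear moves the first coordinate, so the slices must fix the second one: the other iterated
   integral is needed. *)
have E B : measurable B -> mu2 B = (mu \x^ mu)%E B.
  by apply: product_measure_unique => //= ? ? ? ?; rewrite product_measure2E.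
move=> mA; rewrite !E//; last first.
  by rewrite -[X in measurable X]setTI; exact: measurable_shear1.
rewrite /product_measure2; apply: eq_integral => y _ /=.
have -> : ysection ((fun z => (z.1 + a * z.2, z.2)) @^-1` A) y =
    (fun x => x + a * y) @^-1` ysection A y.
  by apply/seteqP; split => x; rewrite /ysection /= !inE.
by rewrite lebesgue_measure_translation//; exact: measurable_ysection.
Qed.

Definition rotation (c s : R) (z : mR * mR) : mR * mR :=
  (c * z.1 + s * z.2, c * z.2 - s * z.1).

Lemma measurable_rotation c s : measurable_fun setT (rotation c s).
Proof.
apply: measurable_fun_pair.
  by apply: measurable_funD; apply: measurable_funM.
by apply: measurable_funB; apply: measurable_funM.
Qed.

(* A rotation is a product of three shears. *)
Lemma lebesgue_rotation (c s : R) (A : set (mR * mR)) : measurable A ->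
  s != 0 -> c ^+ 2 + s ^+ 2 = 1 ->
  mu2 (rotation c s @^-1` A) = mu2 A.
Proof.
(* [t] is the tangent of the half angle. *)
move=> mA s0 cs; pose t := (1 - c) / s.
have -> : rotation c s @^-1` A = (fun z => (z.1 + t * z.2, z.2)) @^-1`
   ((fun z => (z.1, z.2 + (- s) * z.1)) @^-1` ((fun z => (z.1 + t * z.2, z.2)) @^-1` A)).
  have E z : rotation c s z = (z.1 + t * z.2 + t * (z.2 + - s * (z.1 + t * z.2)),
      z.2 + - s * (z.1 + t * z.2)).
    have ts : t * s = 1 - c by rewrite /t divfK.
    have tc : t * (1 + c) = s.
      apply: (mulfI s0); rewrite mulrCA mulrA ts -expr2.
      by transitivity (1 - c ^+ 2); [ring|rewrite -cs; ring].
    have -> : z.1 + t * z.2 + t * (z.2 + - s * (z.1 + t * z.2)) =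
      z.1 * (1 - t * s) + z.2 * (t * (1 + (1 - t * s))) by ring.
    have -> : z.2 + - s * (z.1 + t * z.2) = z.2 * (1 - t * s) - s * z.1 by ring.
    have -> : 1 - t * s = c by rewrite ts; ring.
    by rewrite tc /rotation; congr (_, _); ring.
  by apply/seteqP; split => z /=; rewrite E.
have m1 B : measurable B -> measurable ((fun z : mR * mR => (z.1 + t * z.2, z.2)) @^-1` B).
  by move=> mB; rewrite -[X in measurable X]setTI; exact: measurable_shear1.
have m2 B : measurable B -> measurable ((fun z : mR * mR => (z.1, z.2 + (- s) * z.1)) @^-1` B).
  by move=> mB; rewrite -[X in measurable X]setTI; exact: measurable_shear2.
by rewrite lebesgue_shear1; [rewrite lebesgue_shear2;
  [rewrite lebesgue_shear1|exact: m1]|apply: m2; exact: m1].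
Qed.

End lebesgue_translation.

Section density_measure.
Context d (T : measurableType d) (R : realType).
Variables (mu : {measure set T -> \bar R}) (f : T -> \bar R).
Hypotheses (mf : measurable_fun setT f) (f0 : forall x, (0 <= f x)%E).

Definition density_fun (A : set T) : \bar R := (\int[mu]_(x in A) f x)%E.

Let density0 : density_fun set0 = 0%E. Proof. exact: integral_set0. Qed.

Let density_ge0 A : (0 <= density_fun A)%E.
Proof. by apply: integral_ge0 => x _. Qed.

Let density_sigma_additive : semi_sigma_additive density_fun.
Proof.
move=> A mA tA mUA; rewrite /density_fun ge0_integral_bigcup//; last first.
  exact: measurable_funTS.
by apply: is_cvg_ereal_nneg_natsum_cond => n _ _; apply: integral_ge0.
Qed.

Definition density_measure : {measure set T -> \bar R} :=
  HB.pack density_fun (isMeasure.Build _ _ _ density_fun density0 density_ge0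
    density_sigma_additive).

Lemma density_measureE A : density_measure A = (\int[mu]_(x in A) f x)%E.
Proof. by []. Qed.

End density_measure.

(** * Rotation of two independent normal variables *)

Section normal_rotation.
Variables (R : realType) (sigma : R).
Hypothesis sigma0 : sigma != 0.
Notation mu := (@lebesgue_measure R).
Notation mR := (measurableTypeR R).
Notation gamma := (normal_prob 0 sigma).
Notation phi := (normal_pdf 0 sigma).

Let rho (z : mR * mR) : \bar R := (phi z.1 * phi z.2)%:E.

Let mrho : measurable_fun setT rho.
Proof.
apply/measurable_EFinP; apply: measurable_funM;
  apply: (measurableT_comp (measurable_normal_pdf _ _)) => //.
Qed.

Let rho0 z : (0 <= rho z)%E.
Proof. by rewrite lee_fin mulr_ge0// normal_pdf_ge0. Qed.

(** Tonelli's theorem gives the equality on rectangles, and uniqueness of the product measure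
    extends it. *)
Lemma normal_product_density (X : set (mR * mR)) : measurable X ->
  (gamma \x gamma)%E X = (\int[(mu \x mu)%E]_(z in X) rho z)%E.
Proof.
rewrite -(density_measureE _ mrho rho0).
apply: product_measure_unique => //= A B mA mB.
have mAB : measurable (A `*` B) by exact: measurableX.
have mpatch (C : set mR) : measurable C ->
    measurable_fun setT ((fun x => (phi x)%:E) \_ C).
  move=> mC; apply/(measurable_restrictT _ _).1 => //; apply: measurable_funTS.
  by apply/measurable_EFinP; exact: measurable_normal_pdf.
have patch_ge0 (C : set mR) x : (0 <= ((fun x => (phi x)%:E) \_ C) x)%E.
  by rewrite /patch; case: ifP => // _; rewrite lee_fin normal_pdf_ge0.
rewrite /density_fun integral_mkcond fubini_tonelli1; last 2 first.
- by apply/(measurable_restrictT _ _).1 => //; exact: measurable_funTS.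
- by move=> z; rewrite /patch; case: ifP.
rewrite /normal_prob [X in (X * _)%E]integral_mkcond -ge0_integralZr//; [|exact: mpatch|];
  last by apply: integral_ge0 => x _; rewrite lee_fin normal_pdf_ge0.
apply: eq_integral => x _; rewrite /fubini_F.
rewrite [X in (_ * X)%E]integral_mkcond.
rewrite -ge0_integralZl//; [|exact: mpatch].
apply: eq_integral => y _; rewrite /patch in_setX /rho /=.
by case: (x \in A) (y \in B) => [] [] //=; rewrite ?mul0e ?mule0.
Qed.

(** The joint density is a function of the norm only, and Lebesgue measure of the plane is invariant
    under rotations. *)
Lemma normal_rotation (c s : R) (X : set (mR * mR)) : measurable X ->
  s != 0 -> c ^+ 2 + s ^+ 2 = 1 ->
  (gamma \x gamma)%E (rotation c s @^-1` X) = (gamma \x gamma)%E X.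
Proof.
move=> mX s0 cs; have mr := measurable_rotation c s.
have mrX : measurable (rotation c s @^-1` X) by rewrite -[X in measurable X]setTI; exact: mr.
rewrite !normal_product_density//.
have <- : (\int[image_measure (mu \x mu)%E mr]_(z in X) rho z =
    \int[(mu \x mu)%E]_(z in X) rho z)%E.
  by apply: eq_measure_integral => A mA _; exact: lebesgue_rotation.
rewrite ge0_integral_pushforward//; last exact: measurable_funTS.
apply: eq_integral => z _; rewrite /rho /= !normal_pdfE//; congr EFin.
rewrite /normal_fun mulrACA [RHS]mulrACA -!expRD; congr (_ * expR _).
rewrite !subr0 -!mulrDl; congr (_ / _).
rewrite /rotation /= -[LHS]mulr1 -cs; ring.
Qed.

End normal_rotation.

Lemma measurable_norm_ge d (T : measurableType d) (R : realType) (f : T -> R) (e : R) :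
  measurable_fun setT f -> measurable [set t | e <= `|f t|].
Proof.
move=> mf; rewrite (_ : [set _ | _] = (fun t => `|f t|) @^-1` `[e, +oo[).
  rewrite -[X in measurable X]setTI.
  by apply: (measurableT_comp (@normr_measurable R setT) mf).
by apply/seteqP; split => t /=; rewrite in_itv /= andbT.
Qed.

(** As [Y] and [- Y] have the same law, the integral, which is finite, equals its own opposite. *)
Lemma symmetric_mean0 d (T : measurableType d) (R : realType) (P : probability T R)
    (Y : T -> R) : P.-integrable setT (EFin \o Y) ->
  (forall B : set R, measurable B -> P ((fun t => - Y t) @^-1` B) = P (Y @^-1` B)) ->
  (\int[P]_t (Y t)%:E = 0)%E.
Proof.
move=> iY symY; have mY : measurable_fun setT (Y : T -> measurableTypeR R).
  by have /measurable_EFinP := measurable_int _ iY.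
have mN : measurable_fun setT ((fun t => - Y t) : T -> measurableTypeR R).
  exact: (measurableT_comp (@oppr_measurable R setT)).
have iN : P.-integrable setT (EFin \o (fun t => - Y t)).
  apply: (eq_integrable _ (fun t => (-1)%:E * (Y t)%:E)%E) => //.
    by move=> t _; rewrite /= -EFinM mulN1r.
  exact: integrableZl.
have mE : measurable_fun setT (EFin : measurableTypeR R -> \bar R).
  exact/measurable_EFinP.
have F : (\int[P]_t (Y t)%:E = - \int[P]_t (Y t)%:E)%E.
  transitivity (\int[image_measure P mN]_x x%:E)%E; last first.
    rewrite integral_pushforward// -[RHS]mulN1e -integralZl//.
    by apply: eq_integral => t _; rewrite /= -EFinM mulN1r.
  transitivity (\int[image_measure P mY]_x x%:E)%E; first by rewrite integral_pushforward.
  by apply: eq_measure_integral => A mA _; apply/esym; exact: symY.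
have fI : (\int[P]_t (Y t)%:E)%E \is a fin_num by exact: integrable_fin_num.
move: F; rewrite -(fineK fI) -EFinN => -[]; set v := fine _ => vE.
by congr EFin; lra.
Qed.

(** * Centred normal laws: symmetry, integrability, tails *)

Section normal_moments.
Variables (R : realType) (sigma : R).
Hypothesis sigma_gt0 : 0 < sigma.
Notation mu := (@lebesgue_measure R).
Notation mR := (measurableTypeR R).
Notation gamma := (normal_prob 0 sigma).
Notation phi := (normal_pdf 0 sigma).

Let sigma0 : sigma != 0. Proof. by rewrite gt_eqF. Qed.

Lemma normal_shift m (A : set R) : measurable A ->
  normal_prob m sigma ((fun x => x - m) @^-1` A) = gamma A.
Proof.
move=> mA; have ms := measurable_add (- m).
have mphi : measurable_fun setT (fun x => (phi x)%:E).
  by apply/measurable_EFinP; exact: measurable_normal_pdf.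
rewrite /normal_prob.
have -> : (\int[mu]_(x in A) (phi x)%:E = \int[image_measure mu ms]_(x in A) (phi x)%:E)%E.
  apply: eq_measure_integral => B mB _; apply/esym.
  exact: (lebesgue_measure_translation (- m) mB).
rewrite ge0_integral_pushforward//; last 2 first.
- exact: measurable_funTS.
- by move=> y _; rewrite lee_fin normal_pdf_ge0.
apply: eq_integral => x _ /=; rewrite !normal_pdfE//.
by rewrite normal_fun_center.
Qed.

(** A quarter turn maps (x, y) to (y, - x); rotation invariance is applied to the strip [setT] times
    [A]. *)
Lemma normal_opp (A : set R) : measurable A -> gamma ((fun x => - x) @^-1` A) = gamma A.
Proof.
move=> mA; have := @normal_rotation R sigma sigma0 0 1 (setT `*` A).
have -> : rotation 0 1 @^-1` (setT `*` A) = ((fun x => - x) @^-1` A) `*` setT :> set (mR * mR).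
  by apply/seteqP; split => -[x y] /=; rewrite /rotation /= mul0r mul1r sub0r; tauto.
have mNA : measurable ((fun x => - x) @^-1` A : set mR).
  by rewrite -[X in measurable X]setTI; exact: oppr_measurable.
rewrite expr0n expr1n add0r oner_eq0 => /(_ (measurableX measurableT mA) isT erefl).
have g1 : gamma setT = 1%E by rewrite /normal_prob integral_normal_pdf.
by rewrite !product_measure1E//= g1 mule1 mul1e.
Qed.

(** The density is given through measures of sets; the Radon-Nikodym derivative, which agrees with
    [phi] almost everywhere, carries it over to integrals of functions. *)
Lemma normal_integral (f : mR -> \bar R) : (forall x, 0 <= f x)%E -> measurable_fun setT f ->
  (\int[gamma]_x f x = \int[mu]_x (f x * (phi x)%:E))%E.
Proof.
move=> f0 mf; have dom := normal_prob_dominates (0 : R) sigma.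
rewrite -(Radon_Nikodym_SigmaFinite.change_of_variables dom)//.
set g := Radon_Nikodym_SigmaFinite.f _ _.
have mphi : measurable_fun setT (fun x => (phi x)%:E).
  by apply/measurable_EFinP; exact: measurable_normal_pdf.
have ig : mu.-integrable setT g := Radon_Nikodym_SigmaFinite.f_integrable dom.
have ae : ae_eq mu setT g (fun x => (phi x)%:E).
  apply: integral_ae_eq => //.
  by move=> E _ mE; rewrite -(Radon_Nikodym_SigmaFinite.f_integral dom mE).
apply: ae_eq_integral => //.
- by apply: emeasurable_funM => //; exact: measurable_int ig.
- by apply: emeasurable_funM.
by apply: filterS ae => x h xT; rewrite h.
Qed.

Lemma normal_abs_lty : (\int[gamma]_x `|x|%:E < +oo)%E.
Proof.
rewrite normal_integral//; last by apply/measurable_EFinP; exact: normr_measurable.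
(* With y = x^2 / (4 sigma^2) the density decays like e^(-2y), and |x| <= sigma (1 + y) <= sigma e^y
   uses up one factor e^(-y). What remains is the normal density of deviation sqrt 2 sigma, up to
   the constant [K]. *)
pose s2 := Num.sqrt 2 * sigma; have s20 : s2 != 0 by rewrite mulf_neq0// gt_eqF// sqrtr_gt0.
pose K := sigma * normal_peak sigma / normal_peak s2.
have K0 : 0 <= K by rewrite divr_ge0 ?mulr_ge0 ?normal_peak_ge0// ltW.
have mphi s : measurable_fun setT (fun x : mR => (normal_pdf (0 : R) s x)%:E).
  by apply/measurable_EFinP; exact: measurable_normal_pdf.
apply: (@le_lt_trans _ _ (\int[mu]_x (K%:E * (normal_pdf 0 s2 x)%:E))%E).
  apply: ge0_le_integral => //.
  - by move=> x _; rewrite -EFinM lee_fin mulr_ge0// normal_pdf_ge0.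
  - by apply: emeasurable_funM => //; apply/measurable_EFinP; exact: normr_measurable.
  - by apply: emeasurable_funM.
  move=> x _; rewrite -!EFinM lee_fin !normal_pdfE//.
  rewrite [leRHS]mulrA /K divfK; last by rewrite gt_eqF// normal_peak_gt0.
  rewrite mulrCA [sigma * _]mulrC -mulrA ler_wpM2l ?normal_peak_ge0//.
  rewrite /normal_fun !subr0 exprMn sqr_sqrtr//.
  pose y := x ^+ 2 / (sigma ^+ 2 *+ 2 *+ 2).
  have -> : - x ^+ 2 / (sigma ^+ 2 *+ 2) = - y - y.
    by rewrite /y; field.
  have -> : - x ^+ 2 / (2 * sigma ^+ 2 *+ 2) = - y.
    by rewrite /y; field.
  rewrite expRD mulrA ler_pM2r ?expR_gt0// expRN -ler_pdivlMr ?invr_gt0 ?expR_gt0//.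
  rewrite invrK; apply: (@le_trans _ _ (sigma * (1 + y))); last first.
    by rewrite ler_pM2l// expR_ge1Dx.
  rewrite -subr_ge0; have -> : sigma * (1 + y) - `|x| = sigma * (1 - `|x| / (sigma *+ 2)) ^+ 2.
    by rewrite /y -[x ^+ 2]real_normK ?num_real//; field.
  by rewrite mulr_ge0 ?sqr_ge0// ltW.
rewrite ge0_integralZl//; last by move=> x _; rewrite lee_fin normal_pdf_ge0.
by rewrite integral_normal_pdf mule1 ltry.
Qed.

Lemma normal_tail_gt0 e : 0 < e -> (0 < gamma [set x | e <= `|x|]%R)%E.
Proof.
move=> e0; have mphi : measurable_fun setT (fun x => (phi x)%:E).
  by apply/measurable_EFinP; exact: measurable_normal_pdf.
have mI : measurable (`[e, e + 1] : set mR) by exact: measurable_itv.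
apply: (@lt_le_trans _ _ (gamma `[e, e + 1])); last first.
  apply: le_measure; rewrite ?inE//.
    exact: (@measurable_norm_ge _ mR R id).
  by move=> x /=; rewrite in_itv /= => /andP[ex _]; rewrite (le_trans ex)// ler_norm.
apply: (@lt_le_trans _ _ (\int[mu]_(x in `[e, (e + 1)%R]) (phi (e + 1))%:E)%E).
  rewrite integral_cst//= lebesgue_measure_itv /= lte_fin ltrDl ltr01 -EFinB -EFinM lte_fin.
  rewrite mulr_gt0 ?subr_gt0 ?ltrDl// normal_pdfE// mulr_gt0 ?normal_peak_gt0//.
  exact: expR_gt0.
apply: ge0_le_integral => //.
- by move=> x _; rewrite lee_fin normal_pdf_ge0.
- exact: measurable_funTS.
move=> x /=; rewrite in_itv /= => /andP[ex xe]; rewrite lee_fin !normal_pdfE//.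
rewrite ler_wpM2l ?normal_peak_ge0// ler_expR !subr0 ler_wpM2r ?invr_ge0 ?mulrn_wge0 ?sqr_ge0//.
by rewrite lerN2 ler_sqr ?nnegrE; lra.
Qed.

End normal_moments.

(** * Independent families and conditional expectations *)

Section sigma_fields.
Context d (T : measurableType d) (R : realType).
Implicit Types (C : set (set T)) (f g : T -> R).

Definition adapted C f := forall B : set R, measurable B -> C (f @^-1` B).

Lemma adapted_measurable f : adapted measurable f <-> measurable_fun setT f.
Proof.
split=> [h _ B mB|h B mB]; first by rewrite setTI; exact: h.
by rewrite -[_ @^-1` _]setTI; exact: h.
Qed.

(** Makes the closure properties of measurable functions available for an arbitrary sigma-field. *)
Lemma adapted_gen C f : sigma_algebra setT C ->
  adapted C f <-> measurable_fun setT (f : g_sigma_algebraType C -> R).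
Proof.
move=> sC; have CE : <<s C >> = C by exact: sigma_algebra_id.
split=> [h _ B mB|h B mB].
  by rewrite setTI; rewrite /measurable /= CE; exact: h.
have := h measurableT B mB; rewrite setTI.
by rewrite /measurable /= CE.
Qed.

Lemma adapted_lin C a f g : sigma_algebra setT C -> adapted C f -> adapted C g ->
  adapted C (fun t => a * f t + g t).
Proof.
move=> sC /(adapted_gen _ sC) mf /(adapted_gen _ sC) mg; apply/adapted_gen => //.
by apply: measurable_funD => //; exact: measurable_funM.
Qed.

Lemma adapted_cst C a : sigma_algebra setT C -> adapted C (fun=> a).
Proof. by move=> sC; apply/adapted_gen => //; exact: measurable_cst. Qed.

End sigma_fields.

Section independence.
Context d (T : measurableType d) (R : realType) (P : probability T R).
Implicit Types (G : set (set T)) (F A : set T).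

(** As functions of [A], both sides are finite measures; they agree on a generating pi-system. *)
Lemma indep_gen G F (r : R) : G `<=` measurable -> setI_closed G -> G setT ->
  measurable F -> 0 <= r -> (forall A, G A -> P (A `&` F) = P A * r%:E)%E ->
  forall A, <<s G >> A -> (P (A `&` F) = P A * r%:E)%E.
Proof.
move=> Gm GI GT mF r0 GF A GA.
pose m1 : {measure set T -> \bar R} := mrestr P mF.
pose m2 : {measure set T -> \bar R} := mscale (NngNum r0) P.
pose g (k : nat) : set T := setT.
have cover : \bigcup_k g k = setT.
  by apply/seteqP; split=> // x _; exists 0%N.
have m12 B : G B -> m1 B = m2 B.
  by move=> GB; rewrite /m1 /m2 /= /mrestr /mscale /= GF// muleC.
have m1oo (k : nat) : (m1 setT < +oo)%E.
  by rewrite /m1 /= /mrestr setTI (le_lt_trans (probability_le1 _ _))// ltry.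
have := @g_sigma_algebra_measure_unique _ _ _ G Gm g (fun=> GT) cover m1 m2 GI m12 m1oo _ GA.
by rewrite /m1 /m2 /= /mrestr /mscale /= muleC.
Qed.

End independence.

(** * Independent identically distributed sequences *)

Section iid.
Context d (T : measurableType d) (R : realType) (P : probability T R).
Variable mu : set R -> \bar R.
Hypothesis muT : mu setT = 1%E.
Implicit Types (Z : nat -> T -> R) (B : nat -> set R).

Definition box Z n B := \big[setI/setT]_(i < n) Z i @^-1` B i.

(** Initial segments of the indices suffice: since [mu] has total mass 1, the set [setT] frees a
    coordinate. *)
Definition iid Z := (forall i, measurable_fun setT (Z i)) /\
  forall n B, (forall i, measurable (B i)) -> (P (box Z n B) = \prod_(i < n) mu (B i))%E.

Lemma box_mem Z n B t : box Z n B t <-> forall i, (i < n)%N -> B i (Z i t).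
Proof.
rewrite /box; elim: n => [|n IH]; first by rewrite big_ord0; split.
rewrite big_ord_recr /=; split=> [[/IH h hn] i|h].
  by rewrite ltnS leq_eqVlt => /predU1P[->//|/h].
by split; [apply/IH => i ni; apply: h; rewrite ltnS ltnW|exact: h].
Qed.

Lemma box_ext Z n m B : (n <= m)%N ->
  box Z n B = box Z m (fun i => if (i < n)%N then B i else setT).
Proof.
move=> nm; apply/seteqP; split => t /box_mem h; apply/box_mem => i im.
  by case: ifPn => // /h.
by have := h i (leq_trans im nm); rewrite im.
Qed.

Lemma boxI Z n B B' : box Z n B `&` box Z n B' = box Z n (fun i => B i `&` B' i).
Proof.
apply/seteqP; split => t.
  by move=> [/box_mem h /box_mem h']; apply/box_mem => i ni; split; [exact: h|exact: h'].
by move=> /box_mem h; split; apply/box_mem => i /h [].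
Qed.

Lemma measurable_box Z n B : (forall i, measurable_fun setT (Z i)) ->
  (forall i, measurable (B i)) -> measurable (box Z n B).
Proof.
move=> mZ mB; apply: bigsetI_measurable => i _.
by rewrite -[X in measurable X]setTI; exact: mZ.
Qed.

(** The pi-system of finite-dimensional boxes over the coordinates in [S], as required by
    [indep_gen]. *)
Definition boxes_on (S : pred nat) Z : set (set T) := [set A | exists n B,
  [/\ forall i, measurable (B i), forall i, ~~ S i -> B i = setT & A = box Z n B]].

Lemma boxes_on_setI S Z : setI_closed (boxes_on S Z).
Proof.
move=> _ _ [n [B [mB BS ->]]] [m [B' [mB' BS' ->]]].
rewrite (box_ext Z B (leq_maxl n m)) (box_ext Z B' (leq_maxr n m)) boxI.
eexists; eexists; split; last reflexivity.
  by move=> i; apply: measurableI; case: ifP.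
by move=> i Si; rewrite /= BS// BS'// !if_same setIT.
Qed.

Lemma boxes_on_setT S Z : boxes_on S Z setT.
Proof. by exists 0%N, (fun=> setT); split => //; rewrite /box big_ord0. Qed.

Lemma boxes_on_measurable S Z : (forall i, measurable_fun setT (Z i)) ->
  boxes_on S Z `<=` measurable.
Proof. by move=> mZ _ [n [B [mB _ ->]]]; exact: measurable_box. Qed.

Definition sigma_on S Z := <<s boxes_on S Z >>.

Lemma sigma_on_algebra S Z : sigma_algebra setT (sigma_on S Z).
Proof. exact: smallest_sigma_algebra. Qed.

Lemma sigma_on_measurable S Z A : (forall i, measurable_fun setT (Z i)) ->
  sigma_on S Z A -> measurable A.
Proof.
move=> mZ; apply: smallest_sub; first exact: sigma_algebra_measurable.
exact: boxes_on_measurable.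
Qed.

Lemma sigma_on_adapted (S : pred nat) Z i : S i -> adapted (sigma_on S Z) (Z i).
Proof.
move=> Si B mB; apply: sub_sigma_algebra.
exists i.+1, (fun j => if j == i then B else setT); split.
- by move=> j; case: ifP.
- by move=> j Sj; case: eqP => // ji; rewrite ji Si in Sj.
apply/seteqP; split => t /=.
  by move=> Bt; apply/box_mem => j _; case: eqP => [->|].
by move/box_mem => /(_ i (ltnSn i)); rewrite eqxx.
Qed.

Lemma iid_law Z i (B : set R) : iid Z -> measurable B -> P (Z i @^-1` B) = mu B.
Proof.
move=> [mZ iidZ] mB; have := iidZ i.+1 (fun j => if j == i then B else setT).
have -> : box Z i.+1 (fun j => if j == i then B else setT) = Z i @^-1` B.
  apply/seteqP; split => t /=; last by move=> Bt; apply/box_mem => j _; case: eqP => [->|].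
  by move/box_mem => /(_ i (ltnSn i)); rewrite eqxx.
move=> ->; last by move=> j; case: ifP.
rewrite big_ord_recr /= eqxx big1 ?mul1e// => j _.
by rewrite ltn_eqF.
Qed.

(** For two boxes the product formula splits coordinate by coordinate, one of the two constraints
    being trivial. [indep_gen] then extends it to the sigma-fields, one side at a time. *)
Lemma iid_indep_on (S S' : pred nat) Z A A' : iid Z -> (forall i, ~~ (S i && S' i)) ->
  sigma_on S Z A -> sigma_on S' Z A' -> (P (A `&` A') = P A * P A')%E.
Proof.
move=> iidZ SS' SA SA'; have [mZ prodZ] := iidZ.
have PE D : measurable D -> P D = (fine (P D))%:E.
  by move=> mD; rewrite fineK// fin_num_measure.
have mA := sigma_on_measurable mZ SA.
have on_boxes D D' : boxes_on S Z D -> boxes_on S' Z D' -> (P (D `&` D') = P D * P D')%E.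
  move=> [n [B [mB BS ->]]] [m [B' [mB' BS' ->]]].
  rewrite (box_ext Z B (leq_maxl n m)) (box_ext Z B' (leq_maxr n m)) boxI.
  have mB1 i : measurable (if (i < n)%N then B i else setT) by case: ifP.
  have mB1' i : measurable (if (i < m)%N then B' i else setT) by case: ifP.
  rewrite !prodZ//; last by move=> i; exact: measurableI.
  rewrite -big_split; apply: eq_bigr => i _ /=.
  have := SS' i; rewrite negb_and => /orP[/BS ->|/BS' ->].
    by rewrite if_same setTI muT mul1e.
  by rewrite if_same setIT muT mule1.
have half D' : boxes_on S' Z D' -> (P (A `&` D') = P A * P D')%E.
  move=> S'D'; have mD' := boxes_on_measurable mZ S'D'.
  rewrite (PE D')//; apply: (indep_gen (G := boxes_on S Z)) => //.
  - exact: boxes_on_measurable.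
  - exact: boxes_on_setI.
  - exact: boxes_on_setT.
  - by rewrite fine_ge0.
  by move=> D SD; rewrite -PE//; exact: on_boxes.
rewrite setIC muleC (PE A)//; apply: (indep_gen (G := boxes_on S' Z)) => //.
- exact: boxes_on_measurable.
- exact: boxes_on_setI.
- exact: boxes_on_setT.
- by rewrite fine_ge0.
by move=> D' S'D'; rewrite -PE// setIC muleC; exact: half.
Qed.

Notation sigma_but a := (sigma_on (predC1 a)).

Lemma iid_indep_but Z a A (B : set R) : iid Z -> sigma_but a Z A -> measurable B ->
  P (A `&` Z a @^-1` B) = (P A * mu B)%E.
Proof.
move=> iidZ sA mB; rewrite -(iid_law a iidZ mB).
apply: (iid_indep_on (S' := pred1 a) iidZ _ sA) => [i|].
  by rewrite /= andNb.
by apply: sigma_on_adapted => //; rewrite /= eqxx.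
Qed.

End iid.

Notation sigma_but a := (sigma_on (predC1 a)).

(** * Linear combinations and plane rotations of a family *)

Section combinations.
Context (T : Type) (R : realType).
Implicit Types (Z : nat -> T -> R) (x y : {poly R}).

Definition lincomb Z x t : R := \sum_(i < size x) x`_i * Z i t.

Lemma lincomb_bound Z n x t : (size x <= n)%N -> lincomb Z x t = \sum_(i < n) x`_i * Z i t.
Proof.
move=> xn; rewrite /lincomb (big_ord_widen n (fun i => x`_i * Z i t) xn).
rewrite big_mkcond; apply: eq_bigr => i _; case: ifPn => //.
by rewrite -leqNgt => /(nth_default 0) ->; rewrite mul0r.
Qed.

Lemma lincomb_lin Z a x y t : lincomb Z (a *: x + y) t = a * lincomb Z x t + lincomb Z y t.
Proof.
have sx : (size (a *: x) <= maxn (size x) (size y))%N.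
  by rewrite (leq_trans (size_scale_leq _ _))// leq_maxl.
have sy := leq_maxr (size x) (size y).
rewrite (@lincomb_bound _ (maxn (size x) (size y))); last first.
  by rewrite (leq_trans (size_polyD _ _))// geq_max sx sy.
rewrite (lincomb_bound Z t (leq_maxl (size x) (size y))) (lincomb_bound Z t sy).
rewrite mulr_sumr -big_split; apply: eq_bigr => i _ /=.
by rewrite coefD coefZ mulrDl mulrA.
Qed.

Lemma lincomb0 Z t : lincomb Z 0 t = 0. Proof. by rewrite /lincomb size_poly0 big_ord0. Qed.

Lemma lincombZ Z a x t : lincomb Z (a *: x) t = a * lincomb Z x t.
Proof. by have := lincomb_lin Z a x 0 t; rewrite addr0 lincomb0 addr0. Qed.

Lemma lincombD Z x y t : lincomb Z (x + y) t = lincomb Z x t + lincomb Z y t.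
Proof. by have := lincomb_lin Z 1 x y t; rewrite scale1r mul1r. Qed.

Lemma lincombB Z x y t : lincomb Z (x - y) t = lincomb Z x t - lincomb Z y t.
Proof. by rewrite lincombD -scaleN1r lincombZ mulN1r. Qed.

Lemma lincombXn Z n t : lincomb Z 'X^n t = Z n t.
Proof.
rewrite /lincomb size_polyXn (bigD1 ord_max)//= coefXn eqxx mul1r big1 ?addr0//.
move=> i ni; rewrite coefXn; case: eqP => [E|]; last by rewrite mul0r.
by case/eqP: ni; exact: val_inj.
Qed.

Lemma functional_ext (f g : {poly R} -> R) :
  (forall a x y, f (a *: x + y) = a * f x + f y) ->
  (forall a x y, g (a *: x + y) = a * g x + g y) ->
  (forall n, f 'X^n = g 'X^n) -> f =1 g.
Proof.
move=> fl gl fg x; rewrite -(coefK x) poly_def; elim/big_rec: _ => [|i y _ IH].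
  have := fl 0 0 0; have := gl 0 0 0; rewrite !scale0r !addr0 !mul0r !add0r.
  have := fl 1 0 0; have := gl 1 0 0; rewrite scale1r addr0 !mul1r.
  by move=> h1 h2 _ _; lra.
by rewrite fl gl fg IH.
Qed.

End combinations.

Section givens.
Variables (R : realType) (k : nat) (c s : R).
Hypothesis cs : c ^+ 2 + s ^+ 2 = 1.

Definition givens (x : {poly R}) : {poly R} :=
  x + ((c - 1) * x`_k + s * x`_k.+1) *: 'X^k +
      ((c - 1) * x`_k.+1 - s * x`_k) *: 'X^(k.+1).

Lemma coef_givens x i : (givens x)`_i =
  if i == k then c * x`_k + s * x`_k.+1
  else if i == k.+1 then c * x`_k.+1 - s * x`_k else x`_i.
Proof.
rewrite /givens !coefD !coefZ !coefXn.
have [->|ik] := eqVneq i k; first by rewrite ltn_eqF//=; ring.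
by have [->|_] := eqVneq i k.+1 => /=; ring.
Qed.

Lemma linfn_givens : linfn givens.
Proof.
move=> a x y; apply/polyP => i; rewrite coef_givens [RHS]coefD [X in _ =
  X + _]coefZ !coef_givens !coefD !coefZ.
by do 2?[case: eqP => _]; ring.
Qed.

Lemma dot_givens x y : dot (givens x) (givens y) = dot x y.
Proof.
rewrite /givens !(dotDl, dotDr, dotZl, dotZr) ![dot _ 'X^_]dotC !dotXnl.
rewrite !coefXn !eqxx ltn_eqF// gtn_eqF//=.
set x0 := x`_k; set x1 := x`_k.+1; set y0 := y`_k; set y1 := y`_k.+1.
rewrite -[X in _ = X]addr0.
(* The difference of the two sides is this multiple of the constraint [cs]. *)
have -> : 0 = (c ^+ 2 + s ^+ 2 - 1) * (x0 * y0 + x1 * y1) by rewrite cs; ring.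
ring.
Qed.

(** The variables are rotated in the same way as the coefficients, so that linear combinations keep
    their values. *)
Definition turn (T : Type) (Z : nat -> T -> R) i t :=
  if i == k then c * Z k t + s * Z k.+1 t
  else if i == k.+1 then c * Z k.+1 t - s * Z k t else Z i t.

Lemma lincomb_turn (T : Type) (Z : nat -> T -> R) x t : lincomb (turn Z) (givens x) t =
  lincomb Z x t.
Proof.
apply: (@functional_ext R (fun x => lincomb (turn Z) (givens x) t) (fun x => lincomb Z x t)).
- by move=> a u v; rewrite linfn_givens lincomb_lin.
- by move=> a u v; rewrite lincomb_lin.
move=> n; rewrite /givens !coefXn !lincombD !lincombZ !lincombXn /turn !eqxx.
rewrite [k.+1 == k]gtn_eqF// ![_ == n]eq_sym.
have [->|nk] := eqVneq n k.
  rewrite ltn_eqF//=; transitivity ((c ^+ 2 + s ^+ 2) * Z k t); last by rewrite cs mul1r.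
  by ring.
have [->|nk1] := eqVneq n k.+1; last by rewrite /=; ring.
rewrite /=; transitivity ((c ^+ 2 + s ^+ 2) * Z k.+1 t); last by rewrite cs mul1r.
by ring.
Qed.

End givens.

(** * Conditional expectations in an i.i.d. Gaussian family *)

Section gaussian_families.
Context d (T : measurableType d) (R : realType) (P : probability T R).
Variable sigma : R.
Hypothesis sigma_gt0 : 0 < sigma.
Notation mR := (measurableTypeR R).
Notation gamma := (normal_prob 0 sigma).
Implicit Types (Z : nat -> T -> R) (B : nat -> set R).

Let gammaT : gamma setT = 1%E.
Proof. by rewrite /normal_prob integral_normal_pdf. Qed.

Lemma measurable_turn k c s Z : (forall i, measurable_fun setT (Z i)) ->
  forall i, measurable_fun setT (turn k c s Z i).
Proof.
move=> mZ i; rewrite /turn; case: eqP => _; last case: eqP => _ //.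
  by apply: measurable_funD; apply: measurable_funM.
by apply: measurable_funB; apply: measurable_funM.
Qed.

(** The joint law of two coordinates, on an event about the others, is a multiple of the product
    law: the two measures of the plane agree on rectangles. This form admits non-rectangular [X],
    such as rotated rectangles. *)
Lemma iid_pair k n B Z (X : set (mR * mR)) : iid P gamma Z -> (k.+1 < n)%N ->
  (forall i, measurable (B i)) -> B k = setT -> B k.+1 = setT -> measurable X ->
  P ((fun t => (Z k t, Z k.+1 t)) @^-1` X `&` box Z n B) =
  (P (box Z n B) * (gamma \x gamma) X)%E.
Proof.
move=> [mZ iidZ] kn mB Bk Bk1 mX.
have mp : measurable_fun setT (fun t => (Z k t, Z k.+1 t) : mR * mR).
  by apply/(@measurable_fun_pairP _ _ _ T mR mR); split; exact: mZ.
have mF := measurable_box n mZ mB.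
pose m1 := image_measure (mrestr P mF) mp.
have r0 : 0 <= fine (P (box Z n B)) by exact: fine_ge0.
pose m2 : {measure set (mR * mR) -> \bar R} := mscale (NngNum r0) (gamma \x gamma)%E.
have fP : P (box Z n B) = (fine (P (box Z n B)))%:E by rewrite fineK// fin_num_measure.
suff : m1 X = m2 X by rewrite /m1 /m2 /= /pushforward /mrestr /mscale /= -fP.
have GE := measurable_prod_measurableType mR mR.
set G := (X in <<s X >>) in GE.
have GT : G setT by exists setT => //; exists setT => //; rewrite setXTT.
have GI : setI_closed G.
  move=> _ _ [A1 mA1 [A2 mA2 <-]] [B1 mB1 [B2 mB2 <-]]; rewrite -setXI.
  by exists (A1 `&` B1); [exact: measurableI|exists (A2 `&` B2) => //; exact: measurableI].
pose g (i : nat) : set (mR * mR) := setT.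
have cover : \bigcup_k g k = setT by apply/seteqP; split => // x _; exists 0%N.
apply: (@measure_unique _ _ _ G g GE GI (fun=> GT) cover m1 m2) => //.
  move=> _ [A mA [A' mA' <-]]; rewrite /m1 /m2 /= /pushforward /mrestr /mscale /= -fP.
  rewrite product_measure1E//.
  pose B' i := if i == k then A else if i == k.+1 then A' else B i.
  have mB' i : measurable (B' i) by rewrite /B'; case: ifP => _; [exact: mA|case: ifP => _;
    [exact: mA'|exact: mB]].
  have k1n : (k < n)%N by rewrite ltnW.
  have -> : (fun t => (Z k t, Z k.+1 t)) @^-1` (A `*` A') `&` box Z n B = box Z n B'.
    apply/seteqP; split => t.
      move=> [[/= At At'] /box_mem h]; apply/box_mem => i ni; rewrite /B'.
      by case: eqP => [->//|_]; case: eqP => [->//|_]; exact: h.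
    move=> /box_mem h; split.
      split => /=; first by have := h k k1n; rewrite /B' eqxx.
      by have := h k.+1 kn; rewrite /B' eqxx gtn_eqF.
    apply/box_mem => i ni; have := h i ni; rewrite /B'.
    by case: eqP => [->|_]; [rewrite Bk|case: eqP => [->|//]; rewrite Bk1].
  rewrite !iidZ//.
  have kk : Ordinal kn != Ordinal k1n by apply/eqP => -[]; lia.
  rewrite (bigD1 (Ordinal k1n))//= (bigD1 (Ordinal kn))//=.
  rewrite [in RHS](bigD1 (Ordinal k1n))//= [in RHS](bigD1 (Ordinal kn))//= Bk Bk1.
    rewrite /B' eqxx gtn_eqF// eqxx gammaT !mul1e muleA muleC; congr (_ * _)%E.
  apply: eq_bigr => i /andP[ik ik1]; case: eqP => [E|_].
    by case/eqP: ik; exact: val_inj.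
  by case: eqP => [E|//]; case/eqP: ik1; exact: val_inj.
by move=> i; rewrite /m1 /= /pushforward /mrestr /g preimage_setT setTI fP ltry.
Qed.

(** A box for the turned family is a rotated rectangle for the coordinates [k] and [k.+1], together
    with an ordinary box for the others. *)
Lemma iid_turn k c s Z : iid P gamma Z -> s != 0 -> c ^+ 2 + s ^+ 2 = 1 ->
  iid P gamma (turn k c s Z).
Proof.
move=> iidZ s0 cs; have [mZ prodZ] := iidZ.
have mT := measurable_turn k c s mZ; split=> // n B mB.
wlog kn : n B mB / (k.+1 < n)%N.
  move=> H; have nm := leq_maxl n k.+2; rewrite (box_ext _ B nm) H//; last 2 first.
  - by move=> i; case: ifP.
  - by rewrite leq_max leqnn orbT.
  rewrite (big_ord_widen _ (fun i => gamma (B i)) nm) [RHS]big_mkcond.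
  by apply: eq_bigr => i _; case: ifP => // _.
pose B0 i := if (i == k) || (i == k.+1) then setT else B i.
have mB0 i : measurable (B0 i) by rewrite /B0; case: ifP.
have B0k : B0 k = setT by rewrite /B0 eqxx.
have B0k1 : B0 k.+1 = setT by rewrite /B0 eqxx orbT.
have k1n : (k < n)%N by rewrite ltnW.
have -> : box (turn k c s Z) n B =
    (fun t => (Z k t, Z k.+1 t)) @^-1` (rotation c s @^-1` (B k `*` B k.+1)) `&` box Z n B0.
  apply/seteqP; split => t.
    move=> /box_mem h; split.
      split; rewrite /rotation /=; first by have := h k k1n; rewrite /turn eqxx.
      by have := h k.+1 kn; rewrite /turn eqxx gtn_eqF.
    apply/box_mem => i ni; rewrite /B0; case: ifPn => // /norP[ik ik1].
    by have := h i ni; rewrite /turn (negbTE ik) (negbTE ik1).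
  move=> [[/= h1 h2] /box_mem h]; apply/box_mem => i ni; rewrite /turn.
  case: eqP => [->//|/eqP ik]; case: eqP => [->//|/eqP ik1].
  by have := h i ni; rewrite /B0 (negbTE ik) (negbTE ik1).
have mX : measurable (B k `*` B k.+1 : set (mR * mR)) by apply: (@measurableX _ _ mR mR); exact: mB.
rewrite (iid_pair iidZ)//; last first.
  by rewrite -[X in measurable X]setTI; exact: (measurable_rotation c s measurableT mX).
rewrite normal_rotation// ?gt_eqF// product_measure1E; [|exact: mB|exact: mB].
have -> : P (box Z n B0) = (\prod_(i < n) gamma (B0 i))%E by exact: prodZ.
rewrite /=.
have kk : Ordinal kn != Ordinal k1n by apply/eqP => -[]; lia.
rewrite (bigD1 (Ordinal k1n))//= (bigD1 (Ordinal kn))//= B0k B0k1 gammaT !mul1e.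
rewrite [in RHS](bigD1 (Ordinal k1n))//= [in RHS](bigD1 (Ordinal kn))//=.
rewrite muleA muleC; congr (_ * _)%E.
apply: eq_bigr => i /andP[ik ik1]; rewrite /B0; case: ifPn => // /orP[/eqP E|/eqP E].
  by case/eqP: ik; exact: val_inj.
by case/eqP: ik1; exact: val_inj.
Qed.

(* Givens rotations cancel the coefficients of u one after the other. *)
Lemma iid_align Z u : iid P gamma Z ->
  exists Z' (M : {poly R} -> {poly R}) a r,
    [/\ iid P gamma Z', linfn M, forall x y, dot (M x) (M y) = dot x y,
        forall x t, lincomb Z x t = lincomb Z' (M x) t & M u = r *: 'X^a].
Proof.
move=> iidZ; pose a := (size u).-1.
suff [Z' [M [iidZ' Ml Md Me [Mu Mu']]]] : exists Z' (M : {poly R} -> {poly R}),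
    [/\ iid P gamma Z', linfn M, forall x y, dot (M x) (M y) = dot x y,
        forall x t, lincomb Z x t = lincomb Z' (M x) t &
        (forall i, (i < a)%N -> (M u)`_i = 0) /\ (forall i, (a < i)%N -> (M u)`_i = 0)].
  exists Z', M, a, ((M u)`_a); split=> //; apply/polyP => i; rewrite coefZ coefXn.
  by have [ia|ia|->] := ltngtP i a; rewrite ?mulr1// mulr0 ?(Mu _ ia)// Mu'.
have : (a <= a)%N by []; elim: {1 3}a => [|j IH] ja.
  exists Z, id; split=> //; split=> // i ai; rewrite nth_default//.
  by move: ai; rewrite /a /=; case: (size u).
have [Z' [M [iidZ' Ml Md Me [Mu Mu']]]] := IH (ltnW ja).
(* A vanishing coefficient is set apart because [iid_turn] asks for [s != 0]. *)
have [Muj|Muj] := eqVneq (M u)`_j 0.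
  exists Z', M; split=> //; split=> // i; rewrite ltnS leq_eqVlt.
  by move=> /predU1P[->//|]; exact: Mu.
set al := (M u)`_j in Muj; pose be := (M u)`_j.+1.
pose r := Num.sqrt (al ^+ 2 + be ^+ 2).
have r2 : r ^+ 2 = al ^+ 2 + be ^+ 2 by rewrite sqr_sqrtr// addr_ge0 ?sqr_ge0.
have r0 : r != 0.
  have al2 : 0 < al ^+ 2 by rewrite exprn_even_gt0.
  by apply/eqP => rE; move: r2; rewrite rE expr0n /=; have := sqr_ge0 be; lra.
(* With these values [c * al + s * be = 0]: the weight of coefficient [j] passes to [j.+1]. *)
pose c := be / r; pose s := - al / r.
have cs : c ^+ 2 + s ^+ 2 = 1.
  by rewrite /c /s !expr_div_n sqrrN -mulrDl addrC -r2 divff// expf_neq0.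
have s0 : s != 0 by rewrite mulf_neq0 ?oppr_eq0 ?invr_eq0.
exists (turn j c s Z'), (givens j c s \o M); split.
- exact: iid_turn.
- by move=> b x y /=; rewrite Ml linfn_givens.
- by move=> x y /=; rewrite dot_givens.
- by move=> x t /=; rewrite lincomb_turn.
split=> i.
  rewrite ltnS leq_eqVlt /= coef_givens => /predU1P[->|ij].
    by rewrite eqxx -/al -/be /c /s; field.
  by rewrite ltn_eqF// ltn_eqF ?ltnS 1?ltnW// Mu.
move=> ai; rewrite /= coef_givens gtn_eqF ?(ltn_trans ja)//.
  by rewrite gtn_eqF ?(leq_ltn_trans ja)// Mu'.
Qed.

Lemma lincomb_adapted C Z (x : {poly R}) : sigma_algebra setT C ->
  (forall i, x`_i != 0 -> adapted C (Z i)) -> adapted C (lincomb Z x).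
Proof.
move=> sC CZ; rewrite /lincomb.
rewrite (_ : (fun _ => _) = fun t => \sum_(i <- index_enum 'I_(size x)) x`_i * Z i t); last first.
  by [].
elim: index_enum => [|i l IH].
  rewrite (_ : (fun _ => _) = fun=> 0); first exact: adapted_cst.
  by apply/funext => t; rewrite big_nil.
rewrite (_ : (fun _ => _) = fun t => x`_i * Z i t + \sum_(j <- l) x`_j * Z j t); last first.
  by apply/funext => t; rewrite big_cons.
have [->|xi] := eqVneq x`_i 0; last by apply: adapted_lin => //; exact: CZ.
by rewrite (_ : (fun _ => _) = fun t => \sum_(j <- l) x`_j * Z j t)//; apply/funext => t;
  rewrite mul0r add0r.
Qed.

Lemma integrable_iid Z i : iid P gamma Z -> P.-integrable setT (EFin \o Z i).
Proof.
move=> iidZ; have mZ := iidZ.1 i; apply/integrableP; split; first exact/measurable_EFinP.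
have := normal_abs_lty sigma_gt0.
have -> : (\int[gamma]_x `|x|%:E = \int[image_measure P (mZ : measurable_fun setT (Z i : T ->
  mR))]_x `|x|%:E)%E.
  by apply: eq_measure_integral => A mA _; apply/esym; exact: (iid_law gammaT).
rewrite ge0_integral_pushforward//.
by apply/measurable_EFinP; exact: normr_measurable.
Qed.

(** By independence the product of the indicator of [A] and [Z a] is again symmetric: off [A] it is
    0, and on [A] its law is a multiple of the centred normal law. So no product formula for
    expectations is called for. *)
Lemma integral_indep_iid Z a A : iid P gamma Z -> sigma_but a Z A ->
  (\int[P]_(t in A) (Z a t)%:E = 0)%E.
Proof.
move=> iidZ sA; have mZ := iidZ.1 a; have iZ := integrable_iid a iidZ.
have mA := sigma_on_measurable iidZ.1 sA.
pose Y t := \1_A t * Z a t.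
have mY : measurable_fun setT Y by apply: measurable_funM => //; exact: measurable_indic.
have -> : (\int[P]_(t in A) (Z a t)%:E = \int[P]_t (Y t)%:E)%E.
  rewrite integral_mkcond; apply: eq_integral => t _; rewrite /patch /Y indicE.
  by case: (t \in A); rewrite ?mul1r ?mul0r.
have law (f : R -> R) (B : set R) : (f 0 = 0) -> measurable B -> measurable (f @^-1` B) ->
    P ((f \o Y) @^-1` B) = (P A * gamma (f @^-1` B) + P (~` A `&` [set _ | B 0%R]))%E.
  move=> f0 mB mfB; rewrite -(iid_indep_but gammaT iidZ sA mfB) -measureU//.
  - congr (P _); apply/seteqP; split => t; rewrite /Y /=; have [tA|tA] := pselect (A t).
    + by rewrite indicE mem_set//= mul1r; left.
    + by rewrite indicE memNset//= mul0r f0; right.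
    + by rewrite indicE mem_set//= mul1r => -[[]|[]].
    + by rewrite indicE memNset//= mul0r f0 => -[[]|[]].
  - by apply: measurableI => //; rewrite -[X in measurable X]setTI; exact: mZ.
  - apply: measurableI; first exact: measurableC.
    have [B0|B0] := pselect (B 0).
      by rewrite (_ : [set _ | _] = setT)//; apply/seteqP; split.
    by rewrite (_ : [set _ | _] = set0)//; apply/seteqP; split.
  - by apply/seteqP; split=> // t [[At _] [nAt _]].
apply: symmetric_mean0 => [|B mB].
  apply: (le_integrable measurableT _ _ iZ); first exact/measurable_EFinP.
  move=> t _ /=; rewrite lee_fin /Y normrM ler_piMl// indicE.
  by case: (t \in A); rewrite ?normr1 ?normr0.
rewrite [LHS](law -%R) ?oppr0// ?normal_opp//.
  by apply/esym; exact: (law id B erefl mB mB).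
by rewrite -[X in measurable X]setTI; exact: oppr_measurable.
Qed.

Lemma integrable_lincomb Z x : iid P gamma Z -> P.-integrable setT (EFin \o lincomb Z x).
Proof.
move=> iidZ.
rewrite (_ : EFin \o _ = fun t => \sum_(i < size x) (x`_i)%:E * (Z i t)%:E)%E; last first.
  by apply/funext => t /=; rewrite /lincomb -sumEFin; apply: eq_bigr => i _; rewrite EFinM.
apply: integrable_sum => // i _; apply: integrableZl => //; exact: integrable_iid.
Qed.

Definition generated Z (W : {poly R} -> Prop) : set (set T) :=
  <<s [set A | exists w (B : set R), [/\ W w, measurable B & A = lincomb Z w @^-1` B]] >>.

(* Once [x - y] is a multiple of a single coordinate of a rotated family, the
   sigma-field only depends on the other coordinates. *)
Lemma condexp_proj Z W x y m : iid P gamma Z -> is_proj W x y ->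
  is_condexp P (generated Z W) (fun t => m + lincomb Z x t) (fun t => m + lincomb Z y t).
Proof.
move=> iidZ pxy; have [Wy xyW] := pxy.
have sG : sigma_algebra setT (generated Z W) by exact: smallest_sigma_algebra.
have im : P.-integrable setT (EFin \o (fun=> m)) by exact: finite_measure_integrable_cst.
have iv v : P.-integrable setT (EFin \o (fun t => m + lincomb Z v t)).
  by apply: (integrableD measurableT im (integrable_lincomb v iidZ)).
split => //.
  suff : adapted (generated Z W) (fun t => m + lincomb Z y t) by [].
  rewrite (_ : (fun _ => _) = fun t => 1 * lincomb Z y t + m); last first.
    by apply/funext => t; rewrite mul1r addrC.
  apply: adapted_lin => //; last exact: adapted_cst.
  elim: Wy => [|a w z Ww _ IH].
    rewrite (_ : lincomb Z 0 = fun=> 0); first exact: adapted_cst.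
    by apply/funext => t; rewrite lincomb0.
  rewrite (_ : lincomb Z _ = fun t => a * lincomb Z w t + lincomb Z z t); last first.
    by apply/funext => t; rewrite lincomb_lin.
  apply: adapted_lin => // B mB; apply: sub_sigma_algebra.
  by exists w, B.
move=> A GA; have [<-//|xy] := eqVneq x y.
have [Z' [M [a [r [iidZ' Ml Md Me Mu]]]]] := iid_align (x - y) iidZ.
have r0 : r != 0.
  apply: contra xy => /eqP r0; rewrite -subr_eq0; apply/eqP/dot_eq0.
  by rewrite -Md Mu r0 scale0r dot0l.
have sA : sigma_but a Z' A.
  have sB := sigma_on_algebra (predC1 a) Z'.
  apply: (smallest_sub sB _ GA) => _ [w [B [Ww mB ->]]].
  rewrite (_ : lincomb Z w = lincomb Z' (M w)); last by apply/funext => t; rewrite Me.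
  apply: lincomb_adapted mB => // i Mwi; apply: sigma_on_adapted.
  (* [M] preserves [dot] and sends [x - y] to [r *: 'X^a] with [r != 0], so a generator [w],
     orthogonal to [x - y], has no coefficient at [a] after rotation. *)
  rewrite /=; apply: contra Mwi => /eqP ->; rewrite -dotXnl.
  have := Md (x - y) w; rewrite Mu dotZl xyW// => /eqP; rewrite mulf_eq0 (negbTE r0).
  by [].
have mA := sigma_on_measurable iidZ'.1 sA.
have E t : m + lincomb Z x t = (m + lincomb Z y t) + r * Z' a t.
  have : lincomb Z (x - y) t = r * Z' a t by rewrite Me Mu lincombZ lincombXn.
  by rewrite lincombB; lra.
under [RHS]eq_integral do rewrite E EFinD.
have sub f : P.-integrable setT f -> P.-integrable A f by apply: integrableS.
have iZa := sub _ (integrable_iid a iidZ').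
rewrite integralD//; [|exact: sub (iv y)|]; last first.
  apply: (eq_integrable _ (fun t => r%:E * (Z' a t)%:E)%E) => //.
  exact: (integrableZl mA r iZa).
under [X in (_ + X)%E]eq_integral do rewrite EFinM.
by rewrite integralZl// (integral_indep_iid iidZ' sA) mule0 adde0.
Qed.

End gaussian_families.

(** * Independent families in a non-atomic sigma-field *)

Section sigma_algebra_closure.
Context (T : Type) (C : set (set T)).
Hypothesis sC : sigma_algebra setT C.

Lemma sa_set0 : C set0. Proof. by case: sC. Qed.

Lemma sa_setC A : C A -> C (~` A).
Proof. by case: sC => _ h _ /h; rewrite setTD. Qed.

Lemma sa_setU A B : C A -> C B -> C (A `|` B).
Proof.
by move=> CA CB; rewrite -bigcup2E; case: sC => _ _; apply => -[|[|i]] //=; exact: sa_set0.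
Qed.

Lemma sa_setI A B : C A -> C B -> C (A `&` B).
Proof. by move=> /sa_setC CA /sa_setC CB; rewrite -(setCK (A `&` B)) setCI;
  exact/sa_setC/sa_setU. Qed.

Lemma sa_setD A B : C A -> C B -> C (A `\` B).
Proof. by move=> CA /sa_setC CB; rewrite setDE; exact: sa_setI. Qed.

Lemma sa_setT : C setT.
Proof. by rewrite -setC0; exact/sa_setC/sa_set0. Qed.

Lemma sa_bigcap (F : nat -> set T) : (forall n, C (F n)) -> C (\bigcap_n F n).
Proof.
move=> CF; rewrite -(setCK (\bigcap_n F n)) setC_bigcap; apply: sa_setC.
by case: sC => _ _; apply => n; exact: sa_setC.
Qed.

End sigma_algebra_closure.

(** * Halving the sets of a non-atomic sigma-field *)

Section halving.
Context d (T : measurableType d) (R : realType) (P : probability T R).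
Variable C : set (set T).
Hypotheses (subC : sub_sigma_field C) (naC : non_atomic P C).

Let sC : sigma_algebra setT C. Proof. exact: subC.1. Qed.
Let mC A : C A -> measurable A. Proof. exact: subC.2. Qed.

Definition prob A : R := fine (P A).

Lemma probE A : measurable A -> P A = (prob A)%:E.
Proof. by move=> mA; rewrite fineK// fin_num_measure. Qed.

Lemma prob_ge0 A : 0 <= prob A. Proof. exact: fine_ge0. Qed.

Lemma le_prob A B : measurable A -> measurable B -> A `<=` B -> prob A <= prob B.
Proof.
by move=> mA mB AB; rewrite -lee_fin -!probE//; apply: le_measure => //; rewrite inE.
Qed.

Lemma probU A B : measurable A -> measurable B -> A `&` B = set0 ->
  prob (A `|` B) = prob A + prob B.
Proof.
move=> mA mB AB; apply: EFin_inj; rewrite EFinD -!probE//; last exact: measurableU.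
exact: measureU.
Qed.

Lemma probD A B : measurable A -> measurable B -> A `<=` B -> prob (B `\` A) = prob B - prob A.
Proof.
move=> mA mB AB; have mBA : measurable (B `\` A) by exact: measurableD.
rewrite -[in RHS](setDUK AB) probU//; first by ring.
by rewrite setDE setICA setICr setI0.
Qed.

Let C0 := sa_set0 sC.
Let CU := @sa_setU _ _ sC.
Let CD := @sa_setD _ _ sC.

Lemma split_set B : C B -> 0 < prob B ->
  exists A, [/\ C A, A `<=` B & 0 < prob A <= prob B / 2].
Proof.
move=> CB B0; have : ~ atomic_set P C B by exact: naC.
rewrite /atomic_set => na.
have [A [CA AB A0 AneB]] : exists A, [/\ C A, A `<=` B, P A <> 0%E & P A <> P B].
  apply: contrapT => h; apply: na; split => //; first by rewrite (probE (mC CB)) lte_fin.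
  move=> A CA AB; apply: contrapT => /not_orP[h1 h2]; apply: h.
  by exists A.
have mA := mC CA; have mB := mC CB.
have pA0 : 0 < prob A.
  rewrite lt_def prob_ge0 andbT; apply/eqP => pA; apply: A0.
  by rewrite probE// pA.
have pAB : prob A < prob B.
  rewrite lt_def le_prob// andbT; apply/eqP => pA; apply: AneB.
  by rewrite !probE// pA.
have [le|gt] := leP (prob A) (prob B / 2); first by exists A; rewrite pA0 le.
exists (B `\` A); split; [exact: CD|by move=> t []|].
by rewrite probD//; lra.
Qed.

Lemma small_set B e : C B -> 0 < prob B -> 0 < e ->
  exists A, [/\ C A, A `<=` B & 0 < prob A < e].
Proof.
move=> CB B0 e0; have step n : exists A, [/\ C A, A `<=` B & 0 < prob A <= prob B / 2 ^+ n].
  elim: n => [|n [A [CA AB /andP[A0 An]]]]; first by exists B; split => //;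
    rewrite B0 expr0 divr1 lexx.
  have [A' [CA' A'A /andP[A'0 A'n]]] := split_set CA A0.
  exists A'; split => //; first exact: subset_trans AB.
  by rewrite A'0 (le_trans A'n)// exprSr invfM mulrA ler_wpM2r// invr_ge0.
have [n ne] : exists n, prob B / 2 ^+ n < e.
  exists (Num.truncn (prob B / e)).+1.
  rewrite ltr_pdivrMr ?exprn_gt0// mulrC -ltr_pdivrMr//.
  apply: lt_le_trans (truncnS_gt _) _.
  by rewrite -natrX ler_nat ltnW// ltn_expl.
have [A [CA AB /andP[A0 An]]] := step n.
by exists A; rewrite A0 (le_lt_trans An).
Qed.

(** [E] is chosen to reach more than half of the supremum of the admissible measures. When this
    supremum is 0 the empty set does. *)
Lemma greedy_set B t A : C B -> C A -> A `<=` B -> prob A <= t ->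
  exists E, [/\ C E, E `<=` B `\` A, prob A + prob E <= t &
    forall E', C E' -> E' `<=` B `\` A -> prob A + prob E' <= t -> prob E' <= 2 * prob E].
Proof.
move=> CB CA AB At.
pose S := [set prob E | E in [set E | [/\ C E, E `<=` B `\` A & prob A + prob E <= t]]].
have prob0 : prob set0 = 0 by rewrite /prob measure0.
have S0 : S 0 by exists set0 => //; split => //; rewrite prob0 addr0.
have hS : has_sup S.
  split; first by exists 0.
  by exists (t - prob A) => _ [E [_ _ h] <-]; rewrite lerBrDl.
have [s0|s0] := leP (sup S) 0.
  exists set0; split => //; first by rewrite prob0 addr0.
  move=> E' CE' E'B E't; rewrite prob0 mulr0 (le_trans _ s0)//.
  by apply: sup_upper_bound => //; exists E'.
have s2 : 0 < sup S / 2 by rewrite divr_gt0.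
have [_ [E [CE EB Et] <-] EE] := sup_adherent s2 hS.
exists E; split => // E' CE' E'B E't.
have : prob E' <= sup S by apply: sup_upper_bound => //; exists E'.
by lra.
Qed.

(* Exhaustion: keep adding an admissible piece that has at least half the measure of
   any other one. *)
Lemma half_set B : C B -> exists A, [/\ C A, A `<=` B & prob A = prob B / 2].
Proof.
move=> CB; pose t := prob B / 2; have mB := mC CB.
have t0 : 0 <= t by rewrite divr_ge0// prob_ge0.
pose ok A := [/\ C A, A `<=` B & prob A <= t].
have /choice[g Hg] : forall A, exists E, ok A -> [/\ C E, E `<=` B `\` A, prob A + prob E <= t &
    forall E', C E' -> E' `<=` B `\` A -> prob A + prob E' <= t -> prob E' <= 2 * prob E].
  move=> A; have [[CA AB At]|nok] := pselect (ok A); last by exists set0.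
  by have [E ?] := greedy_set CB CA AB At; exists E.
pose A n := iter n (fun A => A `|` g A) set0.
have okA n : ok (A n).
  elim: n => [|n okn]; first by split => //; rewrite /A /= /prob measure0.
  have [CE EB Et _] := Hg _ okn; have [CA AB At] := okn.
  rewrite /A iterS -/(A n); split; [exact: CU|by move=> x [/AB|/EB[]]|].
  rewrite probU//; [exact: mC|exact: mC|].
  by apply/seteqP; split => // x [Ax /EB[]].
have mA n : measurable (A n) by have [/mC] := okA n.
have AS n : prob (A n.+1) = prob (A n) + prob (g (A n)).
  have [CE EB Et _] := Hg _ (okA n); rewrite /A iterS -/(A n) probU//; first exact: mC.
  by apply/seteqP; split => // x [Ax /EB[]].
pose Ao := \bigcup_n A n.
have CAo : C Ao by case: sC => _ _; apply => n; have [] := okA n.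
have mAo := mC CAo.
have AoB : Ao `<=` B by move=> x [n _]; have [_ + _] := okA n; exact.
have Aot : prob Ao <= t.
  rewrite -lee_fin -probE//.
  have ndA : nondecreasing_seq A.
    by apply/nondecreasing_seqP => n; apply/subsetPset => x Ax; left.
  have cv := @nondecreasing_cvg_mu _ _ _ P _ mA mAo ndA.
  rewrite -(cvg_lim _ cv)//; apply: lime_le; first exact: cvgP cv.
  by apply: nearW => n /=; rewrite probE// lee_fin; have [] := okA n.
exists Ao; split => //; apply/eqP; rewrite eq_le Aot /= leNgt; apply/negP => lt_t.
(* If the union stayed below half, some piece [E] of positive measure would still fit at every
   stage. Each greedy piece would then have measure at least [prob E / 2], and the sum of these
   would exceed [t]. *)
have BA0 : 0 < prob (B `\` Ao) by rewrite probD//; rewrite /t in t0 lt_t; lra.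
have e0 : 0 < t - prob Ao by rewrite subr_gt0.
have [E [CE EBA /andP[E0 Ee]]] := small_set (CD CB CAo) BA0 e0.
have grow n : prob E / 2 <= prob (g (A n)).
  have [_ _ _ h] := Hg _ (okA n).
  have : prob E <= 2 * prob (g (A n)).
    apply: h => //; first by move=> x /EBA[Bx nAo]; split => // Ax; apply: nAo; exists n.
    have : prob (A n) <= prob Ao by apply: le_prob => //; exact: bigcup_sup.
    by lra.
  by lra.
have lin n : n%:R * (prob E / 2) <= prob (A n).
  elim: n => [|n IH]; first by rewrite mul0r prob_ge0.
  by rewrite AS -natr1 mulrDl mul1r lerD.
pose n := (Num.truncn (t / (prob E / 2))).+1.
have : t < n%:R * (prob E / 2) by rewrite -ltr_pdivrMr ?divr_gt0//; exact: truncnS_gt.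
have [_ _ An] := okA n; have := lin n; lra.
Qed.

End halving.

(** * Independent fair bits *)

Section bits.
Context d (T : measurableType d) (R : realType) (P : probability T R).
Variable C : set (set T).
Hypothesis subC : sub_sigma_field C.
Variable h : set T -> set T.
Hypothesis hP : forall B, C B -> [/\ C (h B), h B `<=` B & prob P (h B) = prob P B / 2].

Let sC : sigma_algebra setT C. Proof. exact: subC.1. Qed.
Let mC A : C A -> measurable A. Proof. exact: subC.2. Qed.
Notation prob := (prob P).

(** A binary tree of successive halvings: the words of length n give a partition into cells of
    probability 2^-n. The head of a word is its latest choice. *)
Fixpoint cell (w : seq bool) : set T :=
  if w is b :: w' then (if b then h (cell w') else cell w' `\` h (cell w')) else setT.

Fixpoint word n (x : T) : seq bool :=
  if n is n'.+1 then `[< h (cell (word n' x)) x >] :: word n' x else [::].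

Definition bit n x : R := `[< h (cell (word n x)) x >]%:R.

Lemma cellC w : C (cell w).
Proof.
elim: w => [|b w IH] /=; first exact: sa_setT.
have [Ch _ _] := hP IH; case: b => //; exact: sa_setD.
Qed.

Lemma cellP w x : cell w x <-> word (size w) x = w.
Proof.
elim: w => [|b w IH] //=; have [_ hw _] := hP (cellC w).
split.
  case: b => [hx|cx].
    by rewrite (IH.1 (hw _ hx)) asboolT.
  by rewrite (IH.1 cx.1) asboolF//; exact: cx.2.
case.
move=> <- wE; have cx := IH.2 wE; rewrite wE.
by case: asboolP => // hx; split.
Qed.

Lemma word_event (S : pred (seq bool)) n :
  C [set x | S (word n x)] /\
  prob ([set x | S (word n x)] `&` bit n @^-1` [set 1]) = prob [set x | S (word n x)] / 2.
Proof.
set D := bit n @^-1` [set 1].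
have DE x : D x <-> h (cell (word n x)) x.
  by rewrite /D /bit /=; case: asboolP => hx; split => // /eqP; rewrite eq_sym oner_eq0.
(* Induction on the number [k] of choices still open. A cell of level [n] is halved by [h], and a
   coarser one is the disjoint union of its two children. *)
suff H k w : (size w + k = n)%N ->
    [/\ C (cell w `&` [set x | S (word n x)]), C (cell w `&` [set x | S (word n x)] `&` D) &
    prob (cell w `&` [set x | S (word n x)] `&` D) = prob (cell w `&` [set x | S (word n x)]) / 2].
  by have [] := H n [::] erefl; rewrite /= !setTI.
elim: k w => [|k IH] w wn.
  rewrite addn0 in wn; have [Chw hw hw2] := hP (cellC w).
  have cE x : cell w x -> word n x = w by rewrite -wn => /cellP.
  have [Sw|Sw] := boolP (S w).
    have -> : cell w `&` [set x | S (word n x)] = cell w.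
      by apply/seteqP; split => [x []//|x cx]; split => //=; rewrite cE.
    have -> : cell w `&` D = h (cell w).
      apply/seteqP; split => x; first by move=> [cx /DE]; rewrite cE.
      by move=> hx; split; [exact: hw|apply/DE; rewrite cE//; exact: hw].
    by split => //; exact: cellC.
  have -> : cell w `&` [set x | S (word n x)] = set0.
    by apply/seteqP; split => x // [] /cE /= ->; rewrite (negbTE Sw).
  by rewrite set0I /prob measure0 mul0r; split => //; exact: sa_set0.
have [C1 CD1 E1] := IH (true :: w) (etrans (addSnnS _ _) wn).
have [C0 CD0 E0] := IH (false :: w) (etrans (addSnnS _ _) wn).
have [_ hw _] := hP (cellC w).
have cE : cell w = cell (true :: w) `|` cell (false :: w) by rewrite /= setDUK.
have c0 : cell (true :: w) `&` cell (false :: w) = set0 by rewrite /= setDIK.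
rewrite cE !setIUl; split; [exact: sa_setU|exact: sa_setU|].
rewrite !probU; try exact: mC; first by rewrite E1 E0 mulrDl.
- by rewrite setIACA c0 set0I.
- by rewrite setIACA [X in X `&` _]setIACA c0 !set0I.
Qed.

Lemma bit_event (S : pred (seq bool)) n (B : set R) :
  C ([set x | S (word n x)] `&` bit n @^-1` B) /\
  prob ([set x | S (word n x)] `&` bit n @^-1` B) =
  prob [set x | S (word n x)] * (`[< B 1 >]%:R / 2 + `[< B 0 >]%:R / 2).
Proof.
have [CS S1] := word_event S n.
have CD : C (bit n @^-1` [set 1]).
  have [+ _] := word_event (head false) n.+1.
  rewrite (_ : [set x | _] = bit n @^-1` [set 1])//.
  apply/seteqP; split => x; rewrite /bit /=; first by move=> ->.
  by case: asboolP => // _ /eqP; rewrite eq_sym oner_eq0.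
set A := [set x | _] in CS S1 *; set D := bit n @^-1` [set 1] in CD S1.
have CAD : C (A `&` D) by exact: sa_setI.
have probAD : prob (A `\` D) = prob A / 2.
  have -> : A `\` D = A `\` (A `&` D) by rewrite setDIr setDv set0U.
  rewrite probD; [|exact: mC|exact: mC|by move=> x []].
  by rewrite S1; lra.
have bitE x : bit n x = 1 \/ bit n x = 0.
  by rewrite /bit; case: asboolP => _; [left|right].
case: (asboolP (B 1)) => B1; case: (asboolP (B 0)) => B0.
- have -> : A `&` bit n @^-1` B = A.
    by apply/seteqP; split => x; [case|move=> Ax; split => //=; case: (bitE x) => ->].
  by split => //; rewrite /=; lra.
- have -> : A `&` bit n @^-1` B = A `&` D.
    apply/seteqP; split => x [Ax] /=; split => //; last by rewrite /D /= in b *; rewrite b.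
    by case: (bitE x) => // E; rewrite E in b.
  by split => //; rewrite S1 /=; lra.
- have -> : A `&` bit n @^-1` B = A `\` D.
    apply/seteqP; split => x [Ax] /= b; split => //.
      by rewrite /D /= => E; rewrite E in b.
    by case: (bitE x) => // ->.
  by split; [exact: sa_setD|rewrite probAD /=; lra].
- have -> : A `&` bit n @^-1` B = set0.
    by apply/seteqP; split => x // [_ /=]; case: (bitE x) => ->.
  by split; [exact: sa_set0|rewrite /prob measure0 /=; lra].
Qed.

Lemma bit_adapted n : adapted C (bit n).
Proof.
by move=> B _; have [+ _] := bit_event xpredT n B; rewrite [X in X `&` _](_ : _ = setT) ?setTI//;
  apply/seteqP; split.
Qed.

Lemma measurable_bit n : measurable_fun setT (bit n).
Proof. by apply/adapted_measurable => B mB; apply: mC; exact: bit_adapted. Qed.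

Definition fair (B : set R) : \bar R := P (bit 0 @^-1` B).

Lemma fairT : fair setT = 1%E.
Proof. by rewrite /fair preimage_setT probability_setT. Qed.

Lemma fairE (B : set R) : measurable B -> fair B = (`[< B 1 >]%:R / 2 + `[< B 0 >]%:R / 2)%:E.
Proof.
move=> mB; have [_] := bit_event xpredT 0 B.
have -> : [set x | xpredT (word 0 x)] = setT by apply/seteqP; split.
have -> : prob setT = 1 by rewrite /prob probability_setT.
rewrite setTI mul1r => <-; rewrite -probE//; apply: mC; exact: bit_adapted.
Qed.

Lemma iid_bit : iid P fair bit.
Proof.
split=> [n|n B mB]; first exact: measurable_bit.
(* The latest bit is at the head, so its index is the size of the tail. *)
pose ok := fix ok (w : seq bool) := if w is b :: w' then `[< B (size w') (b%:R : R) >] && ok w'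
  else true.
have size_word m x : size (word m x) = m by elim: m => //= m ->.
have boxE m : box bit m B = [set x | ok (word m x)].
  elim: m => [|m IH]; first by rewrite /box big_ord0; apply/seteqP; split.
  have -> : box bit m.+1 B = box bit m B `&` bit m @^-1` B m by rewrite /box big_ord_recr.
  rewrite IH; apply/seteqP; split => x /=; rewrite size_word.
    by move=> [-> Bx]; rewrite andbT; exact/asboolP.
  by move=> /andP[/asboolP].
elim: n => [|n IH]; first by rewrite /box !big_ord0 probability_setT.
have -> : box bit n.+1 B = box bit n B `&` bit n @^-1` B n by rewrite /box big_ord_recr.
have [CA E] := bit_event ok n (B n).
rewrite big_ord_recr /= -IH boxE (probE P (mC CA)) E EFinM -fairE//; congr (_ * _)%E.
by rewrite -probE//; apply: mC; have [] := word_event ok n.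
Qed.

End bits.

Lemma adapted_halflines d (T : measurableType d) (R : realType) (C : set (set T)) (f : T -> R) :
  sigma_algebra setT C -> (forall t, C [set x | f x <= t]) -> adapted C f.
Proof.
move=> sC Cf B mB; have CE : <<s C >> = C by exact: sigma_algebra_id.
have : (measurable : set (set R)) `<=` [set B | C (f @^-1` B)].
  have -> : (measurable : set (set R)) = <<s @RGenOInfty.G R >>.
    exact: RGenOInfty.measurableE.
  apply: smallest_sub => [|_ [t ->]] /=.
    split => /=.
    - by rewrite preimage_set0; exact: sa_set0.
    - by move=> A CA; rewrite setTD preimage_setC; exact: sa_setC.
    - by move=> F CF; rewrite preimage_bigcup; case: sC => _ _; exact.
  rewrite (_ : f @^-1` _ = ~` [set x | f x <= t]); first exact: sa_setC.
  apply/seteqP; split => x /=; rewrite in_itv /= andbT ltNge; first by move/negP.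
  by move=> ?; exact/negP.
exact.
Qed.

(** * Uniform variables from fair bits *)

Section uniform.
Context d (T : measurableType d) (R : realType) (P : probability T R).
Variables (mu : set R -> \bar R) (b : nat -> T -> R).
Hypotheses (muT : mu setT = 1%E) (iidb : iid P mu b).
Hypotheses (b01 : forall i x, b i x = 1 \/ b i x = 0).
Hypotheses (mu1 : mu [set 1] = (2^-1)%:E) (mu0 : mu [set 0] = (2^-1)%:E).
Notation prob := (prob P).

(* The distribution function of the uniform law on [0, 1]. *)
Definition clamp (y : R) : R := Num.min 1 (Num.max 0 y).

Lemma clamp_le0 y : y <= 0 -> clamp y = 0.
Proof. by move=> y0; rewrite /clamp (max_idPl y0) (min_idPr ler01). Qed.

Lemma clamp_ge1 y : 1 <= y -> clamp y = 1.
Proof.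
by move=> y1; rewrite /clamp (max_idPr (le_trans ler01 y1)) (min_idPl y1).
Qed.

Lemma clamp_id y : 0 <= y <= 1 -> clamp y = y.
Proof. by move=> /andP[y0 y1]; rewrite /clamp (max_idPr y0) (min_idPr y1). Qed.

Lemma clamp01 y : 0 <= clamp y <= 1.
Proof. by rewrite /clamp le_min ge_min lexx ler01 le_max lexx. Qed.

(** Self-similarity of the uniform law: half a fair bit plus half an independent uniform variable is
    uniform. *)
Lemma clamp_double y : (clamp (2 * y) + clamp (2 * y - 1)) / 2 = clamp y.
Proof.
have [y0|y0] := leP y 0; first by rewrite !clamp_le0; lra.
have [y1|y1] := leP 1 y; first by rewrite !clamp_ge1; lra.
rewrite [RHS]clamp_id; last by lra.
have [y2|y2] := leP y 2^-1.
  by rewrite clamp_id ?[clamp (_ - 1)]clamp_le0; lra.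
by rewrite clamp_ge1 ?clamp_id; lra.
Qed.

Lemma clamp_lip y e : 0 <= e -> clamp (y + e) <= clamp y + e.
Proof.
move=> e0; have [ye|ye] := leP (y + e) 0.
  by rewrite clamp_le0//; have /andP[? ?] := clamp01 y; lra.
have [y1|y1] := leP 1 y.
  by rewrite [clamp y]clamp_ge1//; have /andP[? ?] := clamp01 (y + e); lra.
have [y0|y0] := leP y 0.
  rewrite [clamp y]clamp_le0//; have [ye1|ye1] := leP 1 (y + e).
    by rewrite clamp_ge1; lra.
  by rewrite clamp_id; lra.
rewrite [clamp y]clamp_id; last by lra.
have [ye1|ye1] := leP 1 (y + e); first by rewrite clamp_ge1; lra.
by rewrite clamp_id; lra.
Qed.

Definition expansion (s : nat -> nat) n x := \sum_(i < n) b (s i) x / 2 ^+ i.+1.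

Lemma expansionS s n x :
  expansion s n.+1 x = b (s 0%N) x / 2 + expansion (s \o succn) n x / 2.
Proof.
rewrite /expansion big_ord_recl expr1 mulr_suml; congr (_ + _).
by apply: eq_bigr => i _; rewrite /= /bump leq0n add1n exprS; field; rewrite expf_neq0.
Qed.

Lemma expansion_adapted (S : pred nat) s n : (forall i, S (s i)) ->
  adapted (sigma_on S b) (expansion s n).
Proof.
move=> Ss; have sS := sigma_on_algebra S b; rewrite /expansion; elim: n => [|n IH].
  rewrite (_ : (fun _ => _) = fun=> 0); first exact: adapted_cst.
  by apply/funext => x; rewrite big_ord0.
rewrite (_ : (fun _ => _) = fun x => (2 ^+ n.+1)^-1 * b (s n) x + \sum_(i < n) b (s i) x / 2 ^+
  i.+1).
  by apply: adapted_lin => //; exact: sigma_on_adapted.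
by apply/funext => x; rewrite big_ord_recr /= addrC mulrC.
Qed.

Let mb i : measurable_fun setT (b i). Proof. exact: iidb.1. Qed.

Lemma measurable_le (f : T -> R) t : measurable_fun setT f -> measurable [set x | f x <= t].
Proof.
move=> mf; rewrite (_ : [set x | _] = f @^-1` `]-oo, t]); last first.
  by apply/seteqP; split => x /=; rewrite in_itv.
by rewrite -[X in measurable X]setTI; exact: mf.
Qed.

Lemma measurable_expansion s n : measurable_fun setT (expansion s n).
Proof.
apply/adapted_measurable => B mB; apply: (@sigma_on_measurable _ _ _ xpredT b) => //.
exact: expansion_adapted.
Qed.

(** According to the first bit, the threshold [t] becomes [2 * t] or [2 * t - 1] for the remaining
    ones, and [clamp_double] averages the two bounds. The gap 2^-n accounts for the missing
    digits. *)
Lemma expansion_cdf n s t : injective s ->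
  clamp t <= prob [set x | expansion s n x <= t] <= clamp (t + 2^-1 ^+ n).
Proof.
elim: n s t => [|n IH] s t inj_s.
  have -> : [set x | expansion s 0 x <= t] = [set _ | 0 <= t].
    by apply/seteqP; split => x; rewrite /expansion /= big_ord0.
  rewrite expr0; have [t0|t0] := leP 0 t.
    rewrite (_ : [set _ | _] = setT); last by apply/seteqP; split.
    rewrite /prob probability_setT /= [clamp (t + 1)]clamp_ge1; last by lra.
    by have /andP[] := clamp01 t; lra.
  rewrite (_ : [set _ | _] = set0); last by apply/seteqP; split.
  rewrite /prob measure0 /= [clamp t]clamp_le0; last by lra.
  by have /andP[] := clamp01 (t + 1); lra.
pose s' := s \o succn; have inj_s' : injective s' by move=> i j /inj_s [].
pose A (u : R) := [set x | expansion s' n x <= u].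
have mA u : measurable (A u) by exact/measurable_le/measurable_expansion.
have mB (B : set R) : measurable B -> measurable (b (s 0%N) @^-1` B).
  by move=> mB; rewrite -[X in measurable X]setTI; exact: mb.
have indep u v : prob (A u `&` b (s 0%N) @^-1` [set v]) = prob (A u) * fine (mu [set v]).
  rewrite /prob (iid_indep_but (a := s 0%N) muT iidb)//.
    rewrite fineM ?fin_num_measure// -(iid_law muT (s 0%N) iidb)//.
    by rewrite fin_num_measure//; exact: mB.
  have := @expansion_adapted (predC1 (s 0%N)) s' n.
  move=> /(_ _ `]-oo, u]%classic); rewrite (_ : _ @^-1` `]-oo, u] = A u); first apply => //.
    by move=> i; rewrite /= (inj_eq inj_s).
  by apply/seteqP; split => x /=; rewrite in_itv.
have -> : [set x | expansion s n.+1 x <= t] =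
    (A (2 * t) `&` b (s 0%N) @^-1` [set 0]) `|` (A (2 * t - 1) `&` b (s 0%N) @^-1` [set 1]).
  apply/seteqP; split => x /=; rewrite expansionS -/s'.
    by case: (b01 (s 0%N) x) => E; rewrite E => h; [right|left]; split => //; rewrite /A /=; lra.
  by rewrite /A /= => -[[h ->]|[h ->]]; lra.
rewrite probU.
- rewrite !indep mu0 mu1 /=.
  have := IH s' (2 * t) inj_s'; have := IH s' (2 * t - 1) inj_s'.
  rewrite -/(A _) -/(A (2 * t)) -!(clamp_double t) -(clamp_double (t + _)).
  have -> : 2 * (t + 2^-1 ^+ n.+1) - 1 = 2 * t - 1 + 2^-1 ^+ n by rewrite exprS; lra.
  have -> : 2 * (t + 2^-1 ^+ n.+1) = 2 * t + 2^-1 ^+ n by rewrite exprS; lra.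
  by move=> /andP[? ?] /andP[? ?]; lra.
- by apply: measurableI => //; exact: mB.
- by apply: measurableI => //; exact: mB.
- apply/seteqP; split => // x [[_ /= ->] [_ /=]] /eqP.
  by rewrite eq_sym oner_eq0.
Qed.

(** The partial sums increase, so the supremum is the sum of the series, and its sublevel sets are
    countable intersections. *)
Definition unif (s : nat -> nat) x : R := sup (range (fun n => expansion s n x)).

Lemma expansion_le s n m x : (n <= m)%N ->
  expansion s n x <= expansion s m x <= expansion s n x + 2^-1 ^+ n - 2^-1 ^+ m.
Proof.
move=> nm; rewrite -(subnKC nm); elim: (m - n)%N => [|k IH].
  by rewrite addn0 lexx; lra.
rewrite addnS /expansion big_ord_recr /= -/(expansion s (n + k) x) -/(expansion s n x).
have p0 : 0 < 2^-1 ^+ (n + k) :> R by rewrite exprn_gt0.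
have E : 2^-1 ^+ (n + k).+1 = 2^-1 ^+ (n + k) / 2 :> R by rewrite exprS mulrC.
rewrite -exprVn E.
by case: (b01 (s (n + k)%N) x) => ->; move/andP: IH => [? ?]; lra.
Qed.

Lemma unif_bounds s n x : expansion s n x <= unif s x <= expansion s n x + 2^-1 ^+ n.
Proof.
have ub : ubound (range (fun n => expansion s n x)) (expansion s n x + 2^-1 ^+ n).
  move=> _ [m _ <-]; have p0 k : 0 < 2^-1 ^+ k :> R by rewrite exprn_gt0.
  have := p0 m; have := p0 n.
  have [nm|/ltnW mn] := leqP n m.
    by have /andP[] := expansion_le s x nm; lra.
  by have /andP[] := expansion_le s x mn; lra.
apply/andP; split; last by apply: sup_le_ub => //; exists (expansion s 0 x), 0%N.
by apply: sup_upper_bound; [split; [exists (expansion s 0 x), 0%N|eexists; exact: ub]|exists n].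
Qed.

Lemma unif_adapted (S : pred nat) s : (forall i, S (s i)) -> adapted (sigma_on S b) (unif s).
Proof.
move=> Ss; apply: adapted_halflines; first exact: sigma_on_algebra.
move=> t; have -> : [set x | unif s x <= t] = \bigcap_n (expansion s n @^-1` `]-oo, t]).
  apply/seteqP; split => x /=.
    move=> ut n _; rewrite /= in_itv /=; have /andP[h _] := unif_bounds s n x.
    exact: le_trans ut.
  move=> h; apply: sup_le_ub; first by exists (expansion s 0 x), 0%N.
  by move=> _ [n _ <-]; have := h n I; rewrite /= in_itv.
apply: sa_bigcap; first exact: sigma_on_algebra.
by move=> n; apply: expansion_adapted.
Qed.

Lemma measurable_unif s : measurable_fun setT (unif s).
Proof.
apply/adapted_measurable => B mB; apply: (@sigma_on_measurable _ _ _ xpredT b) => //.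
exact: unif_adapted.
Qed.

Lemma unif_cdf s t : injective s -> prob [set x | unif s x <= t] = clamp t.
Proof.
move=> inj_s.
have mU u : measurable [set x | unif s x <= u] by exact/measurable_le/measurable_unif.
have mE n u : measurable [set x | expansion s n x <= u].
  exact/measurable_le/measurable_expansion.
have bounds n : clamp t - 2^-1 ^+ n <= prob [set x | unif s x <= t] <= clamp t + 2^-1 ^+ n.
  have p0 : 0 <= 2^-1 ^+ n :> R by rewrite exprn_ge0.
  apply/andP; split.
    have /andP[h _] := expansion_cdf n (t - 2^-1 ^+ n) inj_s.
    have := clamp_lip (t - 2^-1 ^+ n) p0; rewrite subrK => h2.
    apply: (@le_trans _ _ (prob [set x | expansion s n x <= t - 2^-1 ^+ n])); first by lra.
    apply: le_prob => // x /= ht; have /andP[_] := unif_bounds s n x; lra.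
  have /andP[_ h] := expansion_cdf n t inj_s.
  apply: le_trans (clamp_lip t p0); apply: le_trans h.
  apply: le_prob => // x /= ht; have /andP[h _] := unif_bounds s n x; lra.
have small e : 0 < e -> exists n, 2^-1 ^+ n <= e :> R.
  move=> e0; exists (Num.truncn e^-1).+1.
  rewrite exprVn invf_ple ?posrE ?exprn_gt0//.
  apply: (le_trans (ltW (truncnS_gt _))).
  by rewrite -natrX ler_nat ltnW// ltn_expl.
apply/eqP; rewrite eq_le; apply/andP; split; apply/ler_addgt0Pr => e /small[n ne];
  have /andP[h1 h2] := bounds n; lra.
Qed.

End uniform.

(** * The quantile transform *)

Section quantile.
Context d (T : measurableType d) (R : realType) (P : probability T R).
Variables (X : {RV P >-> R}).
Notation prob := (prob P).

Definition dist_fun (t : R) : R := fine (cdf X t).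

Let cdfE t : cdf X t = (dist_fun t)%:E.
Proof.
by rewrite fineK// ge0_fin_numE ?cdf_ge0// (le_lt_trans (cdf_le1 X t))// ltry.
Qed.

Lemma dist_fun_nd s t : s <= t -> dist_fun s <= dist_fun t.
Proof. by move=> st; rewrite -lee_fin -!cdfE; exact: cdf_nondecreasing. Qed.

Lemma dist_fun_large u : u < 1 -> exists t, u <= dist_fun t.
Proof.
move=> u1; apply: contrapT => /forallNP h.
have h' t : dist_fun t <= u by rewrite leNgt; apply/negP => /ltW; exact: h.
have : (1%:E <= u%:E :> \bar R)%E; last by rewrite lee_fin leNgt u1.
have cv := cvg_cdfy1 X.
rewrite -(cvg_lim _ cv)//; apply: lime_le; first exact: cvgP cv.
by apply: nearW => t; rewrite cdfE lee_fin.
Qed.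

Lemma dist_fun_small u : 0 < u -> exists t, dist_fun t < u.
Proof.
move=> u0; apply: contrapT => /forallNP h.
have h' t : u <= dist_fun t by rewrite leNgt; apply/negP; exact: h.
have : (u%:E <= 0 :> \bar R)%E; last by rewrite lee_fin leNgt u0.
have cv := cvg_cdfNy0 X.
rewrite -(cvg_lim _ cv)//; apply: lime_ge; first exact: cvgP cv.
by apply: nearW => t; rewrite cdfE lee_fin.
Qed.

Lemma dist_fun_right u t : (forall e, 0 < e -> u <= dist_fun (t + e)) -> u <= dist_fun t.
Proof.
move=> h; rewrite -lee_fin -cdfE.
have cv : cdf X x @[x --> t^'+] --> cdf X t by exact: (@cdf_right_continuous _ _ _ P X t).
rewrite -(cvg_lim _ cv)//; apply: lime_ge; first exact: cvgP cv.
near=> x; rewrite cdfE lee_fin -(subrKC t x); apply: h.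
by rewrite subr_gt0; near: x; exact: nbhs_right_gt.
Unshelve. all: by end_near. Qed.

Definition quantile u := inf [set t | u <= dist_fun t].

(** The Galois connection between quantiles and distribution function. For 0 < u < 1 the set under
    the infimum is nonempty and bounded below, and right continuity makes it contain its infimum. *)
Lemma quantile_le u t : 0 < u < 1 -> (quantile u <= t) = (u <= dist_fun t).
Proof.
move=> /andP[/dist_fun_small[a Fa] /dist_fun_large[b Fb]].
have lb : lbound [set t | u <= dist_fun t] a.
  move=> s /= us; rewrite leNgt; apply/negP => /ltW /dist_fun_nd; lra.
have hinf : has_inf [set t | u <= dist_fun t] by split; [exists b|exists a].
apply/idP/idP => [qt|ut]; last by apply: ge_inf => //; exists a.
apply: le_trans (dist_fun_nd qt); apply: dist_fun_right => e e0.
have [s us sq] := inf_adherent e0 hinf.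
by apply: le_trans us _; apply: dist_fun_nd; exact: ltW.
Qed.

Variable U : T -> R.
Hypotheses (mU : measurable_fun setT U) (U_cdf : forall t, prob [set x | U x <= t] = clamp t).

(* Outside ]0, 1[, where [U] almost surely does not lie, [quantile] is the [inf] of a
   set that is empty or not bounded below. *)
Definition quantile_transform x : R := if 0 < U x < 1 then quantile (U x) else 0.

Lemma quantile_transform_adapted C : sigma_algebra setT C -> adapted C U ->
  adapted C quantile_transform.
Proof.
move=> sC CU; apply: adapted_halflines => // t.
have CUt : C (U @^-1` `]-oo, dist_fun t]) by exact: CU.
have CI : C (U @^-1` `]0, 1[) by exact: CU.
have -> : [set x | quantile_transform x <= t] =
    (U @^-1` `]0, 1[ `&` U @^-1` `]-oo, dist_fun t]) `|`
    (~` (U @^-1` `]0, 1[) `&` [set _ | 0 <= t]).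
  apply/seteqP; split => x; rewrite /quantile_transform /= !in_itv /=.
    by case: ifPn => U01; [rewrite quantile_le//; left|right].
  by move=> [[U01]|[/negP/negbTE ->//]]; rewrite U01 quantile_le.
apply: sa_setU => //; first exact: sa_setI.
apply: sa_setI => //; first exact: sa_setC.
have [t0|t0] := leP 0 t.
  by rewrite (_ : [set _ | _] = setT); [exact: sa_setT|apply/seteqP; split].
by rewrite (_ : [set _ | _] = set0); [exact: sa_set0|apply/seteqP; split].
Qed.

Let aU : adapted measurable U. Proof. exact/adapted_measurable. Qed.

Lemma measurable_quantile_transform : measurable_fun setT quantile_transform.
Proof.
by apply/adapted_measurable; apply: quantile_transform_adapted => //;
  exact: sigma_algebra_measurable.
Qed.

Let prob_out : prob (~` (U @^-1` `]0, 1[)) = 0.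
Proof.
have mI : measurable (U @^-1` `]0, 1[) by exact: aU.
have m0 t : measurable [set x | U x <= t] by exact: measurable_le.
apply/eqP; rewrite eq_le prob_ge0 andbT; apply/ler_addgt0Pr => e e0; rewrite add0r.
have p1 t : prob (~` [set x | U x <= t]) = 1 - clamp t.
  rewrite -setTD probD//; first by rewrite U_cdf /prob probability_setT.
apply: (@le_trans _ _ (prob ([set x | U x <= 0] `|` ~` [set x | U x <= 1 - e]))).
  apply: le_prob; [exact: measurableC|apply: measurableU => //; exact: measurableC|].
  move=> x /=; rewrite in_itv /= => /negP; rewrite negb_and -!leNgt => /orP[?|?]; first by left.
  by right => /=; lra.
apply: (@le_trans _ _ (clamp 0 + (1 - clamp (1 - e)))).
  rewrite -U_cdf -p1 -lee_fin EFinD -!probE//; last 2 first.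
  - exact: measurableC.
  - by apply: measurableU => //; exact: measurableC.
  apply: measureU2 => //; exact: measurableC.
rewrite clamp_le0//; have := @clamp_lip R (1 - e) e (ltW e0).
by rewrite subrK clamp_ge1//; lra.
Qed.

(** Where [U] lies in ]0, 1[, [quantile_le] identifies the two events; the null set where it does
    not is added on either side. *)
Lemma quantile_transform_cdf t : prob [set x | quantile_transform x <= t] = dist_fun t.
Proof.
have mV := measurable_quantile_transform.
have mI : measurable (U @^-1` `]0, 1[) by exact: aU.
have mO : measurable (~` (U @^-1` `]0, 1[)) by exact: measurableC.
have m0 s : measurable [set x | U x <= s] by exact: measurable_le.
have mVt : measurable [set x | quantile_transform x <= t] by exact: measurable_le.
have F01 : 0 <= dist_fun t <= 1.
  by rewrite -!lee_fin -!cdfE cdf_ge0 cdf_le1.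
have U2 A B : measurable A -> measurable B -> prob (A `|` B) <= prob A + prob B.
  move=> mA mB; rewrite -lee_fin EFinD -!probE//; [exact: measureU2|exact: measurableU].
apply/eqP; rewrite eq_le; apply/andP; split.
  apply: (@le_trans _ _ (prob ([set x | U x <= dist_fun t] `|` ~` (U @^-1` `]0, 1[)))).
    apply: le_prob => //; first exact: measurableU.
    move=> x; rewrite /quantile_transform /= in_itv /=; case: ifPn => U01; last by right.
    by rewrite quantile_le//; left.
  by rewrite (le_trans (U2 _ _ _ _))// prob_out addr0 U_cdf clamp_id.
rewrite -(clamp_id F01) -U_cdf.
apply: (@le_trans _ _ (prob ([set x | quantile_transform x <= t] `|` ~` (U @^-1` `]0, 1[)))).
  apply: le_prob => //; first exact: measurableU.
  move=> x /= Ux; rewrite in_itv /= /quantile_transform; case: ifPn => U01; last by right.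
  by left; rewrite quantile_le.
by rewrite (le_trans (U2 _ _ _ _))// prob_out addr0.
Qed.

Lemma quantile_transform_law (B : set R) : measurable B ->
  P (quantile_transform @^-1` B) = distribution P X B.
Proof.
move=> mB; have mV := measurable_quantile_transform.
have mX : measurable_fun setT X by exact: measurable_funP.
pose m1 := image_measure P mV.
pose m2 := image_measure P mX.
suff : m1 B = m2 B by [].
have GE := RGenOInfty.measurableE R.
pose g (k : nat) : set R := `](- k%:R), +oo[%classic.
have cover : \bigcup_k g k = setT.
  apply/seteqP; split => // x _; exists (Num.truncn `|x|).+1 => //.
  rewrite /g /= in_itv /= andbT ltrNl; apply: le_lt_trans (truncnS_gt _).
  by rewrite -normrN ler_norm.
apply: (measure_unique _ g GE _ _ cover m1 m2) => //.
- move=> _ _ [x ->] [y ->]; exists (Num.max x y).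
  by apply/seteqP; split => z /=; rewrite !in_itv /= !andbT gt_max => /andP.
- by move=> k; exists (- k%:R).
- move=> _ [t ->].
  have E (f : T -> R) : measurable_fun setT f -> P (f @^-1` `]t, +oo[) =
    (1 - prob [set x | f x <= t])%:E.
    move=> mf; have mft : measurable [set x | f x <= t] by exact: measurable_le.
    have -> : f @^-1` `]t, +oo[ = ~` [set x | f x <= t].
      by apply/seteqP; split => x /=; rewrite in_itv /= andbT ltNge => /negP.
    by rewrite probability_setC// EFinB -probE.
  rewrite /m1 /m2 /= /pushforward E// E// quantile_transform_cdf /dist_fun.
  by congr (_ - _)%:E; rewrite /prob /cdf /distribution /pushforward; congr (fine (P _)).
move=> k; rewrite /m1 /= /pushforward.
have mg : measurable (g k) by exact: measurable_itv.
rewrite (le_lt_trans (probability_le1 _ _)) ?ltry//.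
by rewrite -[X in measurable X]setTI; exact: (mV measurableT _ mg).
Qed.

End quantile.

(** * An i.i.d. sequence with a prescribed law *)

Section nonatomic.
Context d (T : measurableType d) (R : realType) (P : probability T R).

Lemma sigma_on_sub (S : pred nat) (Z : nat -> T -> R) C :
  sigma_algebra setT C -> (forall i, adapted C (Z i)) -> sigma_on S Z `<=` C.
Proof.
move=> sC CZ; apply: smallest_sub => // _ [n [B [mB _ ->]]].
rewrite /box; elim: n => [|n IH]; first by rewrite big_ord0; exact: sa_setT.
by rewrite big_ord_recr /=; apply: sa_setI => //; exact: CZ.
Qed.

Lemma nonatomic_iid (X : {RV P >-> R}) C : sub_sigma_field C -> non_atomic P C ->
  exists V : nat -> T -> R, (forall i, adapted C (V i)) /\ iid P (distribution P X) V.
Proof.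
move=> subC naC; have sC := subC.1.
have /choice[h hP] : forall B, exists A, C B -> [/\ C A, A `<=` B & prob P A = prob P B / 2].
  move=> B; have [CB|nCB] := pselect (C B); last by exists set0.
  by have [A ?] := half_set subC naC CB; exists A.
pose b := bit R h; pose mu := fair P h.
have iidb : iid P mu b := iid_bit subC hP.
have muT : mu setT = 1%E := fairT P h.
have b01 i x : b i x = 1 \/ b i x = 0.
  by rewrite /b /bit; case: asboolP => _; [left|right].
have mu1 : mu [set 1] = (2^-1)%:E.
  rewrite /mu (fairE subC hP)//= asboolT// asboolF ?mul0r ?addr0 ?mul1r//.
  by move=> /eqP; rewrite eq_sym oner_eq0.
have mu0 : mu [set 0] = (2^-1)%:E.
  rewrite /mu (fairE subC hP)//= asboolF ?asboolT ?mul0r ?add0r ?mul1r//.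
  by move=> /eqP; rewrite oner_eq0.
(* The bits are dealt into infinitely many disjoint rows, and each row makes one uniform
   variable. *)
pose s (j i : nat) := pickle (j, i).
have inj_s j : injective (s j) by move=> i i' /(pcan_inj pickleK) [].
pose U j := unif b (s j).
have mU j : measurable_fun setT (U j) by exact: (measurable_unif iidb b01).
have U_cdf j t : prob P [set x | U j x <= t] =
  clamp t by exact: (unif_cdf muT iidb b01 mu1 mu0 t (inj_s j)).
pose V j := quantile_transform X (U j).
pose row j : pred nat := fun q => `[< exists i, q = s j i >].
have Vrow (S : pred nat) j : (forall i, S (s j i)) -> adapted (sigma_on S b) (V j).
  move=> Ss; apply: quantile_transform_adapted; first exact: sigma_on_algebra.
  exact: unif_adapted.
exists V; split=> [i B mB|].
  have bC j : adapted C (b j) by exact: (bit_adapted subC hP).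
  apply: (sigma_on_sub sC bC (S := xpredT)).
  exact: Vrow.
split=> [i|n B mB].
  by apply: measurable_quantile_transform.
elim: n => [|n IH]; first by rewrite /box !big_ord0 probability_setT.
(* [S] gathers the first [n] rows, which carry the box so far. Row [n] is disjoint from them, hence
   independent. *)
pose S : pred nat := fun q => `[< exists j i, (j < n)%N /\ q = s j i >].
have -> : box V n.+1 B = box V n B `&` V n @^-1` B n by rewrite /box big_ord_recr.
rewrite (iid_indep_on (S := S) (S' := row n) muT iidb).
- by rewrite big_ord_recr /= -IH (quantile_transform_law X (mU n) (U_cdf n)).
- move=> q; apply/negP => /andP[/asboolP[j [i [jn ->]]] /asboolP[i' /(pcan_inj pickleK)[jE _]]].
  by rewrite jE ltnn in jn.
- suff Hbox m : (m <= n)%N -> sigma_on S b (box V m B) by exact: Hbox.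
  rewrite /box; elim: m => [_|m IHm mn].
    by rewrite big_ord0; exact: (sa_setT (sigma_on_algebra S b)).
  rewrite big_ord_recr /=; apply: (sa_setI (sigma_on_algebra S b)); first by apply: IHm;
    exact: ltnW.
  by apply: Vrow => // i; apply/asboolP; exists m, i.
- by apply: Vrow => // i; apply/asboolP; exists i.
Qed.

End nonatomic.

(** * Convergence in probability *)

Section versions.
Context d (T : measurableType d) (R : realType) (P : probability T R).
Implicit Types (G : set (set T)) (X Y : T -> R).

(** The event Y > Y' belongs to [G], so both variables have the same integral on it, although their
    difference is positive there. *)
Lemma condexp_ae_le G X X' Y Y' : sub_sigma_field G ->
  is_condexp P G X Y -> is_condexp P G X' Y' ->
  {ae P, forall t, X t = X' t} -> {ae P, forall t, Y t <= Y' t}.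
Proof.
move=> [sG Gm] [iX iY GY eY] [iX' iY' GY' eY'] XX'.
pose D t := Y t - Y' t; pose A := D @^-1` `]0, +oo[.
have GA : G A.
  have : adapted G (fun t => -1 * Y' t + Y t) by exact: adapted_lin.
  rewrite (_ : (fun _ => _) = D); first exact.
  by apply/funext => t; rewrite /D mulN1r addrC.
have mA := Gm _ GA.
have sub f : P.-integrable setT f -> P.-integrable A f by exact: integrableS.
have XE : (\int[P]_(t in A) (X t)%:E = \int[P]_(t in A) (X' t)%:E)%E.
  apply: ae_eq_integral => //.
  - by have := measurable_int _ (sub _ iX).
  - by have := measurable_int _ (sub _ iX').
  by apply: filterS XX' => t E _; rewrite E.
have mD : measurable_fun A (EFin \o D).
  have := emeasurable_funB (measurable_int _ (sub _ iY)) (measurable_int _ (sub _ iY')).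
  exact.
have : (\int[P]_(t in A) `|(D t)%:E| = 0)%E.
  transitivity (\int[P]_(t in A) ((Y t)%:E - (Y' t)%:E))%E.
    apply: eq_integral => t /set_mem; rewrite /A /= in_itv /= andbT => D0.
    by rewrite gtr0_norm.
  rewrite integralB//; [|exact: sub iY|exact: sub iY'].
  rewrite eY// eY'// XE subee//; apply: integrable_fin_num => //.
  exact: sub iX'.
move=> /(ae_eq_integral_abs P mA mD); apply: filterS => t /= h.
rewrite leNgt; apply/negP => YY'.
have At : A t by rewrite /A /= in_itv /= andbT subr_gt0.
by have := h At; move=> [] /eqP; rewrite subr_eq0 gt_eqF.
Qed.

Lemma condexp_ae_eq G X X' Y Y' : sub_sigma_field G ->
  is_condexp P G X Y -> is_condexp P G X' Y' ->
  {ae P, forall t, X t = X' t} -> {ae P, forall t, Y t = Y' t}.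
Proof.
move=> sG cY cY' XX'.
have X'X : {ae P, forall t, X' t = X t} by apply: filterS XX'.
have := condexp_ae_le sG cY' cY X'X; have := condexp_ae_le sG cY cY' XX'.
by apply: filterS2 => t le1 le2; apply/eqP; rewrite eq_le le1.
Qed.

(** Conditional expectations are determined up to null sets only; this passes from one explicit
    sequence of versions to all of them. *)
Lemma iterated_condexp_ae_eq (C : 'I_3 -> set (set T)) (k : nat -> 'I_3)
    (X0 : T -> R) (X X' : nat -> T -> R) : (forall i, sub_sigma_field (C i)) ->
  iterated_condexp P C k X0 X -> iterated_condexp P C k X0 X' ->
  forall n, {ae P, forall t, X n t = X' n t}.
Proof.
move=> sC [X00 XS] [X'0 X'S]; elim=> [|n IH].
  by rewrite X00 X'0; exact: aeW.
exact: condexp_ae_eq (sC _) (XS n.+1 isT) (X'S n.+1 isT) IH.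
Qed.

End versions.

Section nonconvergence.
Context d (T : measurableType d) (R : realType) (P : probability T R).

(** A sequence converging in probability is Cauchy in probability: when [X p] and [X q] are at
    distance [delta], one of them is at distance at least [delta / 2] from the limit. *)
Lemma not_converges_in_probability (X : nat -> T -> R) (delta kappa : R) :
  0 < delta -> 0 < kappa -> (forall n, measurable_fun setT (X n)) ->
  (forall N, exists p q, [/\ (N <= p)%N, (N <= q)%N &
    (kappa%:E <= P [set t | delta <= `|X p t - X q t|]%R)%E]) ->
  ~ converges_in_probability P X.
Proof.
move=> delta0 kappa0 mX far [Y cvY].
have d20 : 0 < delta / 2 by rewrite divr_gt0.
have /fine_cvgP[_] := cvY _ d20.
move=> /cvgrPdist_lt/(_ (kappa / 2))[|N _ near0]; first by rewrite divr_gt0.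
have [p [q [Np Nq]]] := far N.
have mY : measurable_fun setT Y by [].
pose E n := [set t | delta / 2 <= `|X n t - Y t|].
have mE n : measurable (E n).
  by apply: measurable_norm_ge; exact: measurable_funB.
have close n : (N <= n)%N -> (P (E n) < (kappa / 2)%:E)%E.
  move=> Nn; have := near0 n Nn; rewrite /= -/(E n) sub0r normrN ger0_norm ?fine_ge0//.
  by rewrite -lte_fin fineK// fin_num_measure//; exact: mE.
move=> far_pq; have : (kappa%:E < kappa%:E)%E; last by rewrite ltxx.
have sum : (P (E p) + P (E q)
    < kappa%:E)%E.
  by rewrite [X in (_ < X%:E)%E](splitr kappa) EFinD; apply: lteD; exact: close.
apply: le_lt_trans far_pq _; apply: le_lt_trans sum; apply: le_trans (measureU2 _ _ _) => //.
apply: le_measure; rewrite ?inE//; first by apply: measurable_norm_ge; exact: measurable_funB.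
  exact: measurableU.
move=> t /= dXX; apply/orP; rewrite leNgt [X in _ || X]leNgt -negb_and.
apply/negP => /andP[h1 h2]; have := ler_distD (Y t) (X p t) (X q t).
by rewrite [`|Y t - _|]distrC; lra.
Qed.

End nonconvergence.

(** * Joining [X0] to the family, and passage to probabilities *)

Section insertion.
Context d (T : measurableType d) (R : realType) (P : probability T R).
Variable mu : set R -> \bar R.
Hypothesis muT : mu setT = 1%E.

(** The given variable takes the place of [V a]. A box over the other indices lies in [C], of which
    [X] is independent. *)
Lemma iid_insert (C : set (set T)) (X : T -> R) (V : nat -> T -> R) a :
  sigma_algebra setT C -> (forall i, adapted C (V i)) -> iid P mu V ->
  measurable_fun setT X ->
  (forall A (B : set R), C A -> measurable B -> P (A `&` X @^-1` B) = P A * mu B)%E ->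
  iid P mu (fun i => if i == a then X else V i).
Proof.
move=> sC CV [mV prodV] mX indep; split=> [i|n B mB]; first by case: ifP.
wlog an : n B mB / (a < n)%N.
  move=> H; have nm := leq_maxl n a.+1; rewrite (box_ext _ B nm) H//; last 2 first.
  - by move=> i; case: ifP.
  - by rewrite leq_max leqnn orbT.
  rewrite (big_ord_widen _ (fun i => mu (B i)) nm) [RHS]big_mkcond.
  by apply: eq_bigr => i _; case: ifP.
pose B' i := if i == a then setT else B i.
have mB' i : measurable (B' i) by rewrite /B'; case: ifP.
have -> : box (fun i => if i == a then X else V i) n B = box V n B' `&` X @^-1` B a.
  apply/seteqP; split => t.
    move=> /box_mem h; split; last by have := h a an; rewrite eqxx.
    by apply/box_mem => i ni; rewrite /B'; have := h i ni; case: eqP.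
  move=> [/box_mem h Xt]; apply/box_mem => i ni; have := h i ni; rewrite /B'.
  by case: eqP => [->|].
rewrite indep//; last first.
  apply: (sigma_on_sub sC CV (S := xpredT)); apply: sub_sigma_algebra.
  by exists n, B'; split.
rewrite prodV// (bigD1 (Ordinal an))//= [in RHS](bigD1 (Ordinal an))//= muleC /B' eqxx muT mul1e.
congr (_ * _)%E; apply: eq_bigr => i ia; case: eqP => // E.
by case/eqP: ia; exact: val_inj.
Qed.

End insertion.

Section gaussian_sequence.
Context d (T : measurableType d) (R : realType) (P : probability T R).

Lemma iid_eq (mu nu : set R -> \bar R) (V : nat -> T -> R) :
  (forall B, measurable B -> mu B = nu B) -> iid P mu V -> iid P nu V.
Proof.
move=> mnu [mV prodV]; split=> // n B mB.
by rewrite prodV//; apply: eq_bigr => i _; exact: mnu.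
Qed.

(** The quantile transform is applied to the law of the centred [X0] itself, so the new variables
    have the deviation of [X0] and it can join them at index [a0]. *)
Lemma gaussian_family (X0 : {RV P >-> R}) C a0 : gaussian X0 ->
  sub_sigma_field C -> non_atomic P C -> independent_of_RV C X0 ->
  exists m s (Z : nat -> T -> R), [/\ 0 < s, iid P (normal_prob 0 s) Z &
    forall t, X0 t = m + Z a0 t].
Proof.
move=> [m [s [s0 lawX]]] subC naC indep.
pose Y t := X0 t - m.
have mY : measurable_fun setT Y by exact: measurable_funB.
pose RY : {RV P >-> R} := HB.pack_for {RV P >-> R} Y (isMeasurableFun.Build _ _ _ _ _ mY).
have lawY (B : set R) : measurable B -> distribution P RY B = normal_prob 0 s B.
  move=> mB; rewrite -(normal_shift s0 m mB) -lawX//.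
  rewrite -[X in measurable X]setTI; apply: measurable_funB => //.
have [V [CV iidV]] := nonatomic_iid RY subC naC.
have sT : normal_prob 0 s setT = 1%E by rewrite /normal_prob integral_normal_pdf.
exists m, s, (fun i => if i == a0 then Y else V i); split=> //.
  have iidV' := iid_eq lawY iidV. apply: (iid_insert sT a0 subC.1 CV iidV' mY).
  move=> A B CA mB; rewrite -lawY//.
  apply: (indep A ((fun x => x - m) @^-1` B)) => //.
  by rewrite -[X in measurable X]setTI; apply: measurable_funB.
by move=> t; rewrite eqxx /Y addrC subrK.
Qed.

Lemma ae_le_measure (A A' : set T) : measurable A -> measurable A' ->
  {ae P, forall t, A t -> A' t} -> (P A <= P A')%E.
Proof.
move=> mA mA' AA'; have mD : measurable (A `\` A') by exact: measurableD.
have D0 : P (A `\` A') = 0%E.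
  apply: measure_negligible => //; apply: negligibleS AA' => t /= [At A't].
  by move=> /(_ At).
apply: (@le_trans _ _ (P (A' `|` (A `\` A')))).
  apply: le_measure; rewrite ?inE//; first exact: measurableU.
  by move=> t At; have [?|?] := pselect (A' t); [left|right].
by apply: le_trans (measureU2 _ _ _) _ => //; rewrite [X in (_ + X)%E]D0 adde0.
Qed.

Lemma measurable_lincomb (Z : nat -> T -> R) x : (forall i, measurable_fun setT (Z i)) ->
  measurable_fun setT (lincomb Z x).
Proof.
move=> mZ; apply/adapted_measurable; apply: lincomb_adapted; first exact: sigma_algebra_measurable.
by move=> i _; apply/adapted_measurable.
Qed.

Lemma generated_sub_sigma_field (Z : nat -> T -> R) W :
  (forall i, measurable_fun setT (Z i)) -> sub_sigma_field (generated Z W).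
Proof.
move=> mZ; split; first exact: smallest_sigma_algebra.
apply: smallest_sub; first exact: sigma_algebra_measurable.
move=> _ [w [B [_ mB ->]]].
by have /adapted_measurable := measurable_lincomb w mZ; exact.
Qed.

(** After alignment the difference is [r * Z' a] with |r| = [len (x - y)], at least [delta]; it is
    large as soon as |Z' a| >= 1, an event whose probability depends on [s] only. *)
Lemma lincomb_far (Z : nat -> T -> R) (s delta : R) x y : 0 < s -> iid P (normal_prob 0 s) Z ->
  delta <= len (x - y) -> 0 < delta ->
  (normal_prob 0 s [set u | 1 <= `|u|]%R <=
   P [set t | delta <= `|lincomb Z x t - lincomb Z y t|]%R)%E.
Proof.
move=> s0 iidZ dxy delta0.
have [Z' [M [a [r [iidZ' Ml Md Me Mu]]]]] := iid_align s0 (x - y) iidZ.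
have sT : normal_prob 0 s setT = 1%E by rewrite /normal_prob integral_normal_pdf.
have dr : delta <= `|r|.
  rewrite -ler_sqr ?nnegrE ?normr_ge0 ?(ltW delta0)// real_normK ?num_real//.
  have -> : r ^+ 2 = len (x - y) ^+ 2.
    by rewrite sqr_len -Md Mu dotZl dotC dotZl dotXnl coefXn eqxx mulr1.
  by rewrite ler_sqr ?nnegrE// (le_trans (ltW delta0)).
have mZ' := iidZ'.1 a.
have ZE t : lincomb Z x t - lincomb Z y t =
  r * Z' a t by rewrite -lincombB Me Mu lincombZ lincombXn.
rewrite -(iid_law sT a iidZ'); last first.
  exact: (@measurable_norm_ge _ (measurableTypeR R) R id).
apply: le_measure; rewrite ?inE.
- exact: measurable_norm_ge mZ'.
- rewrite (_ : [set t | _] = [set t | delta <= `|r * Z' a t|]).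
    by apply: measurable_norm_ge; exact: measurable_funM.
  by apply/seteqP; split=> t /=; rewrite ZE.
by move=> t /= h; rewrite ZE normrM (le_trans dr)// ler_peMr.
Qed.

End gaussian_sequence.

Theorem theorem1p1 (R : realType) :
  exists k : nat -> 'I_3,
  forall (d : measure_display) (T : measurableType d) (P : probability T R)
    (X0 : {RV P >-> R}),
  gaussian X0 ->
  (exists C : set (set T),
      [/\ sub_sigma_field C, non_atomic P C & independent_of_RV C X0]) ->
  exists C : 'I_3 -> set (set T),
    [/\ forall i : 'I_3, sub_sigma_field (C i),
        exists X : nat -> T -> R, iterated_condexp P C k X0 X
      & forall X : nat -> T -> R,
          iterated_condexp P C k X0 X -> ~ converges_in_probability P X].
Proof.
have [W [k [a0 [delta [delta0 tot far]]]]] := strange_projections R.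
(* The projections are numbered from 0, the conditional expectations from 1. *)
exists (fun n => k n.-1) => d T P X0 gX0 [C [subC naC indep]].
have [m [s [Z [s0 iidZ X0E]]]] := gaussian_family a0 gX0 subC naC indep.
have /choice[proj projP] : forall ix : 'I_3 * {poly R}, exists y, is_proj (W ix.1) ix.2 y.
  by case=> i x; exact: tot.
pose x := fix x n := if n is n.+1 then proj (k n, x n) else 'X^a0.
have xP n : is_proj (W (k n)) (x n) (x n.+1) by exact: projP (k n, x n).
pose X n t := m + lincomb Z (x n) t.
have itX : iterated_condexp P (fun i => generated Z (W i)) (fun n => k n.-1) X0 X.
  split; first by apply/funext => t; rewrite /X lincombXn X0E.
  by case=> // n _; exact: (condexp_proj s0 m iidZ (xP n)).
have sG i : sub_sigma_field (generated Z (W i)) by exact: generated_sub_sigma_field iidZ.1.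
exists (fun i => generated Z (W i)); split=> //; first by exists X.
move=> X' itX'; pose kappa := fine (normal_prob 0 s [set u | 1 <= `|u|]).
have kE : normal_prob 0 s [set u | 1 <= `|u|] = kappa%:E.
  rewrite fineK// fin_num_measure//.
  exact: (@measurable_norm_ge _ (measurableTypeR R) R id).
have mX' n : measurable_fun setT (X' n).
  case: n => [|n]; first by rewrite itX'.1.
  by have [_ /measurable_int/measurable_EFinP] := itX'.2 n.+1 isT.
have XX' n : {ae P, forall t, X n t = X' n t} by exact: iterated_condexp_ae_eq sG itX itX' n.
apply: (not_converges_in_probability (delta := delta) (kappa := kappa)) => //.
  by rewrite -lte_fin -kE; exact: normal_tail_gt0.
move=> N; have [p [q [Np Nq dpq]]] := far x erefl xP N.
exists p, q; split=> //; rewrite -kE (le_trans (lincomb_far s0 iidZ dpq delta0))//.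
have mX n : measurable_fun setT (X n).
  by apply: measurable_funD => //; exact: measurable_lincomb iidZ.1.
have evX t : lincomb Z (x p) t - lincomb Z (x q) t = X p t - X q t by rewrite /X; ring.
under eq_set do rewrite evX.
apply: ae_le_measure; last by apply: filterS2 (XX' p) (XX' q) => t /= -> ->.
  by apply: measurable_norm_ge; exact: measurable_funB.
by apply: measurable_norm_ge; exact: measurable_funB.
Qed.
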